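(* Let $\mathfrak g=(\mathfrak s^*\oplus_\delta\mathfrak h)\rtimes_\delta\mathfrak s$ be the double extension of a metric Lie algebra $\mathfrak h$ by a simple real Lie algebra $\mathfrak s$. If $\mathfrak g$ is conformally Einstein, then $\mathfrak s$ is isomorphic to $\mathfrak{sl}_2\mathbb R$ or to $\mathfrak{so}(3)$.
   Context: A metric Lie algebra is a finite-dimensional real Lie algebra with a non-degenerate symmetric $\mathrm{ad}$-invariant bilinear form (any signature); it defines a bi-invariant semi-Riemannian metric $\mathrm g$ on the simply connected Lie group $G$ with this Lie algebra. The metric Lie algebra is conformally Einstein if $\mathrm g$ is locally conformally equivalent to an Einstein metric on $G$, i.e. each point of $G$ has a neighbourhood $U$ and a function $\varphi\in C^\infty(U)$ such that $e^{2\varphi}\mathrm g$ is Einstein (Ricci tensor a possibly vanishing multiple of the metric) on $U$. Double extension: let $(\mathfrak h,\langle\cdot,\cdot\rangle_{\mathfrak h})$ be a metric Lie algebra, $\mathfrak s$ a Lie algebra with an $\mathrm{ad}$-invariant (possibly degenerate or zero) symmetric bilinear form $\mathrm b$, and $\delta:\mathfrak s\to\mathfrak{der}(\mathfrak h)\cap\mathfrak{so}(\mathfrak h)$, $S\mapsto\delta_S$, a Lie algebra homomorphism into the skew-symmetric derivations. Then $\mathfrak g=\mathfrak s^*\oplus\mathfrak h\oplus\mathfrak s$ as a vector space, with bracket $$[(\sigma,X,S),(\hat\sigma,\hat X,\hat S)]=\big(\mathrm{ad}^*_S\hat\sigma-\mathrm{ad}^*_{\hat S}\sigma+\langle\delta_\bullet(X),\hat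 X\rangle_{\mathfrak h},\ [X,\hat X]+\delta_S(\hat X)-\delta_{\hat S}(X),\ [S,\hat S]\big),$$ where $\mathrm{ad}^*_S\sigma=-\sigma\circ\mathrm{ad}_S$ and $\langle\delta_\bullet(X),\hat X\rangle_{\mathfrak h}\in\mathfrak s^*$ is $T\mapsto\langle\delta_T(X),\hat X\rangle_{\mathfrak h}$, and with scalar product $\langle(\sigma,X,S),(\hat\sigma,\hat X,\hat S)\rangle=\langle X,\hat X\rangle_{\mathfrak h}+\mathrm b(S,\hat S)+\sigma(\hat S)+\hat\sigma(S)$. *)

(* Defs.v *)
From HB Require Import structures.
From mathcomp Require Import all_boot all_order all_algebra.
From mathcomp Require Import all_classical all_reals all_analysis.
From mathcomp Require Import ring lra.

Set Implicit Arguments.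
Unset Strict Implicit.
Unset Printing Implicit Defensive.
Import Order.TTheory GRing.Theory Num.Theory.
Import numFieldNormedType.Exports.
Local Open Scope classical_set_scope.
Local Open Scope ring_scope.

(** * Real Lie algebras *)

Record lieAlgebra (R : realType) := LieAlgebra {
  lie_space :> vectType R;
  lb : lie_space -> lie_space -> lie_space;
  lb_linl : forall y, linear (lb^~ y);
  lb_linr : forall x, linear (lb x);
  lb_alt : forall x, lb x x = 0;
  lb_jacobi : forall x y z, lb x (lb y z) + lb y (lb z x) + lb z (lb x y) = 0 }.

Definition ad (R : realType) (L : lieAlgebra R) (x : L) : 'End(L) :=
  linfun (lb x).

Definition lie_iso (R : realType) (L L' : lieAlgebra R) : Prop :=
  exists f : L -> L', [/\ linear f, bijective f
    & forall x y, f (lb x y) = lb (f x) (f y)].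

Definition lie_ideal (R : realType) (L : lieAlgebra R) (I : {vspace L}) : Prop :=
  forall x y : L, y \in I -> lb x y \in I.

Definition lie_simple (R : realType) (L : lieAlgebra R) : Prop :=
  (exists x y : L, lb x y != 0) /\
  (forall I : {vspace L}, lie_ideal I -> I = 0%VS \/ I = fullv).

Lemma linfun_linE (R : realType) (V W : vectType R) (f : V -> W) :
  linear f -> linfun f =1 f.
Proof.
move=> fl x; pose F : {linear V -> W} := HB.pack f (GRing.isLinear.Build R V W *:%R f fl).
exact: (lfunE F x).
Qed.

Section LieTheory.
Variables (R : realType) (L : lieAlgebra R).
Implicit Types x y z : L.

Lemma lbDl x y z : lb (x + y) z = lb x z + lb y z.
Proof. by have := lb_linl z 1 x y; rewrite !scale1r. Qed.
Lemma lbDr x y z : lb x (y + z) = lb x y + lb x z.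
Proof. by have := lb_linr x 1 y z; rewrite !scale1r. Qed.
Lemma lb0l x : lb 0 x = 0.
Proof. by apply: (addrI (lb 0 x)); rewrite -lbDl !addr0. Qed.
Lemma lb0r x : lb x 0 = 0.
Proof. by apply: (addrI (lb x 0)); rewrite -lbDr !addr0. Qed.
Lemma lbZl a x y : lb (a *: x) y = a *: lb x y.
Proof. by have := lb_linl y a x 0; rewrite !addr0 lb0l addr0. Qed.
Lemma lbZr a x y : lb x (a *: y) = a *: lb x y.
Proof. by have := lb_linr x a y 0; rewrite !addr0 lb0r addr0. Qed.
Lemma lbC x y : lb x y = - lb y x.
Proof.
apply/eqP; rewrite -addr_eq0; apply/eqP.
by have := lb_alt (x + y); rewrite lbDl !lbDr !lb_alt addr0 add0r.
Qed.
Lemma adE x y : ad x y = lb x y.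
Proof. exact: (linfun_linE (lb_linr x)). Qed.

End LieTheory.

(** ** Subalgebras of [gl_n], in particular [sl_2(R)] and [so(3)] *)

Section MatrixLie.
Variables (R : realType) (n : nat).

Definition comm_br (A B : 'M[R]_n) : 'M[R]_n := A *m B - B *m A.

Variables (V : {vspace 'M[R]_n})
  (closedV : forall A B, A \in V -> B \in V -> comm_br A B \in V).

Definition sub_br (x y : subvs_of V) : subvs_of V :=
  Subvs (closedV (subvsP x) (subvsP y)).

Fact sub_br_linl y : linear (sub_br^~ y).
Proof.
move=> a x x'; apply: val_inj; rewrite /= /comm_br mulmxDl mulmxDr -scalemxAl.
by rewrite -scalemxAr scalerBr opprD addrACA.
Qed.
Fact sub_br_linr x : linear (sub_br x).
Proof.
move=> a y y'; apply: val_inj; rewrite /= /comm_br mulmxDl mulmxDr -scalemxAl.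
by rewrite -scalemxAr scalerBr opprD addrACA.
Qed.
Fact sub_br_alt x : sub_br x x = 0.
Proof. by apply: val_inj; rewrite /= /comm_br subrr. Qed.
Fact sub_br_jacobi x y z :
  sub_br x (sub_br y z) + sub_br y (sub_br z x) + sub_br z (sub_br x y) = 0.
Proof.
apply: val_inj => /=; rewrite /comm_br.
move: (vsval x) (vsval y) (vsval z) => A B C.
rewrite !mulmxBr !mulmxBl !mulmxA.
apply/matrixP => i j; rewrite !mxE; ring.
Qed.

Definition matrix_lie : lieAlgebra R :=
  LieAlgebra sub_br_linl sub_br_linr sub_br_alt sub_br_jacobi.

End MatrixLie.

Section Classical.
Variable R : realType.

Definition sl_space n : {vspace 'M[R]_n} :=
  lker (linfun (fun A : 'M[R]_n => \tr A : R^o)).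
Definition so_space n : {vspace 'M[R]_n} :=
  lker (linfun (fun A : 'M[R]_n => A + A^T)).

Lemma sl_spaceP n (A : 'M[R]_n) : (A \in sl_space n) = (\tr A == 0).
Proof.
rewrite memv_ker linfun_linE // => a B C.
by rewrite mxtraceD mxtraceZ.
Qed.
Lemma so_spaceP n (A : 'M[R]_n) : (A \in so_space n) = (A^T == - A).
Proof.
rewrite memv_ker linfun_linE ?addr_eq0 1?eqr_oppLR 1?eq_sym//.
  by rewrite eq_sym -eqr_oppLR eq_sym.
move=> a B C; rewrite linearD linearZ /= scalerDr.
by rewrite addrACA.
Qed.

Fact sl_closed n (A B : 'M[R]_n) :
  A \in sl_space n -> B \in sl_space n -> comm_br A B \in sl_space n.
Proof. by move=> _ _; rewrite sl_spaceP linearB /= mxtrace_mulC subrr. Qed.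
Fact so_closed n (A B : 'M[R]_n) :
  A \in so_space n -> B \in so_space n -> comm_br A B \in so_space n.
Proof.
rewrite !so_spaceP /comm_br => /eqP hA /eqP hB.
by rewrite linearB /= !trmx_mul hA hB !mulmxN !mulNmx !opprK opprB.
Qed.

Definition sl_lie n : lieAlgebra R := matrix_lie (@sl_closed n).
Definition so_lie n : lieAlgebra R := matrix_lie (@so_closed n).

End Classical.

(** * Metric Lie algebras and double extensions *)

(* Symmetry makes linearity in one argument enough. *)
Record invariant_form (R : realType) (L : lieAlgebra R) (b : L -> L -> R) : Prop
  := InvariantForm {
  if_lin : forall x, scalar (b x);
  if_sym : forall x y, b x y = b y x;
  if_inv : forall z x y, b (lb z x) y + b x (lb z y) = 0 }.

Record metricLie (R : realType) := MetricLie {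
  ml_lie :> lieAlgebra R;
  ml_form : ml_lie -> ml_lie -> R;
  ml_invariant : invariant_form ml_form;
  ml_nondeg : forall x, (forall y, ml_form x y = 0) -> x = 0 }.

(* delta : s -> der(h) /\ so(h) is a homomorphism of Lie algebras *)
Record skew_der_action (R : realType) (h : metricLie R) (s : lieAlgebra R)
    (delta : s -> 'End(h)) : Prop := SkewDerAction {
  sda_lin : linear delta;
  sda_hom : forall S T X,
    delta (lb S T) X = delta S (delta T X) - delta T (delta S X);
  sda_der : forall S X Y,
    delta S (lb X Y) = lb (delta S X) Y + lb X (delta S Y);
  sda_skew : forall S X Y,
    ml_form (delta S X) Y + ml_form X (delta S Y) = 0 }.

Section FormTheory.
Variables (R : realType) (L : lieAlgebra R) (b : L -> L -> R).
Hypothesis hb : invariant_form b.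

Lemma ifDr x y z : b x (y + z) = b x y + b x z.
Proof. by have := if_lin hb x 1 y z; rewrite scale1r mul1r. Qed.
Lemma if0r x : b x 0 = 0.
Proof. by apply: (addrI (b x 0)); rewrite -ifDr !addr0. Qed.
Lemma ifZr a x y : b x (a *: y) = a * b x y.
Proof. by have := if_lin hb x a y 0; rewrite !addr0 if0r addr0. Qed.
Lemma ifNr x y : b x (- y) = - b x y.
Proof. by rewrite -scaleN1r ifZr mulN1r. Qed.
Lemma ifDl x y z : b (y + z) x = b y x + b z x.
Proof. by rewrite !(if_sym hb _ x) ifDr. Qed.
Lemma ifZl a x y : b (a *: y) x = a * b y x.
Proof. by rewrite !(if_sym hb _ x) ifZr. Qed.
Lemma ifNl x y : b (- y) x = - b y x.
Proof. by rewrite !(if_sym hb _ x) ifNr. Qed.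
Lemma if0l x : b 0 x = 0.
Proof. by rewrite (if_sym hb) if0r. Qed.

End FormTheory.

Section DoubleExtension.
Variables (R : realType) (h : metricLie R) (s : lieAlgebra R).
Variables (b : s -> s -> R) (delta : s -> 'End(h)).
Hypotheses (hb : invariant_form b) (hd : skew_der_action delta).

Local Notation dual := ('Hom(s, R^o)).

Definition coad (S : s) (sigma : dual) : dual := - (sigma \o ad S)%VF.

(* T |-> < delta_T X, Y > *)
Definition delta_pairing (X Y : h) : dual :=
  linfun (fun T : s => ml_form (delta T X) Y : R^o).

Definition dext_space : vectType R := (dual * h * s)%type.

Definition dext_br (u v : dext_space) : dext_space :=
  let: (sigma, X, A) := u in
  let: (sigma', X', A') := v in
  (coad A sigma' - coad A' sigma + delta_pairing X X',
   lb X X' + delta A X' - delta A' X,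
   lb A A').

Definition dext_form (u v : dext_space) : R :=
  let: (sigma, X, A) := u in
  let: (sigma', X', A') := v in
  ml_form X X' + b A A' + (sigma A' : R) + (sigma' A : R).

Local Notation hf := (ml_invariant h).

Fact coadE S sigma T : coad S sigma T = - sigma (lb S T).
Proof. by rewrite /coad opp_lfunE comp_lfunE adE. Qed.

Fact deltaD S T X : delta (S + T) X = delta S X + delta T X.
Proof. by have := sda_lin hd 1 S T; rewrite !scale1r => ->; rewrite add_lfunE. Qed.
Fact delta0 X : delta 0 X = 0.
Proof. by apply: (addrI (delta 0 X)); rewrite -deltaD !addr0. Qed.
Fact deltaZ a S X : delta (a *: S) X = a *: delta S X.
Proof.
have /(congr1 (fun f : 'End(h) => f X)) := sda_lin hd a S 0.
by rewrite addr0 add_lfunE scale_lfunE delta0 addr0.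
Qed.

Fact delta_pairingE X Y T : delta_pairing X Y T = ml_form (delta T X) Y.
Proof.
apply: linfun_linE => a S S'.
by rewrite deltaD deltaZ (ifDl hf) (ifZl hf).
Qed.

Let dextE := (coadE, delta_pairingE, add_lfunE, opp_lfunE, scale_lfunE,
  linearD, linearN, linearZ, lbDl, lbDr, lbZl, lbZr, deltaD, deltaZ).
Let formE := (ifDl hf, ifDr hf, ifZl hf, ifZr hf, ifNl hf, ifNr hf).

Let hlbNr (L : lieAlgebra R) (X Y : L) : lb X (- Y) = - lb X Y.
Proof. by rewrite -scaleN1r lbZr scaleN1r. Qed.

Let form_ext (X Y : h) : (forall Z, ml_form X Z = ml_form Y Z) -> X = Y.
Proof.
move=> e; apply/eqP; rewrite -subr_eq0; apply/eqP/ml_nondeg => Z.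
by rewrite (ifDl hf) (ifNl hf) e subrr.
Qed.

Fact dext_linr u : linear (dext_br u).
Proof.
case: u => [[sg X] A] a [[sg1 X1] S1] [[sg2 X2] S2].
congr (_, _, _) => /=.
- apply/lfunP => T; rewrite !dextE /= !formE /GRing.scale /=; ring.
- by apply: form_ext => Z; rewrite !dextE !formE; ring.
- by rewrite !dextE.
Qed.

Fact dext_alt u : dext_br u u = 0.
Proof.
case: u => [[sg X] A]; congr (_, _, _) => /=.
- apply/lfunP => T; rewrite !dextE zero_lfunE /=.
  have := sda_skew hd T X X; rewrite [X in _ + X](if_sym hf) => H.
  by rewrite subrr add0r; lra.
- by rewrite lb_alt add0r subrr.
- by rewrite lb_alt.
Qed.

Fact dext_linl v : linear (dext_br^~ v).
Proof.
have dC u w : dext_br u w = - dext_br w u.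
  have D x y z : dext_br x (y + z) = dext_br x y + dext_br x z.
    by have := dext_linr x 1 y z; rewrite !scale1r.
  have Dl x y z : dext_br (y + z) x = dext_br y x + dext_br z x.
    case: x y z => [[sg X] A] [[sg1 X1] S1] [[sg2 X2] S2].
    congr (_, _, _) => /=.
    - by apply/lfunP => T; rewrite !dextE /= !formE; ring.
    - by apply: form_ext => Z; rewrite !dextE !formE; ring.
    - by rewrite !dextE.
  apply/eqP; rewrite -addr_eq0; apply/eqP.
  by have := dext_alt (u + w); rewrite Dl !D !dext_alt addr0 add0r.
move=> a x y; rewrite !(dC _ v) dext_linr opprD scalerN //.
Qed.

Fact dext_jacobi u v w : dext_br u (dext_br v w) + dext_br v (dext_br w u)
  + dext_br w (dext_br u v) = 0.
Proof.
case: u v w => [[sg1 X1] S1] [[sg2 X2] S2] [[sg3 X3] S3].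
congr (_, _, _) => /=; last exact: lb_jacobi.
- apply/lfunP => T.
  rewrite zero_lfunE !(coadE, delta_pairingE, add_lfunE, opp_lfunE) /=.
  rewrite !formE !(sda_hom hd) !formE.
  have jac (A B C : s) (sg : dual) :
      (sg (lb (lb A B) C) : R) = sg (lb A (lb B C)) - sg (lb B (lb A C)).
    rewrite -!(linearB sg) /=; congr (sg _).
    have := lb_jacobi A B C; rewrite (lbC (lb A B)) (lbC A C) hlbNr opprK => /eqP.
    by rewrite addr_eq0 => /eqP ->.
   rewrite !jac.
  have iv (Z X Y : h) : ml_form X (lb Z Y) = - ml_form (lb Z X) Y.
    by have := if_inv hf Z X Y; lra.
  have sk A B (X Y : h) :
      ml_form (delta A (delta B X)) Y = - ml_form (delta B X) (delta A Y).
    by have := sda_skew hd A (delta B X) Y; lra.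
  have e : ml_form (delta T X1) (lb X2 X3) + ml_form (delta T X2) (lb X3 X1)
    + ml_form (delta T X3) (lb X1 X2) = 0.
    have := sda_skew hd T (lb X1 X2) X3.
    rewrite (sda_der hd) (ifDl hf) (lbC (delta T X1)) (ifNl hf) -iv.
    rewrite [X in X + _](_ : _ = ml_form (delta T X1) (lb X2 X3)
      + ml_form (delta T X2) (lb X3 X1)); last first.
      by have := iv X1 (delta T X2) X3; rewrite [lb X3 X1]lbC (ifNr hf); lra.
    by rewrite (if_sym hf (lb X1 X2)).
  have c A B (X Y : h) : ml_form (delta A X) (delta B Y)
     = ml_form (delta B Y) (delta A X) by exact: (if_sym hf).
  rewrite !sk (c S1 T X2 X3) (c S2 T X3 X1) (c S3 T X1 X2); lra.
- rewrite !(lbDr, hlbNr, linearD, linearN) /= !(sda_hom hd) !(sda_der hd).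
  rewrite (lbC (delta S1 X2)) (lbC (delta S2 X3)) (lbC (delta S3 X1)).
  apply: form_ext => Z; rewrite !formE (if0l hf).
  have := congr1 (fun X => ml_form X Z) (lb_jacobi X1 X2 X3).
  rewrite /= (if0l hf) !formE.
  lra.
Qed.

Definition dext_lie : lieAlgebra R :=
  LieAlgebra dext_linl dext_linr dext_alt dext_jacobi.

Fact dext_invariant : @invariant_form R dext_lie dext_form.
Proof.
split=> [[[sg X] A] a [[sg1 X1] A1] [[sg2 X2] A2]
        |[[sg X] A] [[sg1 X1] A1]
        |[[sg3 X3] A3] [[sg1 X1] A1] [[sg2 X2] A2]] /=.
- have e : (sg (a *: A1 + A2) : R) = a * sg A1 + sg A2 by rewrite linearP.
  have e' : ((a *: sg1 + sg2) A : R) = a * sg1 A + sg2 A.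
    by rewrite add_lfunE scale_lfunE.
  rewrite !(ifDr hf, ifZr hf, ifDr hb, ifZr hb) e e'; ring.
- by rewrite (if_sym hf) (if_sym hb); lra.
- rewrite !(coadE, delta_pairingE, add_lfunE, opp_lfunE) !formE.
  have := if_inv hf X3 X1 X2; have := if_inv hb A3 A1 A2.
  have := sda_skew hd A3 X1 X2.
  have e : (sg3 (lb A1 A2) : R) = - sg3 (lb A2 A1) by rewrite lbC linearN.
  rewrite e; have := if_sym hf X1 (delta A2 X3).
  have := sda_skew hd A1 X3 X2; have := sda_skew hd A2 X3 X1.
  have := if_sym hf X1 (delta A2 X3); have := if_sym hf X1 (delta A3 X2).
  lra.
Qed.

Fact dext_nondeg (u : dext_lie) : (forall v, dext_form u v = 0) -> u = 0.
Proof.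
case: u => [[sg X] A] H.
have A0 : A = 0.
  apply/eqP; apply: contraT => nA.
  pose f := linfun (fun T : s => coord [tuple of [:: A]] ord0 T : R^o).
  have := H (f, 0, 0).
  rewrite /dext_form /= (if0r hf) (if0r hb) linear0 !add0r /f linfun_linE; last first.
    by move=> a x y; rewrite linearP.
  have fA : free [tuple of [:: A]] by rewrite /= (seq1_free A).
  have := coord_free ord0 ord0 fA => /= -> /eqP.
  by rewrite ?eqxx oner_eq0.
have X0 : X = 0.
  apply: ml_nondeg => Y; have := H (0, Y, 0).
  by rewrite /dext_form /= A0 (if0r hb) !linear0 !addr0.
suff -> : sg = 0 by rewrite A0 X0.
apply/lfunP => T; have := H (0, 0, T).
by rewrite /dext_form /= A0 X0 (if0l hf) (if0l hb) !zero_lfunE !add0r addr0.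
Qed.

Definition double_ext : metricLie R :=
  MetricLie dext_invariant dext_nondeg.

End DoubleExtension.

(** * Smooth maps and Lie groups *)

(* Every iterated directional derivative of f is differentiable, hence
   continuous, at every point of A. For finite-dimensional V and open A this
   says that f is C^infty on A. *)
Definition smooth_on (R : realType) (V W : normedModType R)
    (A : set V) (f : V -> W) : Prop :=
  forall (vs : seq V) (x : V), A x ->
    differentiable (foldr (fun v (g : V -> W) => fun y => 'D_v g y) f vs) x.

Record chart (R : realType) (n : nat) (T : topologicalType) := Chart {
  cdom : set T;
  cmap :> T -> 'rV[R]_n;
  cinv : 'rV[R]_n -> T;
  cdom_open : open cdom;
  cimg_open : open (cmap @` cdom);
  cmapK : forall p, cdom p -> cinv (cmap p) = p;
  cmap_cont : forall p, cdom p -> {for p, continuous cmap};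
  cinv_cont : forall x, (cmap @` cdom) x -> {for x, continuous cinv} }.

Record lieGroup (R : realType) (n : nat) := LieGroup {
  lg_space :> topologicalType;
  lg_hausdorff : hausdorff_space lg_space;
  lg_countable : @second_countable lg_space;
  (* a smooth atlas, not necessarily maximal *)
  lg_atlas : set (chart R n lg_space);
  lg_cover : forall p, exists2 c, lg_atlas c & cdom c p;
  lg_compat : forall c c', lg_atlas c -> lg_atlas c' ->
    smooth_on (c @` (cdom c `&` cdom c')) (c' \o cinv c);
  lg_mul : lg_space -> lg_space -> lg_space;
  lg_one : lg_space;
  lg_inv : lg_space -> lg_space;
  lg_mulA : associative lg_mul;
  lg_mul1 : left_id lg_one lg_mul;
  lg_mulV : left_inverse lg_one lg_inv lg_mul;
  lg_mul_cont : continuous (fun p : lg_space * lg_space => lg_mul p.1 p.2);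
  lg_inv_cont : continuous lg_inv;
  lg_mul_smooth : forall c1 c2 c, lg_atlas c1 -> lg_atlas c2 -> lg_atlas c ->
    smooth_on
      [set (c1 p.1, c2 p.2) | p in
        [set p | [/\ cdom c1 p.1, cdom c2 p.2 & cdom c (lg_mul p.1 p.2)]]]
      (fun z : 'rV[R]_n * 'rV[R]_n => c (lg_mul (cinv c1 z.1) (cinv c2 z.2)));
  lg_inv_smooth : forall c1 c, lg_atlas c1 -> lg_atlas c ->
    smooth_on (c1 @` [set p | cdom c1 p /\ cdom c (lg_inv p)])
      (fun x => c (lg_inv (cinv c1 x))) }.

Definition simply_connected (R : realType) (T : topologicalType) : Prop :=
  (forall p q : T, exists g : R -> T,
     [/\ {within `[0, 1], continuous g}, g 0 = p & g 1 = q]) /\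
  (forall g : R -> T, {within `[0, 1], continuous g} -> g 0 = g 1 ->
     exists H : R * R -> T,
       [/\ {within `[0, 1] `*` `[0, 1], continuous H},
         forall t, t \in `[0, 1] -> H (0, t) = g t,
         forall t, t \in `[0, 1] -> H (1, t) = g 0
       & forall s, s \in `[0, 1] -> H (s, 0) = g 0 /\ H (s, 1) = g 0]).

Section LieAlgebraOfGroup.
Variables (R : realType) (n : nat) (G : lieGroup R n).
(* c0 is a chart around the unit; it identifies the tangent space at the unit
   with R^n. *)
Variable c0 : chart R n G.
Local Notation vec := 'rV[R]_n.

(* The left-invariant vector field with value u at the unit, read in c0. *)
Definition left_field (u x : vec) : vec :=
  'D_u (fun y : vec => c0 (lg_mul (cinv c0 x) (cinv c0 y))) (c0 (lg_one G)).

Definition vf_bracket (X Y : vec -> vec) (x : vec) : vec :=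
  'D_(X x) Y x - 'D_(Y x) X x.

Definition lg_bracket (u v : vec) : vec :=
  vf_bracket (left_field u) (left_field v) (c0 (lg_one G)).

(* The Maurer-Cartan form: at the point p with coordinates x in the chart c,
   it is the differential at p of the left translation by p^-1. *)
Definition maurer_cartan (c : chart R n G) (x a : vec) : vec :=
  'D_a (fun y : vec => c0 (lg_mul (lg_inv (cinv c x)) (cinv c y))) x.

(* The left-invariant metric with value B at the unit, as a Gram matrix in the
   chart c. *)
Definition left_metric (B : vec -> vec -> R) (c : chart R n G) (x : vec) :
    'M[R]_n :=
  \matrix_(i, j) B (maurer_cartan c x (delta_mx 0 i))
                   (maurer_cartan c x (delta_mx 0 j)).

End LieAlgebraOfGroup.

(** * Ricci curvature in coordinates, conformally Einstein metrics *)

Section Ricci.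
Variables (R : realType) (n : nat).
Local Notation vec := 'rV[R]_n.
Variable g : vec -> 'M[R]_n.

Definition partial (i : 'I_n) (f : vec -> R) (x : vec) : R :=
  'D_(delta_mx 0 i : vec) f x.

Definition christoffel (k i j : 'I_n) (x : vec) : R :=
  2^-1 * \sum_(l < n) invmx (g x) k l *
    (partial i (fun y => g y j l) x + partial j (fun y => g y i l) x
     - partial l (fun y => g y i j) x).

Definition ricci (x : vec) : 'M[R]_n :=
  \matrix_(i, j) (
    \sum_(k < n) (partial k (christoffel k i j) x
                  - partial j (christoffel k i k) x)
    + \sum_(k < n) \sum_(l < n) (christoffel k k l x * christoffel l i j x
                  - christoffel k j l x * christoffel l i k x)).

End Ricci.

(* g c x is the Gram matrix of a semi-Riemannian metric on G in the chart c. *)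
Definition locally_conformally_einstein (R : realType) (n : nat)
    (G : lieGroup R n) (g : chart R n G -> 'rV[R]_n -> 'M[R]_n) : Prop :=
  forall p : G, exists (U : set G) (phi : G -> R),
    [/\ open U, U p,
      forall c, lg_atlas c ->
        smooth_on (c @` (cdom c `&` U)) (phi \o cinv c)
    & exists lambda : R, forall c, lg_atlas c ->
        let ghat := fun x => expR (2 * phi (cinv c x)) *: g c x in
        forall x, (c @` (cdom c `&` U)) x ->
          ricci ghat x = lambda *: ghat x].

(* f identifies the Lie algebra of G with L. *)
Definition conformally_einstein (R : realType) (L : metricLie R) : Prop :=
  exists (n : nat) (G : lieGroup R n) (c0 : chart R n G) (f : 'rV[R]_n -> L),
    [/\ simply_connected R G,
      lg_atlas c0 /\ cdom c0 (lg_one G),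
      linear f /\ bijective f,
      forall u v, f (lg_bracket c0 u v) = lb (f u) (f v)
    & locally_conformally_einstein
        (left_metric c0 (fun u v => ml_form (f u) (f v)))].

(* Main.v *)
(* Let [theta] be the Maurer-Cartan form of the group, so that the bi-invariant metric is
   [<theta, theta>], let [e^(2 phi) g] be Einstein, and let [F] be the gradient of [e^(-phi)]
   read in the Lie algebra through [theta]. The Einstein equation is equivalent to a linear
   system expressing [dF(a)] as a combination of [[theta a, F]], [Q (theta a)] and [theta a],
   where [<Q X, Y> = K(X, Y)] is the Killing form. Symmetry of the second derivatives of [F]
   then gives, at each point, a covector [eta] and a constant [r <> 0] with
     <[[X, Y], F], Z> / 4 = <F, X> r K(Y, Z) - <F, Y> r K(X, Z) - eta(X) <Y, Z> + eta(Y) <X, Z>.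
   If [F] vanishes identically, then [K] is a multiple of the scalar product; this is impossible,
   because [K] vanishes on the ideal [s^*] but, by Cartan's criterion, not on [s].
   Otherwise take [F = (tau, X0, S0) <> 0] at some point. If [S0 <> 0], pairing with [s^*] gives
   [[[A, B], t] = al(B) A - al(A) B] on [s] with [t = S0]; if [S0 = 0] and [tau <> 0], pairing with
   [s] gives the same identity for the [t] that is [K]-dual to [tau]; and [F = X0] is excluded
   since then [delta_A delta_C X0] is a nonzero multiple of [K(A, C) X0], whose symmetry in [A]
   and [C] forces [delta X0 = 0].
   Such a [t] yields a basis of [s] with [[a, b] = p c], [[b, c] = q a], [[c, a] = r b] and
   [p, q, r <> 0], which is [sl_2] or [so_3] according to the signs of [p], [q], [r]. *)

Require Import Defs.
From HB Require Import structures.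
From mathcomp Require Import all_boot all_order all_algebra.
From mathcomp Require Import all_classical all_reals all_analysis.
From mathcomp Require Import ring lra zify.
From mathcomp.real_closed Require complex.

Set Implicit Arguments.
Unset Strict Implicit.
Unset Printing Implicit Defensive.
Import Order.TTheory GRing.Theory Num.Theory.
Import numFieldNormedType.Exports.
Local Open Scope ring_scope.

(** * Cartan's criterion *)

(** Differentiating the linear system for [F] once more closes it. Since [Q] commutes with every
    bracket, the terms in [Q [X, Y]] cancel against those produced by the Maurer-Cartan equation,
    and so do the terms in [[X, Y]] carrying the scalar coefficient of [theta a]. What is left is
    algebraic in [F] at a point. That scalar coefficient contains the Laplacian of [phi], but it is
    never computed: only its differential survives, and this is [eta]. The constant [r] is
    [-1 / (4 (n - 2))]; solving the Ricci equation for the Hessian divides by [n - 2], which is why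
    the dimension is bounded below first. Cartan's criterion is needed for a real algebra whose
    operators may have non-real eigenvalues. After extension of scalars, the trace of [x] times the
    conjugate of its semisimple part is the sum of the squared moduli of the eigenvalues, so its
    vanishing makes [x] nilpotent. The criterion is applied to [s] acting on all of [g], because the
    form [K] is the Killing form of [g] and not that of [s]. *)

Section Primary.
Variable F : fieldType.
Implicit Types (s : seq F) (p q : {poly F}).

Lemma coprimep_XsubC_exp s (a : F) m : a \notin s ->
  coprimep (('X - a%:P) ^+ m) (\prod_(b <- s) ('X - b%:P) ^+ m).
Proof.
elim: s => [|b s IH]; first by rewrite big_nil coprimep1.
rewrite inE negb_or => /andP[nab ns]; rewrite big_cons coprimepMr IH // andbT.
by apply/coprimep_expl/coprimep_expr/coprimep_XsubC2; rewrite subr_eq0 eq_sym.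
Qed.

Lemma dvdp_prod_XsubC_exp s m q : uniq s ->
  (forall a, a \in s -> ('X - a%:P) ^+ m %| q) ->
  \prod_(b <- s) ('X - b%:P) ^+ m %| q.
Proof.
elim: s => [|b s IH]; first by rewrite big_nil dvd1p.
move=> /= /andP[bs us] H; rewrite big_cons Gauss_dvdp ?coprimep_XsubC_exp //.
rewrite H ?mem_head // IH // => a ain; apply: H.
by rewrite inE ain orbT.
Qed.

(** Chinese remainder theorem for the moduli [('X - a%:P) ^+ m]. The prescribed values are
    arbitrary, so [v] may be complex conjugation, which is not polynomial. *)
Lemma poly_interp s m (v : F -> F) : uniq s ->
  exists p, forall a, a \in s -> ('X - a%:P) ^+ m %| p - (v a)%:P.
Proof.
elim: s => [|a s IH] /=; first by exists 0.
move=> /andP[nas us]; have [p' Hp'] := IH us.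
set q := \prod_(b <- s) ('X - b%:P) ^+ m.
have /Bezout_eq1_coprimepP[[u w] /= uw] := coprimep_XsubC_exp m nas.
exists (p' + ((v a)%:P - p') * (w * q)) => b; rewrite inE => /predU1P[->|bs].
  have -> : w * q = 1 - u * ('X - a%:P) ^+ m by rewrite -uw addrC addKr.
  rewrite mulrBr mulr1 addrA [p' + _]addrC subrK addrAC subrr add0r.
  by rewrite dvdpNr mulrA dvdp_mulIr.
rewrite addrAC dvdp_add ?Hp' // !dvdp_mull //.
by rewrite /q (big_rem b) //= dvdp_mulIl.
Qed.

End Primary.

Lemma mxtrace_commutator (R : comNzRingType) n (a b y : 'M[R]_n) :
  \tr ((a *m b - b *m a) *m y) = - \tr (a *m (y *m b - b *m y)).
Proof.
rewrite mulmxBl mulmxBr 2!raddfB /= opprB -(mulmxA a); congr (_ - _).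
by rewrite -(mulmxA b) mxtrace_mulC (mulmxA a).
Qed.

(** * The conjugated semisimple part of a complex matrix *)

Section AdPoly.
Variables (C : numClosedFieldType) (n : nat) (x : 'M[C]_n.+1) (r : seq C).
Hypothesis char_xE : char_poly x = \prod_(a <- r) ('X - a%:P).
Let s := undup r.
Local Notation m := n.+1.

Let us : uniq s. Proof. exact: undup_uniq. Qed.

(** No root has multiplicity above the size [m], so the common exponent [m] already covers the
    characteristic polynomial, and Cayley-Hamilton applies. *)
Let horner_eq0 q : (forall a, a \in s -> ('X - a%:P) ^+ m %| q) ->
  horner_mx x q = 0.
Proof.
move=> H; have char_x : char_poly x %| \prod_(b <- s) ('X - b%:P) ^+ m.
  have sz : (size r <= m)%N.
    by have := size_prod_XsubC r id; rewrite -char_xE size_char_poly => -[->].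
  rewrite char_xE -[\prod_(a <- r) _]prodr_undup_exp_count big_seq [X in _ %| X]big_seq.
  elim/big_ind2: _ => // [p q1 p' q'|a ain]; first exact: dvdp_mul.
  by rewrite dvdp_exp2l //; exact: leq_trans (count_size _ _) sz.
have /(dvdp_trans char_x)/dvdpP[w ->] := dvdp_prod_XsubC_exp us H.
by rewrite rmorphM /= Cayley_Hamilton mulr0.
Qed.

Definition ad_mx : 'M[C]_(m * m) := lin_mx (mulmx x \- mulmxr x).

Lemma ad_mxE z : mxvec z *m ad_mx = mxvec (x *m z - z *m x).
Proof. exact: mul_vec_lin. Qed.

Let D (c : C) (z : 'M[C]_m) := x *m z - z *m x - c *: z.

(** [D (a - b)] is left multiplication by [x - a] minus right multiplication by [x - b]. These
    commute, and each term of the power [m + m] contains one of them at least [m] times. *)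
Let iterD_eq0 a b (z : 'M[C]_m) :
  (x - a%:M) ^+ m *m z = 0 -> z *m (x - b%:M) ^+ m = 0 ->
  iter (m + m) (D (a - b)) z = 0.
Proof.
move=> az zb; set xa := x - a%:M; set xb := x - b%:M.
have DB u v : D (a - b) (u - v) = D (a - b) u - D (a - b) v.
  rewrite /D mulmxBr mulmxBl scalerBr; apply/matrixP => i j; rewrite !mxE; ring.
have iDB k u v : iter k (D (a - b)) (u - v)
    = iter k (D (a - b)) u - iter k (D (a - b)) v.
  by elim: k => //= k ->; rewrite DB.
have iD0 k : iter k (D (a - b)) 0 = 0.
  by have := iDB k 0 0; rewrite !subrr.
suff H k i j : (m + m <= k + (i + j))%N ->
    iter k (D (a - b)) (xa ^+ i *m z *m xb ^+ j) = 0.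
  by have := H (m + m)%N 0%N 0%N; rewrite !expr0 mul1mx mulmx1 => ->; rewrite ?addn0.
elim: k i j => [|k IH] i j.
  rewrite add0n /= => ij; have [mi|im] := leqP m i.
    rewrite -(subnK mi) exprD -mulmxE -(mulmxA _ _ z) az mulmx0 mul0mx //.
  have mj : (m <= j)%N.
    by rewrite leqNgt; apply/negP => jm; move: (leq_add im jm); lia.
  by rewrite -(subnK mj) addnC exprD -mulmxE mulmxA -(mulmxA _ z) zb mulmx0 mul0mx.
move=> ij; rewrite iterSr.
have -> : D (a - b) (xa ^+ i *m z *m xb ^+ j)
    = xa ^+ i.+1 *m z *m xb ^+ j - xa ^+ i *m z *m xb ^+ j.+1.
  set w := xa ^+ i *m z *m xb ^+ j.
  have -> : xa ^+ i *m z *m xb ^+ j.+1 = w *m xb.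
    by rewrite exprSr -mulmxE /w !mulmxA.
  have -> : xa ^+ i.+1 *m z *m xb ^+ j = xa *m w.
    by rewrite exprS -mulmxE /w !mulmxA.
  rewrite /D /xa /xb mulmxBl mulmxBr mul_scalar_mx mul_mx_scalar scalerBl.
  by apply/matrixP => i' j'; rewrite !mxE; ring.
by rewrite iDB !IH ?subrr //; lia.
Qed.

Lemma trig_mulmx (A B : 'M[C]_m) : is_trig_mx A -> is_trig_mx B ->
  is_trig_mx (A *m B) /\ forall i, (A *m B) i i = A i i * B i i.
Proof.
move=> /is_trig_mxP At /is_trig_mxP Bt; split.
  apply/is_trig_mxP => i j ij; rewrite mxE big1 // => k _.
  have [ik|ki] := ltnP i k; first by rewrite At // mul0r.
  by rewrite Bt ?mulr0 // (leq_ltn_trans ki).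
move=> i; rewrite mxE (bigD1 i) //= big1 ?addr0 // => k; rewrite neq_ltn.
by case/orP => ki; [rewrite Bt ?mulr0 | rewrite At ?mul0r].
Qed.

Lemma trig_horner (A : 'M[C]_m) p : is_trig_mx A ->
  is_trig_mx (horner_mx A p) /\ forall i, horner_mx A p i i = p.[A i i].
Proof.
move=> At; elim/poly_ind: p => [|p c [IH1 IH2]].
  by rewrite rmorph0; split=> [|i]; rewrite ?mx0_is_trig // mxE horner0.
rewrite rmorphD rmorphM /= horner_mx_X horner_mx_C.
have [tM dM] := trig_mulmx IH1 At; split=> [|i].
  by apply/is_trig_mxP => i j ij; rewrite mxE (is_trig_mxP tM) // add0r
    mxE -val_eqE ltn_eqF.
by rewrite mxE [_ i i]dM IH2 !mxE eqxx !hornerE.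
Qed.

(* [y] is the complex conjugate of the semisimple part of [x]. *)
Lemma conj_semisimple : exists (y : 'M[C]_m) (q : {poly C}),
  (forall z, mxvec (y *m z - z *m y) = mxvec z *m horner_mx ad_mx q) /\
  (\tr (x *m y) = 0 -> x ^+ m = 0).
Proof.
have [p Hp] := poly_interp m Num.conj us.
(* The eigenvalues of [ad_mx] are the differences of those of [x]. Conjugation is additive, so [q]
   makes [horner_mx ad_mx q] the commutator with [y]; the exponent [m + m] is the one of
   [iterD_eq0]. *)
pose t := undup [seq a - b | a <- s, b <- s].
have [q Hq] := @poly_interp _ t (m + m) Num.conj (undup_uniq _).
exists (horner_mx x p), q; split.
  (* The polynomials [e a] in [x] give the projections [E a] onto the generalised eigenspaces. *)
  have He a : exists p, all (fun b => ('X - b%:P) ^+ m %| p - (b == a)%:R%:P) s.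
    by have [e He] := poly_interp m (fun b => (b == a)%:R) us; exists e; apply/allP.
  pose e a := xchoose (He a).
  have eP a b : b \in s -> ('X - b%:P) ^+ m %| e a - (b == a)%:R%:P.
    by move=> bs; exact: (allP (xchooseP (He a))).
  pose E a := horner_mx x (e a).
  have sumE : \sum_(a <- s) E a = 1.
    apply/eqP; rewrite -subr_eq0 -rmorph_sum -[X in _ - X](rmorph1 (horner_mx x)).
    rewrite -rmorphB /=; apply/eqP/horner_eq0 => b bs.
    have -> : 1 = \sum_(a <- s) (b == a)%:R%:P :> {poly C}.
      rewrite (bigD1_seq b) //= eqxx big1 ?addr0 // => a /negPf.
      by rewrite eq_sym => ->.
    by rewrite -sumrB; elim/big_ind: _ => // *; [exact: dvdp_add|exact: eP].
  have yE a : a \in s -> horner_mx x p *m E a = a^* *: E a.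
    move=> ain; apply/eqP; rewrite -subr_eq0 -mul_scalar_mx -mulmxBl.
    rewrite -(horner_mx_C x) -rmorphB mulmxE -rmorphM; apply/eqP/horner_eq0 => b bs.
    have [->|/negPf ba] := eqVneq b a; first by rewrite dvdp_mulr ?Hp.
    by rewrite dvdp_mull //; have := eP a b bs; rewrite ba subr0.
  have Ey b : b \in s -> E b *m horner_mx x p = b^* *: E b.
    by move=> bs; rewrite -yE //; apply/comm_horner_mx2.
  have xE a : a \in s -> (x - a%:M) ^+ m *m E a = 0.
    move=> ain; rewrite -[X in X - _](horner_mx_X x) -(horner_mx_C x) -rmorphB -rmorphXn.
    rewrite mulmxE -rmorphM; apply/horner_eq0 => b bs.
    have [->|/negPf ba] := eqVneq b a; first by rewrite dvdp_mulr.
    by rewrite dvdp_mull //; have := eP a b bs; rewrite ba subr0.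
  have Ex b : b \in s -> E b *m (x - b%:M) ^+ m = 0.
    move=> bs; rewrite -(xE b) // -[X in X - _](horner_mx_X x) -(horner_mx_C x).
    by rewrite -rmorphB -rmorphXn; apply/comm_horner_mx2.
  have adk c k z : mxvec z *m (ad_mx - c%:M) ^+ k = mxvec (iter k (D c) z).
    elim: k z => [|k IH] z; first by rewrite expr0 mulmx1.
    rewrite exprS -mulmxE mulmxA mulmxBr ad_mxE mul_mx_scalar -linearZ -linearB /=.
    by rewrite IH -iterSr.
  (* Split [z] into blocks [E a *m z *m E b], on which both sides act as the conjugate of
     [a - b]. *)
  move=> z; have -> : z = \sum_(a <- s) \sum_(b <- s) E a *m z *m E b.
    rewrite -[LHS]mulr1 -[LHS]mul1r -!sumE -!mulmxE mulmx_suml; apply: eq_bigr => a _.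
    by rewrite !mulmx_sumr; apply: eq_bigr => b _; rewrite mulmxA.
  rewrite !(mulmx_sumr, mulmx_suml) -sumrB !linear_sum mulmx_suml /=.
  apply: eq_big_seq => a ain.
  rewrite !(mulmx_sumr, mulmx_suml) -sumrB !linear_sum mulmx_suml /=.
  apply: eq_big_seq => b bs.
  move: (yE a ain) (xE a ain) (Ey b bs) (Ex b bs).
  move: (E a) (E b) => Ea Eb yEa xEa Eby Ebx; set w := Ea *m z *m Eb.
  have yw : horner_mx x p *m w = a^* *: w by rewrite /w !mulmxA yEa -!scalemxAl.
  have wy : w *m horner_mx x p = b^* *: w by rewrite /w -mulmxA Eby -scalemxAr.
  have -> : horner_mx x p *m w - w *m horner_mx x p = (a - b)^* *: w.
    by rewrite yw wy -scalerBl rmorphB.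
  have abt : a - b \in t by rewrite mem_undup; apply/allpairsP; exists (a, b).
  have /dvdpP[u Eu] := Hq _ abt.
  have -> : q = (a - b)^*%:P + ('X - (a - b)%:P) ^+ (m + m) * u.
    by rewrite mulrC -Eu addrC subrK.
  set cc := (a - b)^*.
  rewrite rmorphD rmorphM rmorphXn rmorphB /= horner_mx_X !horner_mx_C.
  rewrite mulmxDr mul_mx_scalar -mulmxE mulmxA adk iterD_eq0.
  - by rewrite !linear0 mul0mx addr0 linearZ.
  - by rewrite /w !mulmxA xEa !mul0mx.
  - by rewrite /w -[LHS]mulmxA Ebx mulmx0.
(* In a triangular form of [x], the trace becomes the sum of the squared moduli of the diagonal
   entries. *)
have [//|P /unitarymx_unit Pu /=] := @Schur C m x.
rewrite /similar_to /= conjumx //; set T := P *m x *m invmx P => trT.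
have xT : x = invmx P *m T *m P by rewrite /T !mulmxA mulVmx // mul1mx mulmxKV.
have hT w : horner_mx T w = P *m horner_mx x w *m invmx P by exact: horner_mx_uconj.
have rT i : T i i \in s.
  rewrite mem_undup -root_prod_XsubC -char_xE; apply/rootP.
  have [_ <-] := trig_horner (char_poly x) trT.
  by rewrite hT Cayley_Hamilton mulmx0 mul0mx mxE.
have -> : \tr (x *m horner_mx x p) = \sum_i T i i * (T i i)^*.
  have -> : \tr (x *m horner_mx x p) = \tr (T *m horner_mx T p).
    have -> : T *m horner_mx T p = P *m (x *m horner_mx x p) *m invmx P.
      by rewrite hT /T !mulmxA mulmxKV.
    by rewrite [RHS]mxtrace_mulC (mulmxA (invmx P) P) mulVmx // mul1mx.
  have [tp dp] := trig_horner p trT; have [_ dTp] := trig_mulmx trT tp.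
  apply: eq_bigr => i _; rewrite dTp dp; congr (_ * _).
  have /dvdpP[u /eqP] := Hp _ (rT i).
  rewrite subr_eq => /eqP ->; rewrite hornerD hornerM horner_exp !hornerE subrr.
  by rewrite expr0n /= mulr0 add0r.
move=> /eqP; rewrite psumr_eq0 => [/allP T0|i _]; last exact: mul_conjC_ge0.
have T0' i : T i i = 0.
  by have := T0 i (mem_index_enum _); rewrite mul_conjC_eq0 => /eqP.
(* With zero diagonal the characteristic polynomial is ['X^m], so Cayley-Hamilton gives
   nilpotency. *)
have : horner_mx T (char_poly T) = 0 by exact: Cayley_Hamilton.
rewrite (char_poly_trig trT) (eq_bigr (fun _ => 'X)) => [|i _]; last first.
  by rewrite T0' subr0.
rewrite prodr_const card_ord rmorphXn /= horner_mx_X.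
have := hT 'X^m; rewrite !rmorphXn /= !horner_mx_X => -> /(congr1 (fun M => invmx P *m M *m P)).
by rewrite mulmx0 mul0mx !mulmxA mulVmx // mul1mx mulmxKV.
Qed.

(** With [y] from [conj_semisimple], the trace of [x *m y] is minus the sum of the traces of [u i]
    times [[y, v i]]. Each [[y, v i]] is a polynomial in [ad_mx] applied to [v i], hence built from
    elements of [L], where the trace form vanishes. *)
Lemma cartan_nilpotent (L : 'M[C]_m -> Prop) k (u v : 'I_k -> 'M[C]_m) :
  (forall z, L z -> L (x *m z - z *m x)) ->
  (forall a b, L a -> L b -> \tr (a *m b) = 0) ->
  (forall i, L (u i) /\ L (v i)) ->
  x = \sum_i (u i *m v i - v i *m u i) -> x ^+ m = 0.
Proof.
move=> Lad Ltr Luv xE; have [y [q [yq]]] := conj_semisimple; apply.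
have trq a b : L a -> L b -> \tr (a *m (y *m b - b *m y)) = 0.
  move=> La Lb; rewrite -[y *m b - b *m y]mxvecK yq.
  (* [L] is not assumed to be a subspace, so [q] is expanded and each monomial is treated alone. *)
  have Lk j c : L c -> L (vec_mx (mxvec c *m ad_mx ^+ j)).
    elim: j c => [|j IH] c Lc; first by rewrite expr0 mulmx1 mxvecK.
    by rewrite exprS -mulmxE mulmxA ad_mxE; apply/IH/Lad.
  rewrite -[q]coefK poly_def rmorph_sum mulmx_sumr !linear_sum /=.
  rewrite big1 // => j _; rewrite linearZ /= rmorphXn /= horner_mx_X.
  by rewrite -scalemxAr !linearZ /= Ltr ?mulr0 //; apply: Lk.
rewrite {1}xE mulmx_suml linear_sum big1 // => i _; have [Lu Lv] := Luv i.
by apply: etrans (mxtrace_commutator _ _ _) _; rewrite trq ?oppr0.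
Qed.

End AdPoly.

Section RealCartan.
Import complex.

(** Extension of scalars. As [L] is a mere predicate, its image under the embedding of the reals
    serves directly and no complex span has to be formed. *)
Lemma cartan_nilpotent_real (R : rcfType) n (x : 'M[R]_n.+1)
    (L : 'M[R]_n.+1 -> Prop) k (u v : 'I_k -> 'M[R]_n.+1) :
  (forall z, L z -> L (x *m z - z *m x)) ->
  (forall a b, L a -> L b -> \tr (a *m b) = 0) ->
  (forall i, L (u i) /\ L (v i)) ->
  x = \sum_i (u i *m v i - v i *m u i) -> x ^+ n.+1 = 0.
Proof.
move=> Lad Ltr Luv xE; pose f (M : 'M[R]_n.+1) := map_mx (real_complex R) M.
have fM (a b : 'M[R]_n.+1) : f (a *m b) = f a *m f b by exact: map_mxM.
have fB (a b : 'M[R]_n.+1) : f (a - b) = f a - f b by exact: map_mxB.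
have [r] := closed_field_poly_normal (char_poly (f x)).
rewrite (monicP (char_poly_monic _)) scale1r => rE.
suff : (f x) ^+ n.+1 = 0.
  have -> j : f x ^+ j = f (x ^+ j).
    elim: j => [|j IH]; first by rewrite !expr0 /f map_scalar_mx /= rmorph1.
    by rewrite !exprS IH -!mulmxE fM.
  move=> /matrixP e; apply/matrixP => i j; have := e i j.
  by rewrite !mxE => -[].
apply: (@cartan_nilpotent _ _ _ r rE (fun z => exists2 y, L y & z = f y) k
  (fun i => f (u i)) (fun i => f (v i))).
- by move=> z [y Ly ->]; exists (x *m y - y *m x); rewrite ?fB ?fM //; exact: Lad.
- move=> a b [a' La ->] [b' Lb ->]; rewrite -fM trace_map_mx Ltr // rmorph0 //.
- by move=> i; have [Lu Lv] := Luv i; split; [exists (u i)|exists (v i)].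
rewrite {1}xE /f map_mx_sum /=; apply: eq_bigr => i _.
by rewrite [LHS]fB !fM.
Qed.

End RealCartan.

(** * Perfectness of simple Lie algebras and Engel's theorem *)

Section Simple.
Variables (R : realType) (s : lieAlgebra R).
Implicit Types (x y z : s) (U V W M N I : {vspace s}).

Lemma lbNr x y : lb x (- y) = - lb x y.
Proof. by rewrite -scaleN1r lbZr scaleN1r. Qed.
Lemma lbNl x y : lb (- x) y = - lb x y.
Proof. by rewrite -scaleN1r lbZl scaleN1r. Qed.
Lemma lbBr x y z : lb x (y - z) = lb x y - lb x z.
Proof. by rewrite lbDr lbNr. Qed.
Lemma lb_leibniz x y z : lb x (lb y z) = lb (lb x y) z + lb y (lb x z).
Proof.
have := lb_jacobi x y z; rewrite (lbC z (lb x y)) (lbC z x) lbNr => /eqP.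
by rewrite -addrA -opprD subr_eq0 addrC => /eqP.
Qed.
Lemma lb_sumr (K : finType) (P : pred K) x (f : K -> s) :
  lb x (\sum_(i | P i) f i) = \sum_(i | P i) lb x (f i).
Proof. by elim/big_rec2: _ => [|i u v _ <-]; rewrite ?lb0r ?lbDr. Qed.
Lemma lb_suml (K : finType) (P : pred K) x (f : K -> s) :
  lb (\sum_(i | P i) f i) x = \sum_(i | P i) lb (f i) x.
Proof. by elim/big_rec2: _ => [|i u v _ <-]; rewrite ?lb0l ?lbDl. Qed.

Lemma lb_memC U x y : lb x y \in U -> lb y x \in U.
Proof. by move=> xyU; rewrite lbC -scaleN1r memvZ. Qed.

Definition derived : {vspace s} :=
  <<[seq lb x y | x <- vbasis {:s}, y <- vbasis {:s}]>>%VS.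

Lemma lb_derived x y : lb x y \in derived.
Proof.
rewrite (coord_vbasis (memvf x)) (coord_vbasis (memvf y)).
rewrite lb_suml memv_suml // => i _; rewrite lb_sumr memv_suml // => j _.
rewrite lbZl lbZr !memvZ // memv_span //; apply/allpairsP.
by exists ((vbasis {:s})`_i, (vbasis {:s})`_j); split=> //; rewrite mem_nth // size_tuple.
Qed.

Hypothesis simp : lie_simple s.

Lemma simple_derived : derived = fullv.
Proof.
have [[x [y xy]] H] := simp; have [||//] := H derived.
  by move=> a b _; exact: lb_derived.
by move=> d0; have := lb_derived x y; rewrite d0 memv0 (negPf xy).
Qed.

Lemma simple_perfect x : exists k (u v : 'I_k -> s), x = \sum_i lb (u i) (v i).
Proof.
pose p := in_tuple (allpairs pair (vbasis {:s}) (vbasis {:s})).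
pose l := map_tuple (fun q => lb q.1 q.2) p.
have : x \in span l.
  suff -> : span l = derived by rewrite simple_derived memvf.
  by rewrite /= map_allpairs.
move=> /coord_span ->.
exists _, (fun i => coord l i x *: (tnth p i).1), (fun i => (tnth p i).2).
by apply: eq_bigr => i _; rewrite lbZl -tnth_nth tnth_map.
Qed.

(** Perfectness as an induction principle: an additive property need only be checked on brackets. *)
Lemma simple_ind (P : s -> Prop) :
  (forall x y, P x -> P y -> P (x + y)) -> P 0 -> (forall x y, P (lb x y)) -> forall x, P x.
Proof.
move=> PD P0 Pl x; have [k [u [v ->]]] := simple_perfect x.
by elim/big_ind: _.
Qed.

Lemma simple_center x : (forall y, lb x y = 0) -> x = 0.
Proof.
have [[a [b ab]] H] := simp; move=> x0.
have [|e|f] := H <[x]>%VS.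
- by move=> y z /vlineP[c ->]; rewrite lbZr lbC x0 oppr0 scaler0 mem0v.
- by apply/eqP; rewrite -memv0 -e memv_line.
have : b \in <[x]>%VS by rewrite f memvf.
have : a \in <[x]>%VS by rewrite f memvf.
move=> /vlineP[c ac] _; move: ab; rewrite ac lbZl x0 scaler0 eqxx //.
Qed.

Definition subalgebra M := forall x y, x \in M -> y \in M -> lb x y \in M.

Hypothesis ad_nilp : forall x y, exists k, iter k (lb x) y = 0.

Lemma addv_line M v : v \notin M -> (\dim (M + <[v]>) = (\dim M).+1)%N.
Proof.
move=> vM; rewrite dimv_disjoint_sum ?dim_vline.
  by case: eqP vM => [->|_ _]; rewrite ?mem0v // addn1.
apply/eqP; rewrite -subv0; apply/subvP => w /memv_capP[wM /vlineP[c wc]].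
have [c0|c0] := eqVneq c 0; first by rewrite wc c0 scale0r mem0v.
by move: wM; rewrite wc rpredZeq (negPf c0) (negPf vM).
Qed.

(* A version of Engel's theorem for the quotient module [W / U]. *)
Lemma engel d M U W : (\dim M < d)%N -> subalgebra M ->
  (forall x y, x \in M -> y \in U -> lb x y \in U) ->
  (forall x y, x \in M -> y \in W -> lb x y \in W) ->
  (U <= W)%VS -> U != W ->
  exists v, [/\ v \in W, v \notin U & forall x, x \in M -> lb x v \in U].
Proof.
elim: d M U W => // d IH M U W; rewrite ltnS => dM subM MU MW UW nUW.
have [w0 w0W w0U] : exists2 w, w \in W & w \notin U.
  by apply/subvPn; apply: contra nUW => WU; rewrite eqEsubv UW.
have [M0|nM0] := eqVneq M 0%VS.
  by exists w0; split=> // x; rewrite M0 memv0 => /eqP->; rewrite lb0l mem0v.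
(* Take a proper subalgebra [N] of [M] of maximal dimension. Induction on the module [M / N] gives
   [v] outside [N] that normalises [N], and maximality then gives [M = N + <[v]>]. *)
pose Pr k := exists N : {vspace s}, [/\ subalgebra N, (N <= M)%VS, N != M & \dim N = k].
have [k [[N [subN NM nNM dN]] kmax]] : exists k, Pr k /\ forall j, Pr j -> (j <= k)%N.
  have exP : exists k, `[< Pr k >].
    exists 0%N; apply/asboolP; exists 0%VS; split; rewrite ?sub0v ?dimv0 1?eq_sym //.
    by move=> x y; rewrite !memv0 => /eqP-> _; rewrite lb0l.
  have bnd k : `[< Pr k >] -> (k <= \dim M)%N.
    by move=> /asboolP[N [_ NM _ <-]]; exact: dimvS.
  case: (ex_maxnP exP bnd) => k /asboolP Pk kmax; exists k; split=> // j Pj.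
  by apply: kmax; apply/asboolP.
have dNM : (\dim N < \dim M)%N.
  by rewrite ltn_neqAle dimvS // andbT; apply: contra nNM => /eqP e; rewrite eqEdim NM e leqnn.
have NU x y : x \in N -> y \in U -> lb x y \in U by move=> /(subvP NM); exact: MU.
have NW x y : x \in N -> y \in W -> lb x y \in W by move=> /(subvP NM); exact: MW.
have NMst x y : x \in N -> y \in M -> lb x y \in M by move=> /(subvP NM); exact: subM.
have [v [vM vN Nv]] := IH N N M (leq_trans dNM dM) subN subN NMst NM nNM.
have Mv : M = (N + <[v]>)%VS.
  apply/eqP; rewrite eq_sym; apply: contraT => nNv.
  have := kmax (\dim N).+1 _; rewrite dN ltnn => -> //.
  exists (N + <[v]>)%VS; split=> //; last by rewrite addv_line // dN.
    move=> x y /memv_addP[x1 x1N [x2 /vlineP[a ->] ->]].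
    move=> /memv_addP[y1 y1N [y2 /vlineP[c ->] ->]].
    rewrite lbDl !lbDr !lbZl !lbZr lb_alt !scaler0 addr0.
    apply: (subvP (addvSl _ _)); rewrite !memvD ?subN ?memvZ ?Nv //.
    by apply/lb_memC/Nv.
  by apply/subvP => x /memv_addP[x1 /(subvP NM) x1M [x2 /vlineP[a ->] ->]]; rewrite memvD ?memvZ.
have [w [wW wU Nw]] := IH N U W (leq_trans dNM dM) subN NU NW UW nUW.
(* Vectors sent into [U] by [N] stay such under [lb v], because [v] normalises [N]. *)
have stab k' : iter k' (lb v) w \in W /\ forall x, x \in N -> lb x (iter k' (lb v) w) \in U.
  elim: k' => //= k' [IW IN]; split; first by apply: MW.
  move=> x xN; rewrite lb_leibniz memvD //; last by apply: MU => //; exact: IN.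
  by apply: IN; exact: Nv.
(* Nilpotency of [v]: the last iterate outside [U] is killed modulo [U] by [v] as well as by [N]. *)
have ex : exists k', iter k' (lb v) w \in U.
  by have [k' e] := ad_nilp v w; exists k'; rewrite e mem0v.
case: (ex_minnP ex) => -[|k'] kU kmin.
  by move: wU; rewrite kU.
exists (iter k' (lb v) w); split; first by case: (stab k').
  by apply/negP => /kmin; rewrite ltnn.
rewrite Mv => x /memv_addP[x1 x1N [x2 /vlineP[a ->] ->]].
by rewrite lbDl lbZl memvD ?memvZ //; case: (stab k') => _; apply.
Qed.

(** By [engel], a maximal proper subalgebra [N] is normalised by some [v] outside it, so [N + <[v]>]
    is everything and [N] is an ideal. Being proper, it is zero; then the algebra is a line, hence
    abelian. *)
Lemma simple_not_nilpotent : False.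
Proof.
have [[a [b /eqP ab]] H] := simp.
have sub0 : subalgebra 0%VS by move=> x y; rewrite !memv0 => /eqP-> _; rewrite lb0l.
pose Pr k := exists N, [/\ subalgebra N, N != fullv & \dim N = k].
have exP : exists k, `[< Pr k >].
  exists 0%N; apply/asboolP; exists 0%VS; split; rewrite ?dimv0 //.
  apply/eqP => e; apply: ab; apply/eqP.
  by have := memvf a; rewrite -e memv0 => /eqP->; rewrite lb0l.
have bnd k : `[< Pr k >] -> (k <= \dim {:s})%N.
  by move=> /asboolP[N [_ _ <-]]; exact/dimvS/subvf.
case: (ex_maxnP exP bnd) => k /asboolP[N [subN nN dN]] kmax.
have [|||v [_ vN Nv]] := @engel (\dim N).+1 N N fullv (leqnn _) subN subN.
- by move=> *; exact: memvf.
- exact: subvf.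
- by [].
have Nvf : (N + <[v]>)%VS = fullv.
  apply/eqP; apply: contraT => nNv.
  have := kmax (\dim N).+1; rewrite dN ltnn => -> //; apply/asboolP.
  exists (N + <[v]>)%VS; split=> //; last by rewrite addv_line // dN.
  move=> x y /memv_addP[x1 x1N [x2 /vlineP[c ->] ->]].
  move=> /memv_addP[y1 y1N [y2 /vlineP[e ->] ->]].
  rewrite lbDl !lbDr !lbZl !lbZr lb_alt !scaler0 addr0.
  apply: (subvP (addvSl _ _)); rewrite !memvD ?subN ?memvZ ?Nv //.
  by apply/lb_memC/Nv.
have [|N0|//] := H N.
- move=> x y yN; have := memvf x; rewrite -Nvf => /memv_addP[x1 x1N [x2 /vlineP[c ->] ->]].
  rewrite lbDl lbZl; apply: memvD; first exact: subN.
  by apply/memvZ/lb_memC/Nv.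
- move: (memvf a) (memvf b); rewrite -Nvf N0 add0v => /vlineP[c ac] /vlineP[e be].
  by apply: ab; rewrite ac be lbZl lbZr lb_alt !scaler0.
by move=> /eqP; apply/negP.
Qed.

End Simple.

Lemma matrix_nilp (R : realType) n (x : 'M[R]_n)
    (L : 'M[R]_n -> Prop) k (u v : 'I_k -> 'M[R]_n) :
  (forall z, L z -> L (x *m z - z *m x)) ->
  (forall a b, L a -> L b -> \tr (a *m b) = 0) ->
  (forall i, L (u i) /\ L (v i)) ->
  x = \sum_i (u i *m v i - v i *m u i) -> exists k, x ^+ k = 0.
Proof.
case: n x L u v => [|n] x L u v; last first.
  by move=> H1 H2 H3 xE; exists n.+1; exact: (cartan_nilpotent_real H1 H2 H3 xE).
by exists 0%N; apply/matrixP => -[].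
Qed.

(** * The trace form of a representation containing the adjoint one *)

Section Cartan.
Variables (R : realType) (s : lieAlgebra R) (n : nat).
Variables (rho : s -> 'M[R]_n) (iota : s -> 'rV[R]_n).
Hypotheses (simp : lie_simple s) (rho_lin : linear rho) (iota_lin : linear iota).
Hypotheses (iota_inj : injective iota).
(* [rho A] acts on row vectors, hence the order of the products. *)
Hypothesis rho_hom : forall A B, rho (lb A B) = rho B *m rho A - rho A *m rho B.
Hypothesis rho_iota : forall A B, iota B *m rho A = iota (lb A B).

(** If the form vanished, every [rho A] would be nilpotent by Cartan's argument, since [A] is a sum
    of brackets. Through the embedding [iota] every [lb A] would be nilpotent too, against
    [simple_not_nilpotent]. *)
Lemma trace_form_neq0 : exists A B, \tr (rho A *m rho B) != 0.
Proof.
apply: contrapT => /forallNP noA.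
have tr0 A B : \tr (rho A *m rho B) = 0.
  by apply/eqP; apply: contrapT => h; apply: (noA A); exists B; apply/negP.
apply: (@simple_not_nilpotent _ s) => // A B.
pose rL : {linear s -> 'M[R]_n} := HB.pack rho (GRing.isLinear.Build R s _ *:%R rho rho_lin).
have rho0 : iota 0 = 0.
  by have := iota_lin (-1) 0 0; rewrite !scaleN1r oppr0 addr0 addNr.
suff nilp : exists k, (rho A) ^+ k = 0.
  have [k rk] := nilp; exists k; apply: iota_inj; rewrite rho0.
  have -> j : iota (iter j (lb A) B) = iota B *m (rho A) ^+ j.
    elim: j => [|j IH]; first by rewrite mulmx1.
    by rewrite iterS -rho_iota IH exprSr -mulmxA.
  by rewrite rk mulmx0.
have [k [u [v Auv]]] := simple_perfect simp A.
(* [rho] reverses commutators, so the roles of [u] and [v] are exchanged. *)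
apply: (@matrix_nilp _ _ (rho A) (fun z => exists B0, z = rho B0) k
  (fun i => rho (v i)) (fun i => rho (u i))).
- by move=> z [B1 ->]; exists (lb B1 A); rewrite rho_hom.
- by move=> a b [a' ->] [b' ->].
- by move=> i; split; [exists (v i)|exists (u i)].
rewrite {1}Auv; apply: etrans (linear_sum rL _ _ _) _.
by apply: eq_bigr => i _; exact: rho_hom.
Qed.
End Cartan.

(** * Three-dimensional simple Lie algebras *)

Section Coordinates.
Variables (R : realType) (V : vectType R).

(** Coordinates reduce identities between vectors to identities between scalars, which [vring] and
    [vfield] then close. *)
Definition vco (i : 'I_(\dim {:V})) (x : V) : R := coord (vbasis {:V}) i x.
Lemma vcoD i x y : vco i (x + y) = vco i x + vco i y.
Proof. by rewrite /vco linearD. Qed.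
Lemma vcoN i x : vco i (- x) = - vco i x.
Proof. by rewrite /vco linearN. Qed.
Lemma vcoZ i a x : vco i (a *: x) = a * vco i x.
Proof. by rewrite /vco linearZ. Qed.
Lemma vco0 i : vco i 0 = 0.
Proof. by rewrite /vco linear0. Qed.
Lemma vco_ext x y : (forall i, vco i x = vco i y) -> x = y.
Proof.
move=> e; rewrite (coord_vbasis (memvf x)) (coord_vbasis (memvf y)).
by apply: eq_bigr => i _; congr (_ *: _); exact: e.
Qed.

End Coordinates.

Definition vcoE := (vcoD, vcoN, vcoZ, vco0).

Ltac vring := apply: vco_ext => ?; rewrite !vcoE; ring.
Ltac vfield := apply: vco_ext => ?; rewrite !vcoE; field.

Section Diagonal.
Variable R : realType.

Definition basis3 (V : vectType R) (a b c : V) :=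
  (forall x, exists x1 x2 x3, x = x1 *: a + x2 *: b + x3 *: c) /\
  (forall x1 x2 x3, x1 *: a + x2 *: b + x3 *: c = 0 -> [/\ x1 = 0, x2 = 0 & x3 = 0]).

Definition diag_basis (L : lieAlgebra R) (p q r : R) (a b c : L) :=
  [/\ basis3 a b c, lb a b = p *: c, lb b c = q *: a & lb c a = r *: b].

Lemma diag_basis_iso (L L' : lieAlgebra R) p q r (a b c : L) (a' b' c' : L') :
  diag_basis p q r a b c -> diag_basis p q r a' b' c' -> lie_iso L L'.
Proof.
move=> [[sp fr] ab bc ca] [[sp' fr'] ab' bc' ca'].
have uniq x1 x2 x3 y1 y2 y3 : x1 *: a + x2 *: b + x3 *: c =
    y1 *: a + y2 *: b + y3 *: c -> [/\ x1 = y1, x2 = y2 & x3 = y3].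
  move=> e; have [|e1 e2 e3] := fr (x1 - y1) (x2 - y2) (x3 - y3).
    have -> : 0 = x1 *: a + x2 *: b + x3 *: c - (y1 *: a + y2 *: b + y3 *: c).
      by rewrite e subrr.
    by vring.
  by split; apply/eqP; rewrite -subr_eq0 ?e1 ?e2 ?e3.
have ex x : exists v : R * R * R, x = v.1.1 *: a + v.1.2 *: b + v.2 *: c.
  by have [x1 [x2 [x3 e]]] := sp x; exists (x1, x2, x3).
pose k x := projT1 (cid (ex x)).
have kE x : x = (k x).1.1 *: a + (k x).1.2 *: b + (k x).2 *: c := projT2 (cid (ex x)).
pose f x := (k x).1.1 *: a' + (k x).1.2 *: b' + (k x).2 *: c'.
have fE x1 x2 x3 : f (x1 *: a + x2 *: b + x3 *: c) = x1 *: a' + x2 *: b' + x3 *: c'.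
  by rewrite /f; have [-> -> ->] := uniq _ _ _ _ _ _ (esym (kE (x1 *: a + x2 *: b + x3 *: c))).
have flin : linear f.
  move=> u x y; rewrite (kE x) (kE y).
  set X := k x; set Y := k y.
  have -> : u *: (X.1.1 *: a + X.1.2 *: b + X.2 *: c) +
     (Y.1.1 *: a + Y.1.2 *: b + Y.2 *: c) = (u * X.1.1 + Y.1.1) *: a +
     (u * X.1.2 + Y.1.2) *: b + (u * X.2 + Y.2) *: c by vring.
  by rewrite !fE; vring.
exists f; split=> //.
- have ex' x : exists v : R * R * R, x = v.1.1 *: a' + v.1.2 *: b' + v.2 *: c'.
    by have [x1 [x2 [x3 e]]] := sp' x; exists (x1, x2, x3).
  exists (fun y => let v := projT1 (cid (ex' y)) in v.1.1 *: a + v.1.2 *: b + v.2 *: c).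
    move=> x; case: cid => /= v; rewrite /f => e; rewrite [RHS]kE.
    have [|e1 e2 e3] := fr' ((k x).1.1 - v.1.1) ((k x).1.2 - v.1.2) ((k x).2 - v.2).
      rewrite -(subrr (v.1.1 *: a' + v.1.2 *: b' + v.2 *: c')) -{1}e.
      by vring.
    by congr (_ *: _ + _ *: _ + _ *: _); apply/esym/eqP; rewrite -subr_eq0 ?e1 ?e2 ?e3.
  by move=> y; case: cid => /= v e; rewrite fE -e.
move=> x y; rewrite (kE x) (kE y); set X := k x; set Y := k y.
have br (M : lieAlgebra R) (u v w : M) : lb u v = p *: w -> lb v w = q *: u ->
  lb w u = r *: v -> lb (X.1.1 *: u + X.1.2 *: v + X.2 *: w) (Y.1.1 *: u + Y.1.2 *: v + Y.2 *: w)
  = (q * (X.1.2 * Y.2 - X.2 * Y.1.2)) *: u + (r * (X.2 * Y.1.1 - X.1.1 * Y.2)) *: v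
   + (p * (X.1.1 * Y.1.2 - X.1.2 * Y.1.1)) *: w.
  move=> uv vw wu; rewrite !(lbDl, lbDr, lbZl, lbZr) !lb_alt (lbC v u) (lbC w v) (lbC u w).
  by rewrite uv vw wu; vring.
by rewrite (br _ a b c) // !fE (br _ a' b' c').
Qed.

Lemma diag_basis_rot (L : lieAlgebra R) p q r (a b c : L) :
  diag_basis p q r a b c -> diag_basis q r p b c a.
Proof.
move=> [[sp fr] ab bc ca]; split=> //; split=> [x|x1 x2 x3 e].
  by have [x1 [x2 [x3 ->]]] := sp x; exists x2, x3, x1; vring.
by have [|-> -> ->] := fr x3 x1 x2; rewrite // -e; vring.
Qed.

Lemma diag_basis_scale (L : lieAlgebra R) p q r (a b c : L) x y z :
  x != 0 -> y != 0 -> z != 0 -> diag_basis p q r a b c ->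
  diag_basis (x * y * p / z) (y * z * q / x) (z * x * r / y) (x *: a) (y *: b) (z *: c).
Proof.
move=> x0 y0 z0 [[sp fr] ab bc ca]; split.
- split=> [u|x1 x2 x3 e].
    have [x1 [x2 [x3 ->]]] := sp u; exists (x1 / x), (x2 / y), (x3 / z).
    by rewrite !scalerA !divfK.
  have [|e1 e2 e3] := fr (x1 * x) (x2 * y) (x3 * z); first by rewrite -e; vring.
  by split; apply/eqP; move: e1 e2 e3 => /eqP + /eqP + /eqP; rewrite !mulf_eq0
    (negPf x0) (negPf y0) (negPf z0) !orbF.
- by rewrite lbZl lbZr ab !scalerA divfK.
- by rewrite lbZl lbZr bc !scalerA divfK.
- by rewrite lbZl lbZr ca !scalerA divfK.
Qed.

End Diagonal.

Section Models.
Variable R : realType.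

(** The halves normalise the structure constants to [1], [-1], [-1]; the generator of [z] is the
    rotation. *)
Definition sl2_mx (x y z : R) : 'M[R]_2 :=
  \matrix_(i, j) nth 0 (nth [::] [:: [:: x / 2; (y + z) / 2]; [:: (y - z) / 2; - x / 2]] i) j.

Lemma sl2_mxP x y z : sl2_mx x y z \in sl_space R 2.
Proof. by rewrite sl_spaceP /mxtrace !big_ord_recl big_ord0 !mxE /=; apply/eqP; lra. Qed.

Definition sl2_elt x y z : sl_lie R 2 := Subvs (sl2_mxP x y z).

Lemma sl2_diag_basis :
  diag_basis 1 (-1) (-1) (sl2_elt 1 0 0) (sl2_elt 0 1 0) (sl2_elt 0 0 1).
Proof.
have lin x1 x2 x3 : x1 *: sl2_elt 1 0 0 + x2 *: sl2_elt 0 1 0 + x3 *: sl2_elt 0 0 1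
    = sl2_elt x1 x2 x3.
  apply: val_inj; apply/matrixP => i j; rewrite /= !mxE.
  by case: i => [[|[|//]] ?]; case: j => [[|[|//]] ?] /=; field.
have br x y z x' y' z' : lb (sl2_elt x y z) (sl2_elt x' y' z') =
    sl2_elt (z * y' - y * z') (x * z' - z * x') (x * y' - y * x').
  apply: val_inj; apply/matrixP => i j; rewrite /= !mxE !big_ord_recl !big_ord0 !mxE.
  by case: i => [[|[|//]] ?]; case: j => [[|[|//]] ?] /=; field.
have cong x y z x' y' z' : x = x' -> y = y' -> z = z' -> sl2_elt x y z = sl2_elt x' y' z'.
  by move=> -> -> ->.
split; rewrite ?br.
- split=> [A|x1 x2 x3]; rewrite ?lin.
    exists (vsval A 0 0 *+ 2), (vsval A 0 1 + vsval A 1 0), (vsval A 0 1 - vsval A 1 0).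
    rewrite lin; apply: val_inj; apply/matrixP => i j; rewrite /= !mxE.
    have := subvsP A; rewrite sl_spaceP /mxtrace !big_ord_recl big_ord0 addr0 => /eqP.
    have -> : lift ord0 ord0 = 1 :> 'I_2 by apply: val_inj.
    move=> e; case: i => [[|[|//]] hi]; case: j => [[|[|//]] hj] /=.
    + have -> : Ordinal hi = 0 by apply: val_inj.
      have -> : Ordinal hj = 0 by apply: val_inj.
      by field.
    + have -> : Ordinal hi = 0 by apply: val_inj.
      have -> : Ordinal hj = 1 by apply: val_inj.
      by field.
    + have -> : Ordinal hi = 1 by apply: val_inj.
      have -> : Ordinal hj = 0 by apply: val_inj.
      by field.
    + have -> : Ordinal hi = 1 by apply: val_inj.
      have -> : Ordinal hj = 1 by apply: val_inj.
      by move: e; lra.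
  move/(congr1 (fun A => vsval A)) => /= /matrixP e.
  have := e 0 0; have := e 0 1; have := e 1 0; rewrite !mxE /= => e1 e2 e3.
  by split; lra.
- by rewrite scale1r; apply: cong; ring.
- have -> : (-1) *: sl2_elt 1 0 0 = sl2_elt (-1) 0 0.
    by rewrite -(lin (-1)) !scale0r !addr0.
  by apply: cong; ring.
- have -> : (-1) *: sl2_elt 0 1 0 = sl2_elt 0 (-1) 0.
    by rewrite -(lin 0 (-1)) !scale0r add0r !addr0.
  by apply: cong; ring.
Qed.

(** The matrix of the cross product with [(x, y, z)]. *)
Definition so3_mx (x y z : R) : 'M[R]_3 :=
  \matrix_(i, j) nth 0 (nth [::] [:: [:: 0; - z; y]; [:: z; 0; - x]; [:: - y; x; 0]] i) j.

Lemma so3_mxP x y z : so3_mx x y z \in so_space R 3.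
Proof.
rewrite so_spaceP; apply/eqP/matrixP => i j; rewrite !mxE.
by case: i => [[|[|[|//]]] ?]; case: j => [[|[|[|//]]] ?] /=; rewrite ?opprK ?oppr0.
Qed.

Definition so3_elt x y z : so_lie R 3 := Subvs (so3_mxP x y z).

Lemma so3_diag_basis :
  diag_basis 1 1 1 (so3_elt 1 0 0) (so3_elt 0 1 0) (so3_elt 0 0 1).
Proof.
have lin x1 x2 x3 : x1 *: so3_elt 1 0 0 + x2 *: so3_elt 0 1 0 + x3 *: so3_elt 0 0 1
    = so3_elt x1 x2 x3.
  apply: val_inj; apply/matrixP => i j; rewrite /= !mxE.
  by case: i => [[|[|[|//]]] ?]; case: j => [[|[|[|//]]] ?] /=; ring.
have br x y z x' y' z' : lb (so3_elt x y z) (so3_elt x' y' z') =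
    so3_elt (y * z' - z * y') (z * x' - x * z') (x * y' - y * x').
  apply: val_inj; apply/matrixP => i j; rewrite /= !mxE !big_ord_recl !big_ord0 !mxE.
  by case: i => [[|[|[|//]]] ?]; case: j => [[|[|[|//]]] ?] /=; ring.
have cong x y z x' y' z' : x = x' -> y = y' -> z = z' -> so3_elt x y z = so3_elt x' y' z'.
  by move=> -> -> ->.
split; rewrite ?br ?scale1r; try by apply: cong; ring.
split=> [A|x1 x2 x3]; rewrite ?lin.
  exists (vsval A 2 1), (vsval A 0 2), (vsval A 1 0).
  rewrite lin; apply: val_inj; apply/matrixP => i j; rewrite /= !mxE.
  have := subvsP A; rewrite so_spaceP => /eqP/matrixP e.
  have eA k l : vsval A k l = - vsval A l k by have := e l k; rewrite !mxE.
  have e0 k : vsval A k k = 0 by have := eA k k; lra.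
  have o (k : 'I_3) : [\/ k = 0, k = 1 | k = 2].
    by case: k => [[|[|[|//]]] hk]; [constructor 1|constructor 2|constructor 3]; apply: val_inj.
  case: (o i) => ->; case: (o j) => -> /=; rewrite ?e0 //; exact/esym/eA.
move/(congr1 (fun A => vsval A)) => /= /matrixP e.
have := e 1 0; have := e 0 2; have := e 2 1; rewrite !mxE /= => e1 e2 e3.
by split.
Qed.

(** Rescaling the basis multiplies each product of two structure constants by a square, so only the
    signs of these products matter. If all are positive the model is [so_lie R 3]; otherwise one
    constant has the sign opposite to the other two, and a rotation brings it to the front to match
    [sl_lie R 2]. *)
Lemma diag_basis_class (L : lieAlgebra R) (p q r : R) (a b c : L) :
  p != 0 -> q != 0 -> r != 0 -> diag_basis p q r a b c ->
  lie_iso L (sl_lie R 2) \/ lie_iso L (so_lie R 3).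
Proof.
have sg (u : R) : 0 < u -> exists2 v, v != 0 & v * v = u.
  move=> u0; exists (Num.sqrt u); first by rewrite gt_eqF // sqrtr_gt0.
  by rewrite -expr2 sqr_sqrtr // ltW.
have mixed (p' q' r' : R) (a' b' c' : L) : p' * q' < 0 -> p' * r' < 0 ->
    diag_basis p' q' r' a' b' c' -> lie_iso L (sl_lie R 2).
  move=> pq pr db.
  have q0 : q' != 0 by apply: contraTN pq => /eqP->; rewrite mulr0 ltxx.
  have p0 : p' != 0 by apply: contraTN pq => /eqP->; rewrite mul0r ltxx.
  have r0 : r' != 0 by apply: contraTN pr => /eqP->; rewrite mulr0 ltxx.
  (* The scales solve [x * y / z = p'], [- (y * z / x) = q'] and [- (z * x / y) = r']. *)
  have [|x x0 xx] := sg (- (p' * r')); first by rewrite oppr_gt0.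
  have [|y y0 yy] := sg (- (p' * q')); first by rewrite oppr_gt0.
  have z0 : x * y / p' != 0 by rewrite !mulf_neq0 ?invr_eq0.
  apply: (diag_basis_iso db).
  have := diag_basis_scale x0 y0 z0 sl2_diag_basis.
  have -> : x * y * 1 / (x * y / p') = p' by field; rewrite p0 x0 y0.
  have -> : y * (x * y / p') * -1 / x = q'.
    by have -> : y * (x * y / p') * -1 / x = - (y * y) / p' by [field; rewrite p0 x0];
    rewrite yy; field.
  have -> : x * y / p' * x * -1 / y = r'.
    by have -> : x * y / p' * x * -1 / y = - (x * x) / p' by [field; rewrite p0 y0];
    rewrite xx; field.
  exact: id.
have same : 0 < p * q -> 0 < p * r -> diag_basis p q r a b c -> lie_iso L (so_lie R 3).
  move=> pq pr db.
  have p0 : p != 0 by apply: contraTN pq => /eqP->; rewrite mul0r ltxx.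
  have [x x0 xx] := sg _ pr.
  have [y y0 yy] := sg _ pq.
  have z0 : x * y / p != 0 by rewrite !mulf_neq0 ?invr_eq0.
  apply: (diag_basis_iso db).
  have := diag_basis_scale x0 y0 z0 so3_diag_basis.
  have -> : x * y * 1 / (x * y / p) = p by field; rewrite p0 x0 y0.
  have -> : y * (x * y / p) * 1 / x = q.
    by have -> : y * (x * y / p) * 1 / x = (y * y) / p by [field; rewrite p0 x0];
    rewrite yy; field.
  have -> : x * y / p * x * 1 / y = r.
    by have -> : x * y / p * x * 1 / y = (x * x) / p by [field; rewrite p0 y0];
    rewrite xx; field.
  exact: id.
move=> p0 q0 r0 db; have db1 := diag_basis_rot db; have db2 := diag_basis_rot db1.
have sp (u v : R) : u != 0 -> v != 0 -> (u * v < 0) \/ (0 < u * v) :> Prop.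
  move=> u0 v0; have := mulf_neq0 u0 v0.
  by case: (ltgtP (u * v) 0) => // h _; [left|right].
case: (sp _ _ p0 q0) => pq; case: (sp _ _ p0 r0) => pr.
- by left; apply: mixed db.
- left; apply: mixed db1; last by rewrite mulrC.
  suff : 0 < - (q * r) * (p * p) by rewrite pmulr_lgt0 ?oppr_gt0 // -expr2 exprn_even_gt0.
  by nra.
- left; apply: mixed db2; first by rewrite mulrC.
  suff : 0 < - (r * q) * (p * p) by rewrite pmulr_lgt0 ?oppr_gt0 // -expr2 exprn_even_gt0.
  by nra.
- by right; apply: same db.
Qed.

End Models.

(** * Simple Lie algebras with a rank one identity *)

Section Rank1.
Variables (R : realType) (s : lieAlgebra R) (t : s) (al : s -> R).
Hypotheses (simp : lie_simple s) (t0 : t != 0) (al_lin : scalar al).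
Hypothesis key : forall A B, lb (lb A B) t = al B *: A - al A *: B.

Let alD x y : al (x + y) = al x + al y.
Proof. by have := al_lin 1 x y; rewrite scale1r mul1r. Qed.
Let al0 : al 0 = 0.
Proof. by apply: (addrI (al 0)); rewrite -alD !addr0. Qed.
Let alZ a x : al (a *: x) = a * al x.
Proof. by have := al_lin a x 0; rewrite !addr0 al0 addr0. Qed.
Let alB x y : al (x - y) = al x - al y.
Proof. by rewrite alD -scaleN1r alZ mulN1r. Qed.

Let alN x : al (- x) = - al x.
Proof. by rewrite -scaleN1r alZ mulN1r. Qed.

Let al_adt x : al (lb x t) = 0.
Proof.
elim/(simple_ind simp): x => [x y hx hy||x y].
- by rewrite lbDl alD hx hy addr0.
- by rewrite lb0l al0.
- by rewrite key alB !alZ; ring.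
Qed.

Let al_tad x : al (lb t x) = 0.
Proof. by rewrite lbC -scaleN1r alZ al_adt mulr0. Qed.

Let scal_eq0 a : a *: t = 0 -> a = 0.
Proof. by move=> /eqP; rewrite scaler_eq0 (negPf t0) orbF => /eqP. Qed.

(** On the kernel of [al] the square of [lb t] is the scalar [c], so [t] spans its own centraliser,
    and brackets of elements of the kernel, which commute with [t], are multiples of [t]. The basis
    is [t], [A], [lb t A] for a suitable [A]. *)
Lemma rank1_semisimple : al t != 0 -> exists p q r a b c,
  [/\ p != 0, q != 0, r != 0 & diag_basis p q r a b (c : s)].
Proof.
set c := al t => c0.
have J2 A : al A = 0 -> lb t (lb t A) = c *: A.
  move=> A0; have := key A t; rewrite A0 scale0r subr0 => <-.
  by rewrite (lbC (lb A t)) (lbC A t) lbNr opprK.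
have kert x : lb x t = 0 -> x = (al x / c) *: t.
  move=> xt; apply/eqP; rewrite -subr_eq0; set y := _ - _.
  have y0 : al y = 0 by rewrite /y alB alZ divfK // subrr.
  have := J2 _ y0; rewrite (_ : lb t y = 0) ?lb0r; last first.
    by rewrite /y lbBr lbZr lb_alt lbC xt oppr0 scaler0 subrr.
  by move/esym/eqP; rewrite scaler_eq0 (negPf c0).
have brV A B : al A = 0 -> al B = 0 -> exists w, lb A B = w *: t.
  move=> A0 B0; exists (al (lb A B) / c); apply: kert.
  by rewrite key A0 B0 !scale0r subrr.
have dec x : exists2 A, al A = 0 & x = (al x / c) *: t + A.
  exists (x - (al x / c) *: t); last by rewrite addrC subrK.
  by rewrite alB alZ divfK // subrr.
(* Otherwise polarisation makes the kernel of [al] abelian. Then [al] vanishes on every bracket,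
   hence on [t] by perfectness. *)
have [A [A0 AJA]] : exists A, al A = 0 /\ lb A (lb t A) != 0.
  apply: contrapT => /forallNP H.
  have H' A : al A = 0 -> lb A (lb t A) = 0.
    by move=> A0; apply/eqP; apply: contrapT => /negP h; apply: (H A).
  have pol A B : al A = 0 -> al B = 0 -> lb A (lb t B) = - lb B (lb t A).
    move=> A0 B0; apply/eqP; rewrite -addr_eq0; apply/eqP.
    have := H' (A + B); rewrite alD A0 B0 addr0 => /(_ erefl).
    by rewrite !(lbDl, lbDr) !H' // add0r addr0.
  have VV A B : al A = 0 -> al B = 0 -> lb A B = 0.
    have VJ A' B' : al A' = 0 -> al B' = 0 -> lb A' (lb t B') = 0.
      move=> A0 B0; have [w wE] := brV _ _ A0 B0.
      have := lb_leibniz t A' B'; rewrite wE lbZr lb_alt scaler0.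
      rewrite (lbC (lb t A')) -(pol _ _ A0 B0) => /esym/eqP.
      by rewrite -mulr2n -scaler_nat scaler_eq0 pnatr_eq0 => /eqP.
    move=> A0 B0; have -> : B = c^-1 *: lb t (lb t B) by rewrite J2 // scalerA mulVf // scale1r.
    by rewrite lbZr VJ ?scaler0 // al_tad.
  have : al t = 0.
    elim/(simple_ind simp): t => [x y hx hy||x y]; [by rewrite alD hx hy addr0|by []|].
    have [A A0 ->] := dec x; have [B B0 ->] := dec y.
    rewrite !(lbDl, lbDr, lbZl, lbZr) lb_alt (VV A B) // !scaler0 add0r addr0.
    by rewrite alD !alZ al_tad al_adt; ring.
  exact/eqP.
set B := lb t A; have B0 : al B = 0 by exact: al_tad.
have [w wE] := brV A B A0 B0.
have w0 : w != 0 by apply: contraNneq AJA => w0; rewrite -/B wE w0 scale0r.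
exists 1, w, (- c), t, A, B; split; rewrite ?oner_neq0 ?oppr_eq0 //; split=> //.
- split.
    move=> x; have [D D0 ->] := dec x.
    have [be beE] := brV B D B0 D0; have [ga gaE] := brV D A D0 A0.
    (* Dimension three: by the Jacobi identity for [D], [A], [B] this combination commutes with [t],
       and it lies in the kernel of [al], where [lb t] is injective. *)
    have e : w *: D + be *: A + ga *: B = 0.
      have := J2 (w *: D + be *: A + ga *: B).
      rewrite !(alD, alZ) A0 B0 D0 !mulr0 !addr0 => /(_ erefl).
      have -> : lb t (w *: D + be *: A + ga *: B) = 0.
        have := lb_jacobi D A B; rewrite wE beE gaE !lbZr.
        rewrite (lbC D) (lbC A) (lbC B) => j.
        by rewrite !(lbDr, lbZr); rewrite -[LHS]opprK -oppr0 -{1}j; vring.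
      by rewrite lb0r => /esym/eqP; rewrite scaler_eq0 (negPf c0) => /eqP.
    exists (al x / c), (- be / w), (- ga / w).
    have -> : D = w^-1 *: (w *: D) by rewrite scalerA mulVf // scale1r.
    have -> : w *: D = - (be *: A) - ga *: B.
      by apply/eqP; rewrite -subr_eq0 -[X in _ == X]e; apply/eqP; vring.
    by vring.
  move=> x1 x2 x3 e.
  have x10 : x1 = 0.
    have : al (x1 *: t + x2 *: A + x3 *: B) = 0 by rewrite e al0.
    by rewrite !(alD, alZ) A0 B0 !mulr0 !addr0 => /eqP; rewrite mulf_eq0 (negPf c0) orbF => /eqP.
  move: e; rewrite x10 scale0r add0r => e.
  have x30 : x3 = 0.
    have : lb A (x2 *: A + x3 *: B) = 0 by rewrite e lb0r.
    rewrite lbDr !lbZr lb_alt scaler0 add0r wE scalerA => /scal_eq0/eqP.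
    by rewrite mulf_eq0 (negPf w0) orbF => /eqP.
  have x20 : x2 = 0.
    have : lb B (x2 *: A + x3 *: B) = 0 by rewrite e lb0r.
    rewrite lbDr !lbZr lb_alt scaler0 addr0 lbC wE -scaleNr scalerA => /scal_eq0/eqP.
    by rewrite mulf_eq0 oppr_eq0 (negPf w0) orbF => /eqP.
  by [].
- by rewrite scale1r.
- by rewrite lbC J2 // scaleNr.
Qed.

(** Here [t] is the nilpotent element of an [sl_2] triple: with [al B = 1], the element [H = lb t B]
    satisfies [lb H t = t], and [B] has to be corrected into the opposite nilpotent. *)
Lemma rank1_nilpotent : al t = 0 -> exists p q r a b c,
  [/\ p != 0, q != 0, r != 0 & diag_basis p q r a b (c : s)].
Proof.
move=> alt.
have [B B1] : exists B, al B = 1.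
  apply: contrapT => /forallNP H.
  have al00 B : al B = 0.
    apply/eqP; apply: contrapT => /negP h; apply: (H ((al B)^-1 *: B)).
    by rewrite alZ mulVf.
  move/eqP: t0; apply; apply: (simple_center simp) => y.
  elim/(simple_ind simp): y => [x y hx hy||x y].
  - by rewrite lbDr hx hy addr0.
  - by rewrite lb0r.
  - by rewrite lbC key !al00 !scale0r subrr oppr0.
have keyV A : al A = 0 -> lb (lb A B) t = A.
  by move=> A0; rewrite key B1 A0 scale0r subr0 scale1r.
set H := lb t B; have Ht : lb H t = t by exact: keyV.
have alH : al H = 0 by exact: al_tad.
have tH : lb t H = - t by rewrite lbC Ht.
have tV w : al w = 0 -> lb t w = al (lb w B) *: t.
  move=> w0; rewrite -{1}(keyV _ w0) lb_leibniz lb_alt lb0r addr0.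
  by rewrite key alt scale0r subr0.
(* every [x] commuting with [t] acts on [ker al] by scalars, forcing [x] onto the line of [t] *)
have kert x : lb x t = 0 -> exists k, x = k *: t.
  move=> xt; have h y : lb x (lb y t) = al y *: x - al x *: y.
    by rewrite -key lb_leibniz xt lb0r addr0.
  have alx : al x = 0.
    by have := h t; rewrite lb_alt lb0r alt scale0r sub0r -scaleNr => /esym/scal_eq0/eqP;
      rewrite oppr_eq0 => /eqP.
  have [->|x0] := eqVneq x 0; first by exists 0; rewrite scale0r.
  have alK : al (lb x B) = 0.
    have := h (lb x B); rewrite keyV // lb_alt alx scale0r subr0 => /esym/eqP.
    by rewrite scaler_eq0 (negPf x0) orbF => /eqP.
  exists (- al (lb (lb x B) B)); have := tV _ alK.
  by rewrite lbC keyV // scaleNr => <-; rewrite opprK.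
have V2 w : al w = 0 -> exists be k, w = - be *: H + k *: t /\ lb t w = be *: t.
  move=> w0; set be := al (lb w B); have [k kE] : exists k, w + be *: H = k *: t.
    by apply: kert; rewrite lbDl lbZl Ht lbC tV // addNr.
  by exists be, k; rewrite -kE tV //; split=> //; vring.
(* Expand [lb H B] in [B], [H], [t]. Its bracket with [t] must be [H], which fixes the first two
   coefficients. *)
have [k kE] : exists k, lb H B = - B + k *: t.
  set G := lb H B; set z := al G.
  have [be [k [wE tw]]] : exists be k, G - z *: B = - be *: H + k *: t /\
      lb t (G - z *: B) = be *: t by apply: V2; rewrite alB alZ B1 mulr1 subrr.
  have GE : G = z *: B - be *: H + k *: t.
    by rewrite -[LHS](subrK (z *: B)) wE; vring.
  have Gt : - z *: H - be *: t = H.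
    rewrite -[RHS](keyV _ alH) -/G GE !(lbDl, lbNl, lbZl) Ht lb_alt lbC -/H.
    by vring.
  have z1 : z = -1.
    have := congr1 (lb t) Gt; rewrite lbBr !lbZr lb_alt tH => e.
    have /scal_eq0 : (z + 1) *: t = 0.
      by rewrite -(subrr (- t)) -{1}e; vring.
    by lra.
  have be0 : be = 0.
    apply: scal_eq0; apply: (addIr H); rewrite -{1}Gt z1 add0r; vring.
  by exists k; rewrite GE z1 be0; vring.
(* As [t] and [B] have eigenvalues [1] and [-1] under [lb H], subtracting [k / 2] times [t] removes
   the term in [t]. *)
set B' := B - (k / 2) *: t.
have tB' : lb t B' = H by rewrite lbBr lbZr lb_alt scaler0 subr0.
have HB' : lb H B' = - B' by rewrite lbBr lbZr Ht kE /B'; vfield.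
have B'1 : al B' = 1 by rewrite alB alZ alt mulr0 subr0.
move: B' tB' HB' B'1 => B' tB' HB' B'1.
(* The sum and the difference of the two nilpotents diagonalise the triple. *)
exists 1, (-2), (-1), H, (t + B'), (t - B').
split; rewrite ?oner_neq0 ?oppr_eq0 ?pnatr_eq0 ?oner_neq0 //; split.
- split.
    move=> x; have [be [g [xE _]]] : exists be g, x - al x *: B' = - be *: H + g *: t /\
      lb t (x - al x *: B') = be *: t by apply: V2; rewrite alB alZ B'1 mulr1 subrr.
    exists (- be), ((g + al x) / 2), ((g - al x) / 2).
    by rewrite -[LHS](subrK (al x *: B')) xE; vfield.
  move=> x1 x2 x3 e.
  have e23 : x2 - x3 = 0.
    have := congr1 al e; rewrite al0 !(alN, alD, alZ) alt alH B'1; lra.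
  have e1 : x1 = 0.
    have := congr1 (lb t) e; rewrite !(lbDr, lbZr, lbNr) lb_alt lb0r tB' tH => e'.
    have /scal_eq0 : - x1 *: t = 0.
      have x23 : x2 = x3 by lra.
      by rewrite -e' x23; vring.
    by lra.
  have /scal_eq0 : (x2 + x3) *: t = 0.
    by rewrite -e e1 (_ : x2 = x3); [vring | lra].
  by split=> //; lra.
- by rewrite lbDr Ht HB' scale1r.
- by rewrite lbDl lbBr lbBr !lb_alt (lbC B') tB'; vring.
- by rewrite lbC lbBr Ht HB'; vring.
Qed.

Lemma simple_rank1_class :
  lie_iso s (sl_lie R 2) \/ lie_iso s (so_lie R 3).
Proof.
suff [p [q [r [a [b [c [p0 q0 r0 db]]]]]]] : exists p q r a b c,
  [/\ p != 0, q != 0, r != 0 & diag_basis p q r a b (c : s)].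
  exact: diag_basis_class db.
by have [/rank1_nilpotent|/rank1_semisimple] := eqVneq (al t) 0.
Qed.

End Rank1.

(** * Double extensions *)

Section DextAlgebra.
Variables (R : realType) (h : metricLie R) (s : lieAlgebra R).
Variables (b : s -> s -> R) (delta : s -> 'End(h)).
Hypotheses (hb : invariant_form b) (hd : skew_der_action delta).
Hypothesis simp : lie_simple s.
Local Notation L := (double_ext hb hd).
Local Notation dual := ('Hom(s, R^o)).
Local Notation hf := (ml_invariant h).

Definition in_s (A : s) : L := (0, 0, A).
Definition in_h (X : h) : L := (0, X, 0).
Definition in_d (sg : dual) : L := (sg, 0, 0).

Lemma dual_ext (x y : s) : (forall sg : dual, sg x = sg y) -> x = y.
Proof.
move=> e; apply: vco_ext => i.
have := e (linfun (vco i : s -> R^o)).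
by rewrite !linfun_linE // => a u v; rewrite vcoD vcoZ.
Qed.

Lemma in_s_br A B : lb (in_s A) (in_s B) = in_s (lb A B).
Proof.
congr (_, _, _) => /=; rewrite ?lb0l ?linear0 ?subr0 ?addr0 //.
apply/lfunP => T; rewrite !(coadE, delta_pairingE hd, add_lfunE, opp_lfunE).
by rewrite !zero_lfunE !linear0 (if0l hf); ring.
Qed.

Lemma in_s_br0 A sg X : lb (in_s A) (sg, X, 0) = (coad A sg, delta A X, 0) :> L.
Proof.
congr (_, _, _) => /=; rewrite ?lb0l ?lb0r ?linear0 ?(delta0 hd) ?subr0 ?add0r ?addr0 //.
apply/lfunP => T; rewrite !(coadE, delta_pairingE hd, add_lfunE, opp_lfunE).
by rewrite !zero_lfunE !linear0 (if0l hf); ring.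
Qed.

Lemma dext_formE sg X A sg' X' A' : ml_form ((sg, X, A) : L) (sg', X', A') =
  ml_form X X' + b A A' + (sg A' : R) + (sg' A : R).
Proof. by []. Qed.

(** * The integrability identity on a double extension *)

Section KeyIdentity.
Variables (K : L -> L -> R) (eta : L -> R) (q : R) (T : L).
Hypotheses (K_linl : forall y, scalar (K^~ y)) (K_sym : forall x y, K x y = K y x).
Hypothesis K_dual : forall sg x, K (in_d sg) x = 0.
Hypothesis K_inv : forall z x y, K (lb z x) y + K x (lb z y) = 0.
Hypothesis K_neq0 : exists A B, K (in_s A) (in_s B) != 0.
Hypotheses (eta_lin : scalar eta) (q0 : q != 0) (T0 : T != 0).
Hypothesis keyT : forall X Y Z, 4^-1 * ml_form (lb (lb X Y) T) Z =
  ml_form T X * (q * K Y Z) - ml_form T Y * (q * K X Z)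
  - eta X * ml_form Y Z + eta Y * ml_form X Z.

Local Notation k A B := (K (in_s A) (in_s B)).

Let K_dualr sg x : K x (in_d sg) = 0.
Proof. by rewrite K_sym K_dual. Qed.

Let kDl A B C : k (A + B) C = k A C + k B C.
Proof.
have := K_linl (in_s C) 1 (in_s A) (in_s B); rewrite scale1r mul1r => <-.
by congr K; rewrite /in_s; congr (_, _, _); rewrite /= addr0.
Qed.
Let kZl a B C : k (a *: B) C = a * k B C.
Proof.
have k0 : K 0 (in_s C) = 0 by have := K_linl (in_s C) 1 0 0; rewrite scale1r mul1r addr0; lra.
have := K_linl (in_s C) a (in_s B) 0; rewrite k0 !addr0 => <-.
by congr K; rewrite /in_s; congr (_, _, _); rewrite /= scaler0.
Qed.
Let k_inv A B C : k (lb A B) C + k B (lb A C) = 0.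
Proof. by rewrite -!in_s_br K_inv. Qed.

Let k_lin A : linear (fun C => k A C : R^o).
Proof. by move=> a B C; rewrite !(K_sym (in_s A)) kDl kZl. Qed.

Let kf (A : s) : dual := linfun (fun C => k A C : R^o).
Let kfE A C : kf A C = k A C. Proof. exact: linfun_linE (k_lin A) C. Qed.

Let kf_lin : linear kf.
Proof.
move=> a A B; apply/lfunP => C.
by rewrite add_lfunE scale_lfunE !kfE kDl kZl.
Qed.

(** The radical is an ideal, and [K_neq0] prevents it from being all of [s]. *)
Let k_nondeg A : (forall C, k A C = 0) -> A = 0.
Proof.
move=> A0; have [_ /(_ (lker (linfun kf)))[]] := simp.
- move=> x y; rewrite !memv_ker !linfun_linE // => /eqP y0; apply/eqP/lfunP => C.
  rewrite zero_lfunE kfE; have := k_inv x y C; rewrite -(kfE y) y0 zero_lfunE; lra.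
- move=> k0; apply/eqP; rewrite -memv0 -k0 memv_ker linfun_linE //.
  by apply/eqP/lfunP => C; rewrite zero_lfunE kfE.
- move=> kf0; have [A1 [B1 /eqP]] := K_neq0; case.
  have := memvf A1; rewrite -kf0 memv_ker linfun_linE // => /eqP/lfunP/(_ B1).
  by rewrite zero_lfunE kfE.
Qed.

Let k_surj (tau : dual) : exists t, forall C, tau C = k t C.
Proof.
have inj : lker (linfun kf) == 0%VS.
  rewrite -subv0; apply/subvP => x; rewrite memv_ker linfun_linE // => /eqP x0.
  rewrite memv0; apply/eqP/k_nondeg => C; by rewrite -kfE x0 zero_lfunE.
have full : limg (linfun kf) = fullv.
  apply/eqP; rewrite eqEdim subvf /= limg_dim_eq; last by rewrite (eqP inj) capv0.
  by rewrite !dimvf /= /dim /= muln1.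
have := memvf tau; rewrite -full => /memv_imgP[t _ ->]; exists t => C.
by rewrite linfun_linE // kfE.
Qed.

Lemma dext_key_class : lie_iso s (sl_lie R 2) \/ lie_iso s (so_lie R 3).
Proof.
have etaD x y : eta (x + y) = eta x + eta y.
  by have := eta_lin 1 x y; rewrite scale1r mul1r.
have eta_s : scalar (fun A => eta (in_s A)).
  move=> a A B; rewrite -eta_lin; congr eta.
  by congr (_, _, _); rewrite /= ?scaler0 ?addr0.
have scal c (al : s -> R) : scalar al -> scalar (fun A => c * al A).
  by move=> al_lin u A B; rewrite al_lin; ring.
move: T T0 keyT => [[tau X0] S0] T0' key.
have [S00|S00] := eqVneq S0 0; last first.
  (* Pairing with [in_d sg] kills the [K] terms; clearing [4^-1] gives the factor [4] on [eta]. *)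
  apply: (@simple_rank1_class _ _ S0 _ simp S00 (scal 4 _ eta_s)) => A B.
  apply: dual_ext => sg; have := key (in_s A) (in_s B) (in_d sg).
  rewrite in_s_br !K_dualr !mulr0 subrr add0r.
  rewrite (_ : ml_form _ _ = sg (lb (lb A B) S0)); last first.
    by rewrite [LHS]dext_formE (if0r hf) (if0r hb) linear0 !add0r.
  rewrite !dext_formE !(if0r hf) !(if0r hb) !linear0 !add0r => e.
  rewrite !(linearB, linearZ) /= /GRing.scale /=; move: e; lra.
rewrite {}S00 in T0' key *.
have [a1 [b1 ab1]] : exists a1 b1 : s, lb a1 b1 != 0 by case: simp.
(* Without component in [s] the left side pairs to zero with the dual, so
   [eta (in_s B) *: A = eta (in_s A) *: B]. A nonzero value would make [s] a line. *)
have eta0 A : eta (in_s A) = 0.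
  have par B : eta (in_s B) *: A = eta (in_s A) *: B.
    apply: dual_ext => sg; have := key (in_s A) (in_s B) (in_d sg).
    rewrite in_s_br !K_dualr !mulr0 subrr add0r.
    rewrite (_ : lb _ _ = lb (in_s (lb A B)) (tau, X0, 0)) // in_s_br0.
    rewrite !dext_formE !(if0r hf) !(if0r hb) !linear0 !add0r => e.
    rewrite !linearZ /= /GRing.scale /=; move: e; lra.
  apply/eqP; apply: contraT => eA; move: ab1.
  have pB B : B = (eta (in_s B) / eta (in_s A)) *: A.
    by rewrite mulrC -scalerA par scalerA mulVf // scale1r.
  by rewrite (pB a1) (pB b1) lbZl lbZr lb_alt !scaler0 eqxx.
have key_s A B C : 4^-1 * - (tau (lb (lb A B) C) : R) =
    tau A * (q * k B C) - tau B * (q * k A C).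
  have := key (in_s A) (in_s B) (in_s C); rewrite !eta0 in_s_br in_s_br0.
  rewrite !dext_formE !(if0r hf) !(if0l hb) !zero_lfunE coadE.
  lra.
have [tau0|tau0] := eqVneq tau 0; last first.
  have [t tE] := k_surj tau.
  have t0 : t != 0.
    apply: contraNneq tau0 => t0; apply/eqP/lfunP => C.
    by rewrite tE t0 zero_lfunE -(scale0r (0 : s)) kZl mul0r.
  have tau_s : scalar (fun A => tau A : R) by move=> u A B; rewrite linearP.
  (* Invariance of [K] moves the double bracket in [key_s] onto [t]; comparison gives
     [al = - (4 * q) tau]. *)
  apply: (@simple_rank1_class _ _ t _ simp t0 (scal (- (4 * q)) _ tau_s)) => A B.
  apply/eqP; rewrite -subr_eq0; apply/eqP/k_nondeg => C.
  have kB x y : k (x - y) C = k x C - k y C by rewrite kDl -scaleN1r kZl mulN1r.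
  rewrite !kB !kZl.
  have := key_s A B C; rewrite (tE (lb _ C)) => e.
  have := k_inv (lb A B) t C; have -> : k t (lb (lb A B) C) = k (lb (lb A B) C) t by rewrite K_sym.
  by move: e; rewrite (K_sym (in_s t)); lra.
move: T0' key key_s; rewrite {}tau0 -/(in_h X0) => T0' key _.
have a0 : a1 != 0 by apply: contraNneq ab1 => ->; rewrite lb0l.
have br_sh A Y : lb (in_s A) (in_h Y) = in_h (delta A Y).
  by rewrite in_s_br0; congr (_, _, _); apply/lfunP => C; rewrite coadE !zero_lfunE oppr0.
have br_hh X Y C : ml_form (lb (in_h X) (in_h Y)) (in_s C) = ml_form (delta C X) Y.
  rewrite [LHS]dext_formE (if0r hf) lb0l (if0l hb) zero_lfunE.
  by rewrite !(coadE, delta_pairingE hd, add_lfunE, opp_lfunE) !zero_lfunE; ring.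
have br_hh' X Y sg : ml_form (lb (in_h X) (in_h Y)) (in_d sg) = 0.
  by rewrite [LHS]dext_formE (if0r hf) lb0l (if0l hb) !linear0; ring.
have T_s A : ml_form (in_h X0) (in_s A) = 0.
  by rewrite [LHS]dext_formE (if0r hf) (if0l hb) !zero_lfunE; ring.
(* Pairing [in_s a1] and [in_h Y] with [in_d sg] leaves only [eta (in_h Y)] times [sg a1]. *)
have eta_h Y : eta (in_h Y) = 0.
  have e (sg : dual) : eta (in_h Y) * (sg a1 : R) = 0.
    have := key (in_s a1) (in_h Y) (in_d sg).
    rewrite br_sh br_hh' !K_dualr T_s eta0 => e.
    rewrite (_ : (sg a1 : R) = ml_form (in_s a1) (in_d sg)); first by lra.
    by rewrite [RHS]dext_formE (if0r hf) (if0r hb) !linear0; ring.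
  apply/eqP; apply: contraT => e0; move: a0; rewrite (_ : a1 = 0) ?eqxx //.
  apply: dual_ext => sg; rewrite linear0; apply/eqP; have /eqP := e sg.
  by rewrite mulf_eq0 (negPf e0).
have dd A C : delta A (delta C X0) = (- (4 * q) * k A C) *: X0.
  apply/eqP; rewrite -subr_eq0; apply/eqP/ml_nondeg => Y.
  have := key (in_s A) (in_h Y) (in_s C).
  rewrite br_sh br_hh T_s eta0 eta_h.
  rewrite (_ : ml_form (in_h X0) (in_h Y) = ml_form X0 Y); last first.
    by rewrite [LHS]dext_formE (if0l hb) !linear0; ring.
  have := sda_skew hd A (delta C X0) Y; have := sda_skew hd C X0 (delta A Y).
  rewrite (if_sym hf X0) (ifDl hf) (ifNl hf) (ifZl hf); lra.
have d0 A : delta A X0 = 0.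
  elim/(simple_ind simp): A => [x y hx hy||x y].
  - by rewrite (deltaD hd) hx hy addr0.
  - by rewrite (delta0 hd).
  - by rewrite (sda_hom hd) !dd (K_sym (in_s x)) subrr.
have [A [C AC]] := K_neq0.
have := dd A C; rewrite !d0 linear0 => /esym/eqP.
rewrite scaler_eq0 !mulf_eq0 oppr_eq0 !mulf_eq0 (negPf q0) (negPf AC) pnatr_eq0 /=.
by move=> /eqP X00; move: T0'; rewrite X00 => /eqP.
Qed.

End KeyIdentity.

End DextAlgebra.

(** In a full rank factorisation of [A] into a column factor and a row factor, [A *m A = 0] forces
    the product in the reverse order to vanish, and that product has the same trace. *)
Lemma mxtrace_sqr0 (F : fieldType) n (A : 'M[F]_n) : A *m A = 0 -> \tr A = 0.
Proof.
move=> AA; rewrite -(mulmx_base A) mxtrace_mulC.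
suff -> : row_base A *m col_base A = 0 by rewrite mxtrace0.
have : col_base A *m (row_base A *m col_base A) *m row_base A = 0.
  by rewrite mulmxA mulmx_base -mulmxA mulmx_base AA.
move=> /eqP; rewrite -(mul0mx _ (row_base A)).
move=> /eqP/(row_free_inj (row_base_free A)) e.
have := congr1 (mulmx (pinvmx (col_base A))) e.
by rewrite mulmx0 mulmxA mulVpmx ?mul1mx // col_base_full.
Qed.

Lemma mx_rowP (F : pzRingType) m n (A B : 'M[F]_(m, n)) :
  (forall v : 'rV_m, v *m A = v *m B) -> A = B.
Proof. by move=> e; apply/row_matrixP => i; rewrite !rowE e. Qed.

Lemma mxtrace_commutator_inv (R : comNzRingType) n (x y z : 'M[R]_n) :
  \tr ((x *m z - z *m x) *m y) + \tr (x *m (y *m z - z *m y)) = 0.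
Proof.
rewrite mulmxBl mulmxBr !raddfB /= !mulmxA (mxtrace_mulC (x *m y) z) mulmxA.
ring.
Qed.

(** * The Killing form in coordinates *)

Section TraceForm.
Variables (R : realType) (L : lieAlgebra R) (n : nat).
Variables (f : 'rV[R]_n -> L) (g : L -> 'rV[R]_n).
Hypotheses (flin : linear f) (fK : cancel f g) (gK : cancel g f).

Fact glin : linear g.
Proof. by move=> a x y; apply: (can_inj fK); rewrite flin !gK. Qed.

Fact inv_lin0 : g 0 = 0.
Proof. by have := glin (-1) 0 0; rewrite !scaleN1r oppr0 addr0 addNr. Qed.
Let f0 : f 0 = 0. Proof. by rewrite -inv_lin0 gK. Qed.

Definition adjoint_fun (x : L) (v : 'rV[R]_n) := g (lb x (f v)).

Fact adjoint_fun_linear x : linear (adjoint_fun x).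
Proof. by move=> a u v; rewrite /adjoint_fun flin lbDr lbZr glin. Qed.

Definition adjoint_mx (x : L) : 'M[R]_n := lin1_mx (adjoint_fun x).

Lemma mul_adjoint_mx x v : v *m adjoint_mx x = g (lb x (f v)).
Proof.
pose F : {linear 'rV[R]_n -> 'rV[R]_n} := HB.pack (adjoint_fun x)
  (GRing.isLinear.Build R _ _ *:%R (adjoint_fun x) (adjoint_fun_linear x)).
exact: (mul_rV_lin1 F v).
Qed.

Lemma adjoint_mx_linear : linear adjoint_mx.
Proof.
move=> a x y; apply: mx_rowP => v.
by rewrite mulmxDr -scalemxAr !mul_adjoint_mx lbDl lbZl glin.
Qed.

Lemma adjoint_mx_br x y :
  adjoint_mx (lb x y) = adjoint_mx y *m adjoint_mx x - adjoint_mx x *m adjoint_mx y.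
Proof.
apply: mx_rowP => v; rewrite mulmxBr !mulmxA !mul_adjoint_mx !gK.
rewrite (lb_leibniz x) -[g (lb y _)]scale1r -scaleNr addrC -glin.
by rewrite scaleN1r addrC addrK.
Qed.

Definition trace_form x y : R := \tr (adjoint_mx x *m adjoint_mx y).

Lemma trace_form_linl y : scalar (trace_form^~ y).
Proof.
move=> a x z; rewrite /trace_form adjoint_mx_linear mulmxDl -scalemxAl.
by rewrite mxtraceD mxtraceZ.
Qed.

Lemma trace_form_sym x y : trace_form x y = trace_form y x.
Proof. exact: mxtrace_mulC. Qed.

Lemma trace_form_inv z x y : trace_form (lb z x) y + trace_form x (lb z y) = 0.
Proof.
by rewrite /trace_form !adjoint_mx_br mxtrace_commutator_inv.
Qed.

End TraceForm.

Section DextTrace.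
Variables (R : realType) (h : metricLie R) (s : lieAlgebra R).
Variables (b : s -> s -> R) (delta : s -> 'End(h)).
Hypotheses (hb : invariant_form b) (hd : skew_der_action delta).
Hypothesis simp : lie_simple s.
Local Notation L := (double_ext hb hd).
Local Notation dual := ('Hom(s, R^o)).
Variables (n : nat) (f : 'rV[R]_n -> L) (g : L -> 'rV[R]_n).
Hypotheses (flin : linear f) (fK : cancel f g) (gK : cancel g f).

Local Notation K := (trace_form f g).

Let in_dP (sg : dual) (x : L) : exists sg' : dual, lb (in_d hb hd sg) x = in_d hb hd sg'.
Proof.
case: x => [[tau X] A]; exists (- coad A sg); congr (_, _, _) => /=.
- apply/lfunP => C; rewrite !(coadE, delta_pairingE hd, add_lfunE, opp_lfunE).
  by rewrite !lb0l !linear0 (if0l (ml_invariant h)); ring.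
- by rewrite lb0l (delta0 hd) linear0 addr0 subr0.
- by rewrite lb0l.
Qed.

Let in_dP' (sg : dual) (x : L) : exists sg' : dual, lb x (in_d hb hd sg) = in_d hb hd sg'.
Proof.
have [sg' e] := in_dP sg x; exists (- sg'); rewrite lbC e.
by congr (_, _, _); rewrite /= oppr0.
Qed.

Let in_d_br (sg tau : dual) : lb (in_d hb hd sg) (in_d hb hd tau) = 0.
Proof.
congr (_, _, _) => /=; rewrite ?lb0l ?(delta0 hd) ?subr0 ?addr0 //.
apply/lfunP => C; rewrite !(coadE, delta_pairingE hd, add_lfunE, opp_lfunE).
by rewrite !lb0l !linear0 (if0l (ml_invariant h)) zero_lfunE; ring.
Qed.

Let mE := (mul_adjoint_mx flin fK gK).

(** The dual of [s] is an abelian ideal, so bracketing with [in_d sg], [x], [in_d sg] in turn gives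
    zero. The product under the trace therefore squares to zero. *)
Lemma trace_form_dual sg x : K (in_d hb hd sg) x = 0.
Proof.
apply: mxtrace_sqr0; apply: mx_rowP => v.
rewrite mulmx0 !mulmxA !mE !gK; have [s1 ->] := in_dP sg (f v).
have [s2 ->] := in_dP' s1 x; rewrite in_d_br lb0r.
exact: (inv_lin0 flin fK gK).
Qed.

(** Cartan's criterion for [s] acting on the whole extension, which contains the adjoint module as
    the image of [in_s]. *)
Lemma trace_form_s_neq0 : exists A B : s, K (in_s hb hd A) (in_s hb hd B) != 0.
Proof.
have slin : linear (in_s hb hd).
  by move=> a A B; congr (_, _, _); rewrite /= ?scaler0 ?addr0.
have [|||||A [B]] := @trace_form_neq0 R s n (fun A => adjoint_mx f g (in_s hb hd A))
  (fun B => g (in_s hb hd B)) simp; last by exists A, B.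
- by move=> a A B; rewrite slin (adjoint_mx_linear flin fK gK).
- by move=> a A B; rewrite slin (glin flin fK gK).
- by move=> A B /(can_inj gK) [].
- by move=> A B; rewrite -in_s_br (adjoint_mx_br flin fK gK).
- by move=> A B; rewrite mE gK in_s_br.
Qed.

Lemma dext_not_einstein (c : R) :
  ~ forall x y : L, K x y = c * ml_form x y.
Proof.
move=> e; have [A [B]] := trace_form_s_neq0; rewrite e.
have [->|c0] := eqVneq c 0; first by rewrite mul0r eqxx.
have A0 C : C = 0 :> s.
  apply: (dual_ext) => sg; have := e (in_d hb hd sg) (in_s hb hd C).
  rewrite trace_form_dual [ml_form _ _]dext_formE (if0l (ml_invariant h)) (if0l hb).
  by rewrite !linear0 add0r addr0 add0r => /esym/eqP; rewrite mulf_eq0 (negPf c0) => /eqP.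
rewrite (A0 A) (A0 B) [ml_form _ _]dext_formE (if0l (ml_invariant h)) (if0l hb).
by rewrite !zero_lfunE !addr0 mulr0 eqxx.
Qed.

Lemma dext_class (T : L) (eta : L -> R) (q : R) : T != 0 -> q != 0 -> scalar eta ->
  (forall X Y Z, 4^-1 * ml_form (lb (lb X Y) T) Z =
    ml_form T X * (q * K Y Z) - ml_form T Y * (q * K X Z)
    - eta X * ml_form Y Z + eta Y * ml_form X Z) ->
  lie_iso s (sl_lie R 2) \/ lie_iso s (so_lie R 3).
Proof.
move=> T0 q0 eta_lin key.
exact: (dext_key_class simp (trace_form_linl flin fK gK) (@trace_form_sym _ _ _ _ _)
  trace_form_dual (trace_form_inv flin fK gK) trace_form_s_neq0 eta_lin q0 T0 key).
Qed.

(** Two elements of [s] with nonzero bracket are independent, and the dual doubles the contribution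
    of [s]. The bound makes [n - 2] invertible in the Einstein equation. *)
Lemma dext_dim_ge3 : (2 < n)%N.
Proof.
have [a [c ac]] : exists a c : s, lb a c != 0 by case: simp.
have c0 : c != 0 by apply: contraNneq ac => ->; rewrite lb0r.
have dims : (1 < dim s)%N.
  have fr : free [:: a; c].
    rewrite free_cons span_seq1 seq1_free c0 andbT; apply: contra ac => /vlineP[u ->].
    by rewrite lbZl lb_alt scaler0.
  by rewrite -dimvf; apply: leq_trans (dimvS (subvf <<[:: a; c]>>)); rewrite (eqP fr).
have full : limg (linfun f) = fullv.
  apply/vspaceP => x; rewrite memvf; apply/memv_imgP; exists (g x); rewrite ?memvf //.
  by rewrite linfun_linE // gK.
have inj : lker (linfun f) == 0%VS.
  rewrite -subv0; apply/subvP => v; rewrite memv_ker linfun_linE // => /eqP v0.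
  by rewrite memv0 -(fK v) v0 (inv_lin0 flin fK gK).
have : \dim (limg (linfun f)) = \dim {: 'rV[R]_n}.
  by apply: limg_dim_eq; rewrite (eqP inj) capv0.
rewrite full !dimvf.
have sum_gt2 (d e k : nat) : (1 < d -> d * 1 + e + d = 1 * k -> 2 < k)%N by lia.
exact: (sum_gt2 _ (dim h) _ dims).
Qed.

End DextTrace.

(** * Smooth matrix-valued functions *)

Local Open Scope classical_set_scope.
Local Open Scope ring_scope.

Lemma near_eq_differentiable (R : realType) (V W : normedModType R) (f g : V -> W) x :
  (\forall y \near x, f y = g y) -> differentiable f x -> differentiable g x.
Proof.
move=> fg df; have [dc /eqaddoP df'] := (diff_locallyP x f).1 df.
have E : g \o shift x = cst (g x) + 'd f x +o_ 0 id.
  apply/eqaddoP => e e0; have gx := nbhs_singleton fg.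
  have fg0 : \forall h \near 0, f (h + x) = g (h + x).
    by move: (fg); rewrite (near_shift 0 x) /= subr0.
  apply: filterS2 fg0 (df' e e0) => h fgh.
  by rewrite !fctE /= -gx -fgh.
apply/diff_locallyP; rewrite (diff_unique dc E); split=> //.
Qed.

Lemma derive_expR_comp (R : realType) (V : normedModType R) (f : V -> R) (x v : V) :
  differentiable f x -> 'D_v (fun y => expR (f y)) x = 'D_v f x * expR (f x).
Proof.
move=> df; have dexp (y : R) : differentiable (expR : R -> R) y.
  exact/derivable1_diffP/derivable_expR.
rewrite deriveE; last exact: differentiable_comp.
rewrite diff_comp //= deriveE //.
have -> : 'd f x v = 'd f x v *: (1 : R) by rewrite /GRing.scale /= mulr1.
have E : 'D_1 (expR : R -> R) (f x) = expR (f x) by exact: derive_val.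
by rewrite linearZ /= -[in RHS]E deriveE // /GRing.scale /= mulr1.
Qed.

(** * Finitely often differentiable functions *)

Section Ck.
Variables (R : realType) (V : normedModType R).
Implicit Types (A B : set V) (k : nat) (W : normedModType R).

(** Derivatives up to order [k] are themselves differentiable, so even those of top order are
    continuous and obey the product rule. *)
Fixpoint ck (W : normedModType R) k A (f : V -> W) : Prop :=
  (forall x, A x -> differentiable f x) /\
  (if k is k'.+1 then forall v, ck k' A (fun y => 'D_v f y) else True).

Lemma ck_diff W k A (f : V -> W) x : ck k A f -> A x -> differentiable f x.
Proof. by case: k => [|k] [df _]; exact: df. Qed.

Lemma ckS W k A (f : V -> W) : ck k.+1 A f -> ck k A f.
Proof.
elim: k f => [|k IH] f [df Df]; split=> // v; exact: IH.
Qed.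

Lemma ck_deriv W k A (f : V -> W) v : ck k.+1 A f -> ck k A (fun y => 'D_v f y).
Proof. by move=> [_]; apply. Qed.

Lemma ck_sub W k A B (f : V -> W) : B `<=` A -> ck k A f -> ck k B f.
Proof.
move=> BA; elim: k f => [|k IH] f [df Df]; split=> //.
- by move=> x /BA; exact: df.
- by move=> x /BA; exact: df.
- by move=> v; exact/IH/Df.
Qed.

Lemma ck_ext W k A (f g : V -> W) : open A -> (forall x, A x -> f x = g x) ->
  ck k A f -> ck k A g.
Proof.
move=> oA; elim: k f g => [|k IH] f g fg.
  move=> [df _]; split=> // x Ax; apply: near_eq_differentiable (df x Ax).
  by near=> y; apply: fg; near: y; exact: open_nbhs_nbhs.
have nfg x : A x -> \forall y \near x, f y = g y.
  by move=> Ax; near=> y; apply: fg; near: y; exact: open_nbhs_nbhs.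
move=> [df Df]; split=> [x Ax|v].
  exact: near_eq_differentiable (nfg x Ax) (df x Ax).
by apply: IH (Df v) => x /nfg; exact: near_eq_derive.
Unshelve. all: by end_near. Qed.

Lemma ck_cst W k A (a : W) : ck k A (fun=> a).
Proof.
elim: k a => [|k IH] a; split=> [x _|//]; try exact: differentiable_cst.
move=> v.
have -> : (fun y : V => 'D_v (fun=> a) y) = fun=> 0; last exact: IH.
by apply/funext => y; exact: derive_cst.
Qed.

Lemma ckD W k A (f g : V -> W) : open A -> ck k A f -> ck k A g ->
  ck k A (fun x => f x + g x).
Proof.
move=> oA; elim: k f g => [|k IH] f g [df Df] [dg Dg].
  by split=> // x Ax; apply: differentiableD; [exact: df|exact: dg].
split=> [x Ax|v]; first by apply: differentiableD; [exact: df|exact: dg].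
apply: ck_ext (IH _ _ (Df v) (Dg v)) => // x Ax.
by rewrite -deriveD //; apply: diff_derivable; [exact: df|exact: dg].
Qed.

Lemma ckM k A (f g : V -> R) : open A -> ck k A f -> ck k A g ->
  ck k A (fun x => f x * g x).
Proof.
move=> oA; elim: k f g => [|k IH] f g cf cg.
  by split=> // x Ax; apply: differentiableM; [exact: ck_diff cf Ax|exact: ck_diff cg Ax].
split=> [x Ax|v].
  by apply: differentiableM; [exact: ck_diff cf Ax|exact: ck_diff cg Ax].
have cF := IH _ _ (ckS cf) (ck_deriv v cg).
have cG := IH _ _ (ckS cg) (ck_deriv v cf).
apply: ck_ext (ckD oA cF cG) => // x Ax.
by rewrite [RHS]deriveM //; apply: diff_derivable; [exact: ck_diff cf Ax|exact: ck_diff cg Ax].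
Qed.

Lemma ckV k A (f : V -> R) : open A -> (forall x, A x -> f x != 0) -> ck k A f ->
  ck k A (fun x => (f x)^-1).
Proof.
move=> oA f0; elim: k => [|k IH] cf.
  by split=> // x Ax; apply: differentiableV; [exact: ck_diff cf Ax|exact: f0].
split=> [x Ax|v].
  by apply: differentiableV; [exact: ck_diff cf Ax|exact: f0].
have cV := IH (ckS cf).
have := ckM oA (ckM oA cV cV) (ckM oA (@ck_cst R k A (-1)) (ck_deriv v cf)).
apply: ck_ext => // x Ax; rewrite [RHS]deriveV ?f0 //.
  by rewrite -exprVn expr2 /GRing.scale /=; ring.
by apply: diff_derivable; exact: ck_diff cf Ax.
Qed.

Lemma ck_exp k A (f : V -> R) : open A -> ck k A f -> ck k A (fun x => expR (f x)).
Proof.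
move=> oA; have dexp x : differentiable (expR : R -> R) x.
  exact/derivable1_diffP/derivable_expR.
elim: k => [|k IH] cf.
  by split=> // x Ax; apply: differentiable_comp => //; exact: ck_diff cf Ax.
split=> [x Ax|v]; first by apply: differentiable_comp => //; exact: ck_diff cf Ax.
apply: ck_ext (ckM oA (ck_deriv v cf) (IH (ckS cf))) => // x Ax.
have df := ck_diff cf Ax.
by rewrite derive_expR_comp.
Qed.

Lemma ckN k A (f : V -> R) : open A -> ck k A f -> ck k A (fun x => - f x).
Proof.
move=> oA cf; apply: ck_ext (ckM oA (@ck_cst R k A (-1)) cf) => // x _.
by rewrite mulN1r.
Qed.

Lemma ck_sum k A (I : Type) (r : seq I) (P : pred I) (F : I -> V -> R) : open A ->
  (forall i, ck k A (F i)) -> ck k A (fun x => \sum_(i <- r | P i) F i x).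
Proof.
move=> oA cF; elim: r => [|i r IH].
  by apply: ck_ext (@ck_cst R k A 0) => // x _; rewrite big_nil.
have [Pi|Pi] := boolP (P i).
  by apply: ck_ext (ckD oA (cF i) IH) => // x _; rewrite big_cons Pi.
by apply: ck_ext IH => // x _; rewrite big_cons (negPf Pi).
Qed.

Lemma ck_prod k A (I : Type) (r : seq I) (P : pred I) (F : I -> V -> R) : open A ->
  (forall i, ck k A (F i)) -> ck k A (fun x => \prod_(i <- r | P i) F i x).
Proof.
move=> oA cF; elim: r => [|i r IH].
  by apply: ck_ext (@ck_cst R k A 1) => // x _; rewrite big_nil.
have [Pi|Pi] := boolP (P i).
  by apply: ck_ext (ckM oA (cF i) IH) => // x _; rewrite big_cons Pi.
by apply: ck_ext IH => // x _; rewrite big_cons (negPf Pi).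
Qed.

Lemma ck_entry k A m n (F : V -> 'M[R]_(m, n)) i j : open A -> ck k A F ->
  ck k A (fun x => F x i j).
Proof.
move=> oA; have dF (G : V -> 'M[R]_(m, n)) x :
    differentiable G x -> differentiable (fun x => G x i j) x.
  move=> dG; apply: (@differentiable_comp _ _ _ _ G (fun N : 'M[R]_(m, n) => N i j : R)) => //.
  exact: differentiable_coord.
elim: k F => [|k IH] F cF; split=> [x Ax|//]; try by apply: dF; exact: ck_diff cF Ax.
move=> v.
apply: ck_ext (IH _ (ck_deriv v cF)) => // x Ax.
by rewrite derive_mx ?mxE //; apply: diff_derivable; exact: ck_diff cF Ax.
Qed.

End Ck.

Lemma derive_pairl (R : realType) (V1 V2 W : normedModType R) (f : V1 * V2 -> W)
  (v x : V1) (c : V2) : 'D_(v, 0) f (x, c) = 'D_v (fun x => f (x, c)) x.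
Proof.
rewrite /derive; set g1 := fun h => h^-1 *: _; set g2 := fun h => h^-1 *: _.
suff -> : g1 = g2 by []; apply/funext => a; rewrite /g1 /g2 /=.
have -> // : a *: (v, 0 : V2) + (x, c) = (a *: v + x, c).
by rewrite -[LHS]/(a *: v + x, a *: (0 : V2) + c) scaler0 add0r.
Qed.

Lemma ck_pairl (R : realType) (V1 V2 W : normedModType R) k (A : set V1)
    (B : set (V1 * V2)) (c : V2) (f : V1 * V2 -> W) :
  (forall x, A x -> B (x, c)) -> ck k B f -> ck k A (fun x => f (x, c)).
Proof.
move=> AB; have dp (g : V1 * V2 -> W) x :
    differentiable g (x, c) -> differentiable (fun x => g (x, c)) x.
  by move=> df; apply: (@differentiable_comp _ _ _ _ (fun x => (x, c)) g) => //;
    apply: differentiable_pair => //; exact: differentiable_cst.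
elim: k f => [|k IH] f cf; split=> [x Ax|//]; try by apply/dp/(ck_diff cf)/AB.
move=> v.
suff -> : (fun y => 'D_v (fun x => f (x, c)) y) = fun y => 'D_(v, 0) f (y, c).
  exact: IH (ck_deriv (v, 0) cf).
by apply/funext => y; rewrite derive_pairl.
Qed.

Lemma derive_pairr (R : realType) (V1 V2 W : normedModType R) (f : V1 * V2 -> W)
  (v y : V2) (c : V1) : 'D_(0, v) f (c, y) = 'D_v (fun y => f (c, y)) y.
Proof.
rewrite /derive; set g1 := fun h => h^-1 *: _; set g2 := fun h => h^-1 *: _.
suff -> : g1 = g2 by []; apply/funext => a; rewrite /g1 /g2 /=.
have -> // : a *: (0 : V1, v) + (c, y) = (c, a *: v + y).
by rewrite -[LHS]/(a *: (0 : V1) + c, a *: v + y) scaler0 add0r.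
Qed.

Lemma ck_pairr (R : realType) (V1 V2 W : normedModType R) k (A : set V2)
    (B : set (V1 * V2)) (c : V1) (f : V1 * V2 -> W) :
  (forall x, A x -> B (c, x)) -> ck k B f -> ck k A (fun x => f (c, x)).
Proof.
move=> AB; have dp (g : V1 * V2 -> W) x :
    differentiable g (c, x) -> differentiable (fun x => g (c, x)) x.
  by move=> df; apply: (@differentiable_comp _ _ _ _ (fun x => (c, x)) g) => //;
    apply: differentiable_pair => //; exact: differentiable_cst.
elim: k f => [|k IH] f cf; split=> [x Ax|//]; try by apply/dp/(ck_diff cf)/AB.
move=> v.
suff -> : (fun y => 'D_v (fun x => f (c, x)) y) = fun y => 'D_(0, v) f (c, y).
  exact: IH (ck_deriv (0, v) cf).
by apply/funext => y; rewrite derive_pairr.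
Qed.

Lemma derive_line (R : realType) (V W : normedModType R) (f : V -> W) (x u : V) (t : R) :
  'D_1 (fun r : R => f (x + r *: u)) t = 'D_u f (x + t *: u).
Proof.
rewrite /derive; set g1 := fun h => h^-1 *: _; set g2 := fun h => h^-1 *: _.
suff -> : g1 = g2 by []; apply/funext => a; rewrite /g1 /g2 /=.
by rewrite [_ *: 1]mulr1 scalerDl addrCA.
Qed.

Lemma derivable_line (R : realType) (V W : normedModType R) (f : V -> W) (x u : V) (t : R) :
  derivable f (x + t *: u) u -> derivable (fun r : R => f (x + r *: u)) t 1.
Proof.
rewrite /derivable; set g1 := fun h => h^-1 *: _; set g2 := fun h => h^-1 *: _.
suff -> : g1 = g2 by []; apply/funext => a; rewrite /g1 /g2 /=.
by rewrite [_ *: 1]mulr1 scalerDl addrCA.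
Qed.

(** * Symmetry of second derivatives *)

Section Schwarz.
Variables (R : realType) (V : normedModType R) (A : set V) (f : V -> R).
Hypothesis oA : open A.

(** Mean value theorem twice: for [g] along [u], then along [v] for the derivative so obtained. *)
Lemma second_difference (x u v : V) (d : R) : 0 < d -> ck 2 A f ->
  (forall a c, 0 <= a <= d -> 0 <= c <= d -> A (x + a *: u + c *: v)) ->
  exists a c, [/\ 0 <= a <= d, 0 <= c <= d &
    f (x + d *: u + d *: v) - f (x + d *: u) - (f (x + d *: v) - f x) =
    d * d * 'D_v (fun y => 'D_u f y) (x + a *: u + c *: v)].
Proof.
move=> d0 cf Ad.
have d00 : 0 <= d <= d by rewrite lexx ltW.
have d000 : 0 <= (0 : R) <= d by rewrite lexx ltW.
pose g (r : R) := f (x + r *: u + d *: v) - f (x + r *: u).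
have Ad0 a : 0 <= a <= d -> A (x + a *: u).
  by move=> ad; have := Ad a 0 ad d000; rewrite scale0r addr0.
have dg r : 0 <= r <= d -> is_derive r 1 g ('D_u f (x + r *: u + d *: v) - 'D_u f (x + r *: u)).
  move=> rd; apply: is_deriveB.
    have -> : (fun r : R => f (x + r *: u + d *: v)) = fun r => f ((x + d *: v) + r *: u).
      by apply/funext => r'; rewrite addrAC.
    rewrite addrAC; apply: DeriveDef; last exact: derive_line.
    by apply/derivable_line/diff_derivable/(ck_diff cf); rewrite addrAC; exact: Ad.
  apply: DeriveDef; last exact: derive_line.
  by apply/derivable_line/diff_derivable/(ck_diff cf)/Ad0.
have [||a aI ga] := @MVT_segment R g
  (fun r => 'D_u f (x + r *: u + d *: v) - 'D_u f (x + r *: u)) 0 d (ltW d0).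
- by move=> r; rewrite in_itv /= => /andP[/ltW r0 /ltW rd]; apply: dg; rewrite r0.
- apply: derivable_within_continuous => r; rewrite in_itv /= => rd.
  by have [] := dg r rd.
have ad : 0 <= a <= d by move: aI; rewrite in_itv.
have cu := ck_deriv u cf.
pose k (r : R) := 'D_u f (x + a *: u + r *: v).
have dk r : 0 <= r <= d -> is_derive r 1 k ('D_v (fun y => 'D_u f y) (x + a *: u + r *: v)).
  move=> rd; apply: DeriveDef; last exact: (derive_line (fun y => 'D_u f y)).
  by apply/(derivable_line (f := fun y => 'D_u f y))/diff_derivable/(ck_diff cu)/Ad.
have [||c cI kc] := @MVT_segment R k
  (fun r => 'D_v (fun y => 'D_u f y) (x + a *: u + r *: v)) 0 d (ltW d0).
- by move=> r; rewrite in_itv /= => /andP[/ltW r0 /ltW rd]; apply: dk; rewrite r0.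
- apply: derivable_within_continuous => r; rewrite in_itv /= => rd.
  by have [] := dk r rd.
have cd : 0 <= c <= d by move: cI; rewrite in_itv.
exists a, c; split=> //.
move: ga kc; rewrite /g /k !scale0r !addr0 => -> ->.
ring.
Qed.

(** The second difference is symmetric in [u] and [v], so the two mixed derivatives agree at points
    arbitrarily close to [x]; continuity does the rest. *)
Lemma derive_symm (x u v : V) : ck 3 A f -> A x ->
  'D_v (fun y => 'D_u f y) x = 'D_u (fun y => 'D_v f y) x.
Proof.
move=> cf Ax; apply/eqP; rewrite -subr_eq0 -normr_le0; apply/ler_addgt0Pl => e e0.
rewrite addr0.
pose G1 y := 'D_v (fun y => 'D_u f y) y.
pose G2 y := 'D_u (fun y => 'D_v f y) y.
have c1 : {for x, continuous G1}.
  by apply: differentiable_continuous; exact: (ck_diff (ck_deriv v (ck_deriv u cf)) Ax).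
have c2 : {for x, continuous G2}.
  by apply: differentiable_continuous; exact: (ck_diff (ck_deriv u (ck_deriv v cf)) Ax).
have near1 : \forall y \near x, [/\ A y, `|G1 x - G1 y| < e / 2 & `|G2 x - G2 y| < e / 2].
  have h0 : \forall y \near x, A y by apply: open_nbhs_nbhs.
  have e20 : 0 < e / 2 by rewrite divr_gt0.
  have h1 : \forall y \near x, `|G1 x - G1 y| < e / 2 by exact: cvgr_dist_lt c1 _ e20.
  have h2 : \forall y \near x, `|G2 x - G2 y| < e / 2 by exact: cvgr_dist_lt c2 _ e20.
  exact: filterS3 h0 h1 h2.
have [r /= r0 rP] := (nbhs_ballP _ _).1 near1.
(* The [1] keeps [N] positive when both directions vanish and makes the parallelogram of side
   [r / N] fit strictly inside the ball. *)
set N := `|u| + `|v| + 1; have N0 : 0 < N by rewrite ltr_wpDl // addr_ge0.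
pose d := r / N; have d0 : 0 < d by rewrite divr_gt0.
have dP a c : 0 <= a <= d -> 0 <= c <= d -> [/\ A (x + a *: u + c *: v),
    `|G1 x - G1 (x + a *: u + c *: v)| < e / 2 & `|G2 x - G2 (x + a *: u + c *: v)| < e / 2].
  move=> /andP[a0 ad] /andP[c0 cd]; apply: rP.
  rewrite -ball_normE /= -addrA opprD addrA subrr add0r normrN.
  apply: le_lt_trans (ler_normD _ _) _; rewrite !normrZ !ger0_norm //.
  apply: (@le_lt_trans _ _ (d * (`|u| + `|v|))).
    by rewrite mulrDr lerD // ler_wpM2r.
  by rewrite /d mulrAC ltr_pdivrMr // ltr_pM2l // /N ltrDl.
have [a [c [ad cd E1]]] := @second_difference x u v d d0 (ckS cf)
  (fun a c ad cd => let: And3 h _ _ := dP a c ad cd in h).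
have [a' [c' [ad' cd' E2]]] := @second_difference x v u d d0 (ckS cf)
  (fun a c ad cd => eq_ind _ A (let: And3 h _ _ := dP c a cd ad in h) _ (addrAC _ _ _)).
have [_ G1a _] := dP a c ad cd; have [_ _ G2a] := dP c' a' cd' ad'.
rewrite -/(G1 x) -/(G2 x).
move: E1 E2; rewrite -/(G1 _) -/(G2 _) (addrAC x (a' *: v)).
move: (G1 x) (G2 x) (G1 (x + a *: u + c *: v)) (G2 (x + c' *: u + a' *: v)) G1a G2a.
move=> g1 g2 g3 g4 G1a G2a E1 E2.
have dd0 : d * d != 0 by rewrite mulf_neq0 // gt_eqF.
have E : g3 = g4.
  by apply: (mulfI dd0); rewrite -E1 -E2 (addrAC x (d *: v)); ring.
have -> : g1 - g2 = (g1 - g3) - (g2 - g4) by rewrite E; ring.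
apply: le_trans (ler_normB _ _) _; rewrite [e]splitr; exact/ltW/ltrD.
Qed.

End Schwarz.

(** * Differential calculus of matrix-valued maps *)

Section MxCalculus.
Variables (R : realType) (V : normedModType R) (A : set V).
Hypothesis oA : open A.
Implicit Types f g : V -> R.

Definition sm (f : V -> R) := forall k, ck k A f.
(** Smoothness and derivative are taken entrywise, so that the rules for matrices reduce to those
    for real functions. *)
Definition smm p q (M : V -> 'M[R]_(p, q)) := forall i j, sm (fun y => M y i j).
Definition dmx p q (v : V) (M : V -> 'M[R]_(p, q)) (x : V) : 'M[R]_(p, q) :=
  \matrix_(i, j) 'D_v (fun y => M y i j) x.

Lemma sm_ext f g : (forall x, A x -> f x = g x) -> sm f -> sm g.
Proof. by move=> fg sf k; apply: ck_ext (sf k). Qed.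
Lemma sm_cst a : sm (fun=> a). Proof. by move=> k; exact: ck_cst. Qed.
Lemma smD f g : sm f -> sm g -> sm (fun x => f x + g x).
Proof. by move=> sf sg k; exact: ckD. Qed.
Lemma smN f : sm f -> sm (fun x => - f x).
Proof. by move=> sf k; exact: ckN. Qed.
Lemma smM f g : sm f -> sm g -> sm (fun x => f x * g x).
Proof. by move=> sf sg k; exact: ckM. Qed.
Lemma smV f : (forall x, A x -> f x != 0) -> sm f -> sm (fun x => (f x)^-1).
Proof. by move=> f0 sf k; exact: ckV. Qed.
Lemma sm_exp f : sm f -> sm (fun x => expR (f x)).
Proof. by move=> sf k; exact: ck_exp. Qed.
Lemma sm_sum (I : Type) (r : seq I) (P : pred I) (F : I -> V -> R) :
  (forall i, sm (F i)) -> sm (fun x => \sum_(i <- r | P i) F i x).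
Proof. by move=> sF k; apply: ck_sum => // i; exact: sF. Qed.
Lemma sm_prod (I : Type) (r : seq I) (P : pred I) (F : I -> V -> R) :
  (forall i, sm (F i)) -> sm (fun x => \prod_(i <- r | P i) F i x).
Proof. by move=> sF k; apply: ck_prod => // i; exact: sF. Qed.
Lemma sm_deriv v f : sm f -> sm (fun x => 'D_v f x).
Proof. by move=> sf k; apply: (ck_deriv v); exact: sf. Qed.
Lemma sm_diff f x : sm f -> A x -> differentiable f x.
Proof. by move=> sf; exact: (ck_diff (sf 0%N)). Qed.
Lemma sm_derivable f x v : sm f -> A x -> derivable f x v.
Proof. by move=> sf Ax; apply: diff_derivable; exact: sm_diff. Qed.

Lemma smm_ext p q (M N : V -> 'M[R]_(p, q)) : (forall x, A x -> M x = N x) -> smm M -> smm N.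
Proof. by move=> MN sM i j; apply: sm_ext (sM i j) => x Ax; rewrite MN. Qed.
Lemma smm_cst p q (M : 'M[R]_(p, q)) : smm (fun=> M).
Proof. by move=> i j; exact: sm_cst. Qed.
Lemma smmD p q (M N : V -> 'M[R]_(p, q)) : smm M -> smm N -> smm (fun x => M x + N x).
Proof.
by move=> sM sN i j; apply: sm_ext (smD (sM i j) (sN i j)) => x _; rewrite mxE.
Qed.
Lemma smmN p q (M : V -> 'M[R]_(p, q)) : smm M -> smm (fun x => - M x).
Proof. by move=> sM i j; apply: sm_ext (smN (sM i j)) => x _; rewrite mxE. Qed.
Lemma smmB p q (M N : V -> 'M[R]_(p, q)) : smm M -> smm N -> smm (fun x => M x - N x).
Proof. by move=> sM sN; apply: smmD => //; exact: smmN. Qed.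
Lemma smmZ p q f (M : V -> 'M[R]_(p, q)) : sm f -> smm M -> smm (fun x => f x *: M x).
Proof. by move=> sf sM i j; apply: sm_ext (smM sf (sM i j)) => x _; rewrite mxE. Qed.
Lemma smmM p q r (M : V -> 'M[R]_(p, q)) (N : V -> 'M[R]_(q, r)) :
  smm M -> smm N -> smm (fun x => M x *m N x).
Proof.
move=> sM sN i j; have : sm (fun x => \sum_k M x i k * N x k j).
  by apply: sm_sum => k; exact: smM.
by apply: sm_ext => x _; rewrite mxE.
Qed.
Lemma smm_tr p q (M : V -> 'M[R]_(p, q)) : smm M -> smm (fun x => (M x)^T).
Proof. by move=> sM i j; apply: sm_ext (sM j i) => x _; rewrite mxE. Qed.
Lemma smm_dmx p q v (M : V -> 'M[R]_(p, q)) : smm M -> smm (dmx v M).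
Proof. by move=> sM i j; apply: sm_ext (sm_deriv v (sM i j)) => x _; rewrite mxE. Qed.
Lemma smm_det p (M : V -> 'M[R]_p) : smm M -> sm (fun x => \det (M x)).
Proof.
move=> sM; apply: sm_sum => s; apply: smM; first exact: sm_cst.
by apply: sm_prod => i.
Qed.
Lemma smm_inv p (M : V -> 'M[R]_p) : (forall x, A x -> M x \in unitmx) -> smm M ->
  smm (fun x => invmx (M x)).
Proof.
move=> uM sM.
have sadj : smm (fun x => \adj (M x)).
  move=> i j; have : sm (fun x => cofactor (M x) j i); last first.
    by apply: sm_ext => x _; rewrite !mxE.
  apply: smM; first exact: sm_cst.
  by apply: smm_det => a b; apply: sm_ext (sM (lift j a) (lift i b)) => x _; rewrite !mxE.
have sdet : sm (fun x => (\det (M x))^-1).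
  apply: smV; last exact: smm_det.
  by move=> x Ax; rewrite -unitfE -unitmxE uM.
by apply: smm_ext (smmZ sdet sadj) => x Ax; rewrite /invmx uM.
Qed.

Lemma smm_lin p q p' q' (F : 'M[R]_(p, q) -> 'M[R]_(p', q')) (M : V -> 'M[R]_(p, q)) :
  linear F -> smm M -> smm (fun x => F (M x)).
Proof.
move=> Flin sM; pose FL : {linear 'M[R]_(p, q) -> 'M[R]_(p', q')} :=
  HB.pack F (GRing.isLinear.Build R _ _ *:%R F Flin).
move=> i j; have : sm (fun x => \sum_a \sum_b M x a b * FL (delta_mx a b) i j).
  by apply: sm_sum => a; apply: sm_sum => b; apply: smM => //; exact: sm_cst.
apply: sm_ext => x _; rewrite -[F _]/(FL (M x)) {2}[M x]matrix_sum_delta.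
rewrite linear_sum summxE; apply: eq_bigr => a _.
by rewrite linear_sum summxE; apply: eq_bigr => b _; rewrite linearZ mxE.
Qed.

Section At.
Variables (x : V) (v : V).
Hypothesis Ax : A x.

Lemma deriv_sm_ext f g : (forall y, A y -> f y = g y) -> 'D_v f x = 'D_v g x.
Proof.
move=> fg; apply: near_eq_derive; near=> y; apply: fg; near: y.
exact: open_nbhs_nbhs.
Unshelve. all: by end_near. Qed.

Lemma dmx_ext p q (M N : V -> 'M[R]_(p, q)) : (forall y, A y -> M y = N y) ->
  dmx v M x = dmx v N x.
Proof.
by move=> MN; apply/matrixP => i j; rewrite !mxE; apply: deriv_sm_ext => y Ay; rewrite MN.
Qed.

Lemma dmx_cst p q (M : 'M[R]_(p, q)) : dmx v (fun=> M) x = 0.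
Proof. by apply/matrixP => i j; rewrite !mxE derive_cst. Qed.

Lemma smderivD f g : sm f -> sm g -> 'D_v (fun y => f y + g y) x = 'D_v f x + 'D_v g x.
Proof. by move=> sf sg; rewrite -deriveD //; exact: sm_derivable. Qed.
Lemma smderivN f : sm f -> 'D_v (fun y => - f y) x = - 'D_v f x.
Proof. by move=> sf; rewrite -deriveN //; exact: sm_derivable. Qed.
Lemma smderivM f g : sm f -> sm g ->
  'D_v (fun y => f y * g y) x = 'D_v f x * g x + f x * 'D_v g x.
Proof.
move=> sf sg; rewrite [LHS]deriveM; [|exact: sm_derivable..].
by rewrite /GRing.scale /= addrC [g x * _]mulrC.
Qed.
Lemma smderiv_exp f : sm f -> 'D_v (fun y => expR (f y)) x = 'D_v f x * expR (f x).
Proof. by move=> sf; apply: derive_expR_comp; exact: sm_diff. Qed.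
Lemma smderiv_sum (I : Type) (r : seq I) (F : I -> V -> R) :
  (forall i, sm (F i)) ->
  'D_v (fun y => \sum_(i <- r) F i y) x = \sum_(i <- r) 'D_v (F i) x.
Proof.
move=> sF; elim: r => [|i r IH].
  rewrite big_nil -[RHS](derive_cst (0 : R) x v); apply: deriv_sm_ext => y _.
  by rewrite big_nil.
rewrite big_cons -IH -smderivD //; last exact: sm_sum.
by apply: deriv_sm_ext => y _; rewrite big_cons.
Qed.

Lemma dmxD p q (M N : V -> 'M[R]_(p, q)) : smm M -> smm N ->
  dmx v (fun y => M y + N y) x = dmx v M x + dmx v N x.
Proof.
move=> sM sN; apply/matrixP => i j; rewrite !mxE -smderivD //.
by apply: deriv_sm_ext => y _; rewrite mxE.
Qed.
Lemma dmxN p q (M : V -> 'M[R]_(p, q)) : smm M -> dmx v (fun y => - M y) x = - dmx v M x.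
Proof.
move=> sM; apply/matrixP => i j; rewrite !mxE -smderivN //.
by apply: deriv_sm_ext => y _; rewrite mxE.
Qed.
Lemma dmxB p q (M N : V -> 'M[R]_(p, q)) : smm M -> smm N ->
  dmx v (fun y => M y - N y) x = dmx v M x - dmx v N x.
Proof. by move=> sM sN; rewrite -dmxN // -dmxD //; exact: smmN. Qed.
Lemma dmxZ p q f (M : V -> 'M[R]_(p, q)) : sm f -> smm M ->
  dmx v (fun y => f y *: M y) x = 'D_v f x *: M x + f x *: dmx v M x.
Proof.
move=> sf sM; apply/matrixP => i j; rewrite !mxE -smderivM //.
by apply: deriv_sm_ext => y _; rewrite mxE.
Qed.
Lemma dmxM p q r (M : V -> 'M[R]_(p, q)) (N : V -> 'M[R]_(q, r)) : smm M -> smm N ->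
  dmx v (fun y => M y *m N y) x = dmx v M x *m N x + M x *m dmx v N x.
Proof.
move=> sM sN; apply/matrixP => i j; rewrite !mxE -big_split /=.
transitivity (\sum_k 'D_v (fun y => M y i k * N y k j) x).
  rewrite -smderiv_sum; first by apply: deriv_sm_ext => y _; rewrite mxE.
  by move=> k; exact: smM.
by apply: eq_bigr => k _; rewrite smderivM // !mxE.
Qed.
Lemma dmx_tr p q (M : V -> 'M[R]_(p, q)) : dmx v (fun y => (M y)^T) x = (dmx v M x)^T.
Proof. by apply/matrixP => i j; rewrite !mxE; apply: deriv_sm_ext => y _; rewrite mxE. Qed.
Lemma dmx_lin p q p' q' (F : 'M[R]_(p, q) -> 'M[R]_(p', q')) (M : V -> 'M[R]_(p, q)) :
  linear F -> smm M -> dmx v (fun y => F (M y)) x = F (dmx v M x).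
Proof.
move=> Flin sM; pose FL : {linear 'M[R]_(p, q) -> 'M[R]_(p', q')} :=
  HB.pack F (GRing.isLinear.Build R _ _ *:%R F Flin).
have FE (N : 'M[R]_(p, q)) i j : F N i j = \sum_a \sum_b N a b * FL (delta_mx a b) i j.
  rewrite -[F _]/(FL N) {1}[N]matrix_sum_delta linear_sum summxE.
  apply: eq_bigr => a _; rewrite linear_sum summxE.
  by apply: eq_bigr => b _; rewrite linearZ mxE.
apply/matrixP => i j; rewrite FE mxE.
transitivity ('D_v (fun y => \sum_a \sum_b M y a b * FL (delta_mx a b) i j) x).
  by apply: deriv_sm_ext => y _; rewrite FE.
rewrite smderiv_sum => [|a]; last first.
  by apply: sm_sum => b; apply: smM => //; exact: sm_cst.
apply: eq_bigr => a _; rewrite smderiv_sum => [|b]; last first.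
  by apply: smM => //; exact: sm_cst.
apply: eq_bigr => b _; rewrite smderivM //; last exact: sm_cst.
by rewrite derive_cst mulr0 addr0 mxE.
Qed.
Lemma dmx_mulr p q r (M : V -> 'M[R]_(p, q)) (N : 'M[R]_(q, r)) : smm M ->
  dmx v (fun y => M y *m N) x = dmx v M x *m N.
Proof. by move=> sM; rewrite dmxM ?dmx_cst ?mulmx0 ?addr0 //; exact: smm_cst. Qed.
Lemma dmx_mull p q r (M : 'M[R]_(p, q)) (N : V -> 'M[R]_(q, r)) : smm N ->
  dmx v (fun y => M *m N y) x = M *m dmx v N x.
Proof. by move=> sM; rewrite dmxM ?dmx_cst ?mul0mx ?add0r //; exact: smm_cst. Qed.
End At.

Lemma smderiv_symm f x u v : sm f -> A x ->
  'D_v (fun y => 'D_u f y) x = 'D_u (fun y => 'D_v f y) x.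
Proof. by move=> sf Ax; apply: derive_symm (sf 3%N) Ax. Qed.

Lemma dmx_symm p q (M : V -> 'M[R]_(p, q)) x u v : smm M -> A x ->
  dmx v (dmx u M) x = dmx u (dmx v M) x.
Proof.
move=> sM Ax; apply/matrixP => i j; rewrite [LHS]mxE [RHS]mxE.
transitivity ('D_v (fun y => 'D_u (fun z => M z i j) y) x).
  by apply: deriv_sm_ext => // y _; rewrite mxE.
rewrite smderiv_symm //.
by apply: deriv_sm_ext => // y _; rewrite mxE.
Qed.

End MxCalculus.

Section Directional.
Variables (R : realType) (n : nat) (A : set 'rV[R]_n).
Hypothesis oA : open A.
Local Notation vec := 'rV[R]_n.

Lemma smderiv_lin (f : vec -> R) x : sm A f -> A x -> scalar (fun v => 'D_v f x).
Proof.
move=> sf Ax a u v; have df := sm_diff sf Ax.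
by rewrite !deriveE // linearP.
Qed.

Lemma dmx_dir_lin p q (M : vec -> 'M[R]_(p, q)) x : smm A M -> A x ->
  linear (fun v => dmx v M x).
Proof.
move=> sM Ax a u v; apply/matrixP => i j; rewrite !mxE.
exact: (smderiv_lin (sM i j) Ax).
Qed.

End Directional.

(** * Curvature of conformally changed bi-invariant metrics *)

(* With [Gj = (cov j) V^-1] the Christoffel matrices, the Riemann tensor is the curvature of
   the forms [oj] conjugated by [V]; [P] is the common second derivative of [V]. *)
Lemma gauge_curvature (R : comNzRingType) n (Gj Gk V oj ok P Okj Ojk : 'M[R]_n) :
  P + (Gk *m V - V *m ok) *m oj + V *m Okj - Gj *m (Gk *m V - V *m ok)
  - (P + (Gj *m V - V *m oj) *m ok + V *m Ojk - Gk *m (Gj *m V - V *m oj))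
  + Gj *m Gk *m V - Gk *m Gj *m V = V *m (Okj - Ojk + oj *m ok - ok *m oj).
Proof.
have addE (M N : 'M[R]_n) a c : (M + N) a c = M a c + N a c by rewrite mxE.
have oppE (M : 'M[R]_n) a c : (- M) a c = - M a c by rewrite mxE.
rewrite !(mulmxDl, mulmxDr, mulmxN, mulNmx) !mulmxA.
by apply/matrixP => a c; rewrite !(addE, oppE); ring.
Qed.

(** * Ricci curvature in a moving coframe *)

Section Frame.
Variables (R : realType) (n : nat) (A : set 'rV[R]_n).
Hypothesis oA : open A.
Local Notation vec := 'rV[R]_n.
Local Notation E i := (delta_mx 0 i : vec).
Variables (vt Lt g : vec -> 'M[R]_n) (om : 'I_n -> vec -> 'M[R]_n) (Bm : 'M[R]_n).
Hypotheses (svt : smm A vt) (sLt : smm A Lt) (som : forall i, smm A (om i)).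
Hypothesis Ltvt : forall x, A x -> Lt x *m vt x = 1%:M.
Hypotheses (Bsym : Bm^T = Bm) (Bu : Bm \in unitmx).
Hypothesis skew : forall i x, A x -> om i x *m Bm = - (Bm *m (om i x)^T).
Hypothesis gE : forall x, A x -> g x = vt x *m Bm *m (vt x)^T.

(** Row [j] holds the frame components of the covariant derivative of the coordinate field [j] along
    the coordinate field [i], for the connection forms [om]. Hence [torsion] is its symmetry in [i]
    and [j]. *)
Definition cov i x := dmx (E i) vt x + vt x *m om i x.
Hypothesis torsion : forall i j x, A x -> row j (cov i x) = row i (cov j x).

Let vtLt x : A x -> vt x *m Lt x = 1%:M.
Proof. by move=> Ax; apply: mulmx1C; exact: Ltvt. Qed.

Lemma frame_gram_inv x : A x -> invmx (g x) = (Lt x)^T *m invmx Bm *m Lt x.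
Proof.
move=> Ax; have u : g x *m ((Lt x)^T *m invmx Bm *m Lt x) = 1%:M.
  rewrite gE // !mulmxA -(mulmxA (vt x *m Bm)) -trmx_mul Ltvt // trmx1 mulmx1.
  by rewrite mulmxK // vtLt.
have gu : g x \in unitmx by have [] := mulmx1_unit u.
by rewrite -[LHS]mulmx1 -u mulKmx.
Qed.

Lemma frame_gram_deriv i j l x : A x -> partial i (fun y => g y j l) x =
  (cov i x *m Bm *m (vt x)^T) j l + (cov i x *m Bm *m (vt x)^T) l j.
Proof.
move=> Ax; have -> : partial i (fun y => g y j l) x = dmx (E i) g x j l by rewrite mxE.
have sb : smm A (fun y => vt y *m Bm) by apply: smmM => //; exact: smm_cst.
rewrite (dmx_ext oA _ Ax gE) (dmxM oA _ Ax sb); last exact: smm_tr.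
rewrite (dmx_mulr oA _ Ax _ svt) (dmx_tr oA _ Ax).
have trE (M : 'M[R]_n) : M l j = M^T j l by rewrite mxE.
have addE (M N : 'M[R]_n) : M j l + N j l = (M + N) j l by rewrite mxE.
rewrite [X in _ = _ + X]trE !trmx_mul trmxK Bsym addE.
congr (fun M : 'M[R]_n => M j l); rewrite /cov linearD /= !(mulmxDl, mulmxDr) trmx_mul.
rewrite -(mulmxA (vt x) (om i x)) skew // mulmxN mulNmx !mulmxA.
by rewrite [RHS]addrACA addNr addr0.
Qed.

(** Uniqueness of the Levi-Civita connection: by metric compatibility and symmetry of [S] in its
    first two indices, the three derivatives of the Gram matrix add up to [2 * S i j l]. *)
Lemma frame_christoffel i j k x : A x -> christoffel g k i j x = (cov i x *m Lt x) j k.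
Proof.
move=> Ax; pose S i j l := (cov i x *m Bm *m (vt x)^T) j l.
have Ssym i' j' l : S i' j' l = S j' i' l.
  have e a c : S a c l = (row c (cov a x) *m Bm *m (vt x)^T) 0 l.
    by rewrite -!row_mul mxE.
  by rewrite !e torsion.
have symI : (invmx (g x))^T = invmx (g x).
  by rewrite frame_gram_inv // !trmx_mul trmxK trmx_inv Bsym mulmxA.
rewrite /christoffel; under eq_bigr => l _.
  rewrite !frame_gram_deriv // -!/(S _ _ _).
  rewrite (_ : S i j l + S i l j + (S j i l + S j l i) - (S l i j + S l j i)
    = 2 * S i j l); last first.
    by rewrite (Ssym i l j) (Ssym j l i) (Ssym j i l); ring.
  over.
rewrite (eq_bigr (fun l => 2 * (S i j l * invmx (g x) l k))); last first.
  move=> l _; have -> : invmx (g x) l k = invmx (g x) k l.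
    by rewrite -[in LHS]symI mxE.
  by ring.
rewrite -mulr_sumr mulrA mulVf ?pnatr_eq0 // mul1r.
transitivity ((cov i x *m Bm *m (vt x)^T *m invmx (g x)) j k); first by rewrite [RHS]mxE.
rewrite frame_gram_inv // !mulmxA -(mulmxA _ (vt x)^T) -trmx_mul Ltvt // trmx1 mulmx1.
by rewrite mulmxK.
Qed.

(** The curvature form in the directions [k], [j]; the connection forms act on row vectors, which
    reverses the products. *)
Definition curv k j x := dmx (E k) (om j) x - dmx (E j) (om k) x
  + om j x *m om k x - om k x *m om j x.

(** The Christoffel matrices [G k] are the forms [om k] after the gauge change by [vt], so their
    curvature is [curv] conjugated by [vt]; its contraction is the coordinate formula of [ricci]. *)
Lemma frame_ricci i j x : A x ->
  ricci g x i j = \sum_k (vt x *m curv k j x *m Lt x) i k.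
Proof.
move=> Ax; pose G k y := cov k y *m Lt y.
have scov k : smm A (cov k) by apply: smmD => //; [exact: (smm_dmx oA)|exact: smmM].
have sG k : smm A (G k) by exact: smmM.
have Gvt k y : A y -> G k y *m vt y = cov k y.
  by move=> Ay; rewrite /G -mulmxA Ltvt // mulmx1.
have flat k : dmx (E k) (G j) x - dmx (E j) (G k) x + G j x *m G k x - G k x *m G j x
    = vt x *m curv k j x *m Lt x.
  have d a c : dmx (E a) (G c) x *m vt x = dmx (E a) (dmx (E c) vt) x
      + dmx (E a) vt x *m om c x + vt x *m dmx (E a) (om c) x - G c x *m dmx (E a) vt x.
    apply/eqP; rewrite eq_sym subr_eq -(dmxM oA _ Ax (sG c) svt) eq_sym; apply/eqP.
    rewrite (dmx_ext oA _ Ax (Gvt c)) (dmxD oA _ Ax); [|exact: (smm_dmx oA)|exact: smmM].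
    by rewrite (dmxM oA _ Ax svt (som c)) addrA.
  have dvt a : dmx (E a) vt x = G a x *m vt x - vt x *m om a x.
    by rewrite Gvt // /cov addrK.
  rewrite -[LHS]mulmx1 -(vtLt Ax) mulmxA; congr (_ *m _).
  have := d k j; have := d j k; rewrite (dmx_symm oA (E j) (E k) svt Ax) !dvt /curv.
  move=> djk dkj; rewrite mulmxBl mulmxDl mulmxBl djk dkj.
  exact: gauge_curvature.
rewrite mxE -big_split /=; apply: eq_bigr => k _.
have chr a c m y : A y -> christoffel g m a c y = G c y a m.
  move=> Ay; rewrite frame_christoffel //.
  have e a' c' : (cov a' y *m Lt y) c' m = (row c' (cov a' y) *m Lt y) 0 m.
    by rewrite -row_mul [RHS]mxE.
  by rewrite e torsion // -e.
have par a c m p : partial p (christoffel g m a c) x = dmx (E p) (G c) x a m.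
  by rewrite [RHS]mxE; apply: (deriv_sm_ext oA _ Ax) => y Ay; exact: chr.
have addE (M N : 'M[R]_n) a c : (M + N) a c = M a c + N a c by rewrite mxE.
have oppE (M : 'M[R]_n) a c : (- M) a c = - M a c by rewrite mxE.
have mulE (M N : 'M[R]_n) a c : (M *m N) a c = \sum_l M a l * N l c by rewrite mxE.
rewrite !par -flat !(addE, oppE) !mulE sumrB addrA.
congr (_ + _ - _); apply: eq_bigr => l _; rewrite mulrC; congr (_ * _).
- exact: chr.
- exact: frame_christoffel.
- exact: chr.
- exact: frame_christoffel.
Qed.

End Frame.

(** * Invariant forms and conformal changes of bi-invariant metrics *)

Section BracketForm.
Variables (R : realType) (n : nat).
Local Notation vec := 'rV[R]_n.
Variables (br : vec -> vec -> vec) (Bm : 'M[R]_n).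
Hypotheses (br_linr : forall x, linear (br x)) (br_linl : forall y, linear (br^~ y)).
Hypothesis br_alt : forall x, br x x = 0.
Hypothesis br_leibniz : forall x y z, br x (br y z) = br (br x y) z + br y (br x z).
Hypotheses (Bsym : Bm^T = Bm) (Bu : Bm \in unitmx).

Definition bf (u v : vec) : R := (u *m Bm *m v^T) 0 0.
(* Stops [ring] and [lra] from comparing the arguments of [bf] up to conversion. *)
Ltac gen_bf := repeat match goal with |- context [bf ?u ?v] => move: (bf u v) => ? end.
Hypothesis bf_inv : forall z x y, bf (br z x) y + bf x (br z y) = 0.

Lemma bfDl u v w : bf (u + v) w = bf u w + bf v w.
Proof. by rewrite /bf !mulmxDl mxE. Qed.
Lemma bfDr u v w : bf u (v + w) = bf u v + bf u w.
Proof. by rewrite /bf linearD /= mulmxDr mxE. Qed.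
Lemma bfZl a u w : bf (a *: u) w = a * bf u w.
Proof. by rewrite /bf -!scalemxAl mxE. Qed.
Lemma bfZr a u w : bf u (a *: w) = a * bf u w.
Proof. by rewrite /bf linearZ /= -scalemxAr mxE. Qed.
Lemma bfNl u w : bf (- u) w = - bf u w.
Proof. by rewrite -scaleN1r bfZl mulN1r. Qed.
Lemma bfNr u w : bf u (- w) = - bf u w.
Proof. by rewrite -scaleN1r bfZr mulN1r. Qed.
Lemma bf0l w : bf 0 w = 0.
Proof. by rewrite /bf !mul0mx mxE. Qed.
Lemma bf_sym u v : bf u v = bf v u.
Proof.
rewrite /bf; have -> : (u *m Bm *m v^T) = (v *m Bm *m u^T)^T; last by rewrite mxE.
by rewrite !trmx_mul trmxK Bsym mulmxA.
Qed.
Lemma bf_sumr (K : finType) u (f : K -> vec) : bf u (\sum_i f i) = \sum_i bf u (f i).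
Proof. by rewrite /bf linear_sum /= mulmx_sumr summxE. Qed.
Lemma bf_mx_ext (M N : 'M[R]_n) :
  (forall u v : vec, (u *m M *m v^T) 0 0 = (u *m N *m v^T) 0 0) -> M = N.
Proof.
move=> e; apply/matrixP => i j; have := e (delta_mx 0 i) (delta_mx 0 j).
by rewrite -!rowE trmx_delta -!colE !mxE.
Qed.
Lemma bf_ext u v : (forall z, bf u z = bf v z) -> u = v.
Proof.
move=> e; suff : u *m Bm = v *m Bm by move/(congr1 (mulmx^~ (invmx Bm))); rewrite !mulmxK.
by apply/rowP => j; have := e (delta_mx 0 j); rewrite /bf trmx_delta -!colE !mxE.
Qed.

Lemma brDl x y z : br (x + y) z = br x z + br y z.
Proof. by have := br_linl z 1 x y; rewrite !scale1r. Qed.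
Lemma brDr x y z : br x (y + z) = br x y + br x z.
Proof. by have := br_linr x 1 y z; rewrite !scale1r. Qed.
Lemma br0l x : br 0 x = 0.
Proof. by apply: (addrI (br 0 x)); rewrite -brDl !addr0. Qed.
Lemma br0r x : br x 0 = 0.
Proof. by apply: (addrI (br x 0)); rewrite -brDr !addr0. Qed.
Lemma brZl a x y : br (a *: x) y = a *: br x y.
Proof. by have := br_linl y a x 0; rewrite !addr0 br0l addr0. Qed.
Lemma brZr a x y : br x (a *: y) = a *: br x y.
Proof. by have := br_linr x a y 0; rewrite !addr0 br0r addr0. Qed.
Lemma brNl x y : br (- x) y = - br x y.
Proof. by rewrite -scaleN1r brZl scaleN1r. Qed.
Lemma brNr x y : br x (- y) = - br x y.
Proof. by rewrite -scaleN1r brZr scaleN1r. Qed.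
Lemma brC x y : br x y = - br y x.
Proof.
apply/eqP; rewrite -addr_eq0; apply/eqP.
by have := br_alt (x + y); rewrite brDl !brDr !br_alt addr0 add0r.
Qed.
Lemma bf_br x y z : bf (br x y) z = - bf y (br x z).
Proof. by have := bf_inv x y z; lra. Qed.

Definition brE := (brDl, brDr, brZl, brZr, brNl, brNr).
Definition bfE := (bfDl, bfDr, bfZl, bfZr, bfNl, bfNr).

Definition adm (u : vec) : 'M[R]_n := lin1_mx (br u).
Lemma mul_adm u v : v *m adm u = br u v.
Proof.
pose F : {linear vec -> vec} := HB.pack (br u)
  (GRing.isLinear.Build R _ _ *:%R (br u) (br_linr u)).
exact: (mul_rV_lin1 F v).
Qed.

(** Half the bracket is the connection of the bi-invariant metric, the rest its conformal change.
    The usual further term [bf X Phi *: u] is absorbed by the factor [e^phi] of the coframe. *)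
Definition lc_conf (Phi X u : vec) : vec :=
  2^-1 *: br X u + bf u Phi *: X - bf u X *: Phi.

(** The Hessian of [phi] minus the square of its differential: [DX + 2^-1 *: br X Phi] is the
    covariant derivative of the gradient [Phi]. *)
Definition conf_hess (Phi X DX : vec) : vec := DX + 2^-1 *: br X Phi - bf Phi X *: Phi.

(** Conformal transformation of the curvature, in which [- 4^-1] times the double bracket is the
    bi-invariant part. Here [a], [c] stand for the derivatives of the coframe, tied by
    Maurer-Cartan, and [Fk], [Fj] for those of [Phi]. *)
Lemma curvature_algebra (Phi X Y Fk Fj a c w : vec) : a = c - br X Y ->
  (2^-1 *: br a w + (bf w Fk *: Y + bf w Phi *: a) - (bf w a *: Phi + bf w Y *: Fk))
  - (2^-1 *: br c w + (bf w Fj *: X + bf w Phi *: c) - (bf w c *: Phi + bf w X *: Fj))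
  + lc_conf Phi X (lc_conf Phi Y w) - lc_conf Phi Y (lc_conf Phi X w)
  = (- 4^-1) *: br (br X Y) w
  + (bf (conf_hess Phi X Fk) w + bf Phi Phi * bf X w) *: Y
  - (bf (conf_hess Phi Y Fj) w + bf Phi Phi * bf Y w) *: X
  - bf Y w *: conf_hess Phi X Fk + bf X w *: conf_hess Phi Y Fj.
Proof.
move=> ->; apply: bf_ext => z.
have jac : bf (br X (br Y w)) z = bf (br (br X Y) w) z + bf (br Y (br X w)) z.
  by rewrite br_leibniz bfDl.
rewrite /lc_conf /conf_hess !(brE, bfE).
rewrite !jac.
rewrite !(bf_sym _ w) (bf_br Y w Phi) (bf_br X w Phi) (bf_br Y w X) (bf_br X w Y).
rewrite (brC Y X) !(bfNl, bfNr) (bf_sym Y X) (bf_sym Y Phi) (bf_sym X Phi).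
by gen_bf; field.
Qed.

Lemma mul_outer (w u v : vec) : w *m (Bm *m u^T *m v) = bf w u *: v.
Proof. by rewrite !mulmxA [_ *m u^T]mx11_scalar mul_scalar_mx. Qed.

(** * The Einstein equation of a conformally bi-invariant metric *)

Section Conformal.
Variables (A : set vec) (Th Lm g : vec -> 'M[R]_n) (phi : vec -> R).
Hypotheses (oA : open A) (sTh : smm A Th) (sLm : smm A Lm) (sphi : sm A phi).
Hypothesis LmTh : forall x, A x -> Lm x *m Th x = 1%:M.
Hypothesis maurer_cartan_eq : forall x a c, A x ->
  dmx a (fun y => c *m Th y) x - dmx c (fun y => a *m Th y) x
  = - br (a *m Th x) (c *m Th x).
Hypothesis gE : forall x, A x -> g x = expR (2 * phi x) *: (Th x *m Bm *m (Th x)^T).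
Local Notation E i := (delta_mx 0 i : vec).

Let ThLm x : A x -> Th x *m Lm x = 1%:M.
Proof. by move=> Ax; apply: mulmx1C; exact: LmTh. Qed.

Definition th (a : vec) (x : vec) : vec := a *m Th x.

Lemma sth a : smm A (th a).
Proof. by apply: (smmM oA) => //; exact: smm_cst. Qed.

(** [Lm] turns the coordinate differential into frame components and [invmx Bm] raises the index;
    [bf_grad] is the characterisation. *)
Definition grad (f : vec -> R) (x : vec) : vec :=
  (\row_j 'D_(E j) f x) *m (Lm x)^T *m invmx Bm.

Lemma sm_bf w (G : vec -> vec) : smm A G -> sm A (fun y => bf w (G y)).
Proof. by move=> sG; apply: (smmM oA); [exact: smm_cst|exact: (smm_tr oA)]. Qed.

Lemma deriv_bf w (G : vec -> vec) x v : smm A G -> A x ->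
  'D_v (fun y => bf w (G y)) x = bf w (dmx v G x).
Proof.
move=> sG Ax; rewrite /bf -(dmx_tr oA _ Ax) -(dmx_mull oA _ Ax); first by rewrite mxE.
exact: (smm_tr oA).
Qed.

Lemma smm_grad f : sm A f -> smm A (grad f).
Proof.
move=> sf; apply: (smmM oA); last exact: smm_cst.
apply: (smmM oA); last exact: (smm_tr oA).
by move=> i j; apply: (sm_ext oA) (sm_deriv (E j) sf) => x _; rewrite mxE.
Qed.

Lemma bf_grad f x a : sm A f -> A x -> bf (grad f x) (th a x) = 'D_a f x.
Proof.
move=> sf Ax; rewrite /bf /grad /th trmx_mul mulmxA mulmxKV // -(mulmxA _ _ (Th x)^T).
rewrite -trmx_mul ThLm // trmx1 mulmx1 mxE.
rewrite [in RHS](row_sum_delta a).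
pose D : {scalar vec} := HB.pack (fun v : vec => 'D_v f x)
  (GRing.isLinear.Build R vec R *%R _ (smderiv_lin sf Ax)).
rewrite -[RHS]/(D _) linear_sum; apply: eq_bigr => j _.
by rewrite linearZ !mxE mulrC.
Qed.

Local Notation Phi := (grad phi).
Let vt x := expR (phi x) *: Th x.
Let Lt x := expR (- phi x) *: Lm x.
(* Levi-Civita connection of [g] in the coframe [vt]: see [torsion] and [skew]. *)
Let om i x := 2^-1 *: adm (th (E i) x) + Bm *m (Phi x)^T *m th (E i) x
  - Bm *m (th (E i) x)^T *m Phi x.

Let sPhi : smm A Phi. Proof. exact: smm_grad. Qed.

Lemma adm_lin : linear adm.
Proof.
move=> a u v; apply/row_matrixP => i.
by rewrite !rowE mulmxDr -scalemxAr !mul_adm brDl brZl.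
Qed.

Let svt : smm A vt. Proof. by apply: (smmZ oA) => //; exact: (sm_exp oA). Qed.
Let sLt : smm A Lt.
Proof. by apply: (smmZ oA) => //; apply/(sm_exp oA)/(smN oA). Qed.
Let som i : smm A (om i).
Proof.
have sB : smm A (fun=> Bm : 'M[R]_n) by exact: smm_cst.
apply: (smmB oA); last first.
  by apply: (smmM oA) => //; apply: (smmM oA) => //; exact/(smm_tr oA)/sth.
apply: (smmD oA).
  apply: (smmZ oA); first exact: sm_cst.
  exact: (smm_lin oA adm_lin (sth _)).
apply: (smmM oA); last exact: sth.
by apply: (smmM oA) => //; exact: (smm_tr oA).
Qed.

Let mul_om i x w : w *m om i x = lc_conf (Phi x) (th (E i) x) w.
Proof.
by rewrite /om /lc_conf mulmxBr mulmxDr -scalemxAr mul_adm !mul_outer.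
Qed.

Let Ltvt x : A x -> Lt x *m vt x = 1%:M.
Proof.
move=> Ax; rewrite /Lt /vt -scalemxAl -scalemxAr scalerA -expRD addNr expR0 scale1r.
exact: LmTh.
Qed.

Let skew i x : A x -> om i x *m Bm = - (Bm *m (om i x)^T).
Proof.
move=> Ax; apply: bf_mx_ext => u v.
have -> : u *m (om i x *m Bm) *m v^T = (u *m om i x) *m Bm *m v^T by rewrite !mulmxA.
have -> : u *m - (Bm *m (om i x)^T) *m v^T = - (u *m Bm *m (v *m om i x)^T).
  by rewrite mulmxN mulNmx trmx_mul !mulmxA.
rewrite [RHS]mxE !mul_om -/(bf _ _) -/(bf _ _) /lc_conf !bfE bf_br.
by rewrite (bf_sym (th (E i) x) v) (bf_sym (Phi x) v); gen_bf; ring.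
Qed.

Let vtE x : A x -> g x = vt x *m Bm *m (vt x)^T.
Proof.
move=> Ax; rewrite gE // /vt linearZ /= -!scalemxAl -scalemxAr scalerA -expRD.
by congr (expR _ *: _); ring.
Qed.

(** The [Phi] terms are symmetric in [i] and [j]. The antisymmetric part is the exterior derivative
    of the coframe plus the bracket, which vanishes by Maurer-Cartan. *)
Let torsion i j x : A x -> row j (cov vt om i x) = row i (cov vt om j x).
Proof.
move=> Ax.
have e a c : row c (cov vt om a x) = expR (phi x) *: (bf (Phi x) (th (E a) x) *: th (E c) x
   + dmx (E a) (th (E c)) x + lc_conf (Phi x) (th (E a) x) (th (E c) x)).
  rewrite rowE /cov mulmxDr -(dmx_mull oA _ Ax _ svt) mulmxA.
  have -> : E c *m vt x = expR (phi x) *: th (E c) x by rewrite -scalemxAr.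
  rewrite -scalemxAl mul_om [RHS]scalerDr; congr (_ + _).
  rewrite (dmx_ext oA _ Ax (N := fun y => expR (phi y) *: th (E c) y)); last first.
    by move=> y _; rewrite -scalemxAr.
  rewrite (dmxZ oA _ Ax); [|exact: (sm_exp oA)|exact: sth].
  rewrite (smderiv_exp _ Ax sphi) scalerDr scalerA bf_grad //.
  by rewrite [_ * expR _]mulrC.
rewrite !e; congr (_ *: _).
have -> : dmx (E i) (th (E j)) x = dmx (E j) (th (E i)) x - br (th (E i) x) (th (E j) x).
  by rewrite -(maurer_cartan_eq (E i) (E j) Ax) addrC subrK.
rewrite /lc_conf; apply: bf_ext => z; rewrite (brC (th (E j) x)) !bfE.
rewrite (bf_sym (th (E j) x) (th (E i) x)) !(bf_sym _ (Phi x)); gen_bf; lra.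
Qed.

Definition hess j x := conf_hess (Phi x) (th (E j) x) (dmx (E j) Phi x).

Let curvE k j x w : A x -> w *m curv om k j x =
  (- 4^-1) *: br (br (th (E k) x) (th (E j) x)) w
  + (bf (hess k x) w + bf (Phi x) (Phi x) * bf (th (E k) x) w) *: th (E j) x
  - (bf (hess j x) w + bf (Phi x) (Phi x) * bf (th (E j) x) w) *: th (E k) x
  - bf (th (E j) x) w *: hess k x + bf (th (E k) x) w *: hess j x.
Proof.
move=> Ax; have d a c : w *m dmx (E a) (om c) x = 2^-1 *: br (dmx (E a) (th (E c)) x) w
    + (bf w (dmx (E a) Phi x) *: th (E c) x + bf w (Phi x) *: dmx (E a) (th (E c)) x)
    - (bf w (dmx (E a) (th (E c)) x) *: Phi x + bf w (th (E c) x) *: dmx (E a) Phi x).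
  rewrite -(dmx_mull oA _ Ax w (som c)).
  rewrite (dmx_ext oA _ Ax (fun y _ => mul_om c y w)) /lc_conf.
  have s1 : smm A (fun y => br (th (E c) y) w) by exact: (smm_lin oA (br_linl w) (sth _)).
  have s2 : smm A (fun y => bf w (Phi y) *: th (E c) y).
    by apply: (smmZ oA); [exact: sm_bf|exact: sth].
  have s3 : smm A (fun y => bf w (th (E c) y) *: Phi y).
    by apply: (smmZ oA) => //; apply: sm_bf; exact: sth.
  have s4 : smm A (fun y => 2^-1 *: br (th (E c) y) w).
    by apply: (smmZ oA) => //; exact: sm_cst.
  rewrite (dmxB oA _ Ax (smmD oA s4 s2) s3) (dmxD oA _ Ax s4 s2).
  rewrite (dmxZ oA _ Ax (sm_cst _ _) s1) derive_cst scale0r add0r.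
  rewrite (dmx_lin oA _ Ax (br_linl w) (sth _)).
  rewrite (dmxZ oA _ Ax (sm_bf w sPhi) (sth _)) (dmxZ oA _ Ax (sm_bf w (sth _)) sPhi).
  by rewrite !deriv_bf //; exact: sth.
have := @curvature_algebra (Phi x) (th (E k) x) (th (E j) x) (dmx (E k) Phi x)
  (dmx (E j) Phi x) (dmx (E k) (th (E j)) x) (dmx (E j) (th (E k)) x) w.
rewrite -(maurer_cartan_eq (E k) (E j) Ax) [X in _ = X -> _]addrC subrK => /(_ erefl) <-.
have -> : w *m curv om k j x = w *m dmx (E k) (om j) x - w *m dmx (E j) (om k) x
    + w *m om j x *m om k x - w *m om k x *m om j x.
  by rewrite /curv mulmxBr mulmxDr mulmxBr !mulmxA.
congr (_ - _ + _ - _); [exact: d|exact: d|..].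
- by rewrite (mul_om j x w) (mul_om k x (lc_conf _ _ _)).
- by rewrite (mul_om k x w) (mul_om j x (lc_conf _ _ _)).
Qed.

Let co (v x : vec) k := (v *m Lm x) 0 k.

Let coD u v x k : co (u + v) x k = co u x k + co v x k.
Proof. by rewrite /co mulmxDl mxE. Qed.
Let coZ a v x k : co (a *: v) x k = a * co v x k.
Proof. by rewrite /co -scalemxAl mxE. Qed.
Let coN v x k : co (- v) x k = - co v x k.
Proof. by rewrite -scaleN1r coZ mulN1r. Qed.

Lemma frame_decomp x v : A x -> v = \sum_k (v *m Lm x) 0 k *: th (E k) x.
Proof.
move=> Ax; rewrite -[LHS]mulmx1 -(LmTh Ax) mulmxA [v *m Lm x in LHS]row_sum_delta.
by rewrite mulmx_suml; apply: eq_bigr => k _; rewrite -scalemxAl.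
Qed.

Definition hess_trace x := \sum_k (hess k x *m Lm x) 0 k.

(** The classical formula for the Ricci tensor under a conformal change, with [- 4^-1] times the
    Killing form as bi-invariant Ricci tensor. The coefficient [n - 1] arises because [hess_trace]
    is the Laplacian minus the squared norm of [Phi]. *)
Lemma conformal_ricci i j x : A x -> ricci g x i j =
  - 4^-1 * \tr (adm (th (E j) x) *m adm (th (E i) x))
  - (n%:R - 2) * bf (hess j x) (th (E i) x)
  - (hess_trace x + (n%:R - 1) * bf (Phi x) (Phi x)) * bf (th (E j) x) (th (E i) x).
Proof.
move=> Ax; rewrite (frame_ricci oA svt sLt som Ltvt Bsym Bu skew vtE torsion) //.
set w := th (E i) x; set Y := th (E j) x.
have coth a k : co (th (E a) x) x k = (a == k)%:R.
  by rewrite /co /th -mulmxA ThLm // mulmx1 mxE eqxx [k == a]eq_sym.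
rewrite (eq_bigr (fun k => co (w *m curv om k j x) x k)); last first.
  move=> k _.
  transitivity ((E i *m (vt x *m curv om k j x *m Lt x)) 0 k); first by rewrite -rowE [RHS]mxE.
  have -> : vt x *m curv om k j x *m Lt x = Th x *m curv om k j x *m Lm x.
    by rewrite /vt /Lt -!scalemxAl -scalemxAr scalerA -expRD subrr expR0 scale1r.
  by rewrite /co /w /th !mulmxA.
rewrite (eq_bigr (fun k => - 4^-1 * co (br (br (th (E k) x) Y) w) x k
  + (bf (hess k x) w + bf (Phi x) (Phi x) * bf (th (E k) x) w) * (j == k)%:R
  - (bf (hess j x) w + bf (Phi x) (Phi x) * bf Y w)
  - bf Y w * co (hess k x) x k + co (hess j x) x k * bf (th (E k) x) w)); last first.
  move=> k _; rewrite curvE // -/Y -/w; move: (hess k x) (hess j x) => hk hj.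
  rewrite !(coD, coN, coZ) !coth eqxx /=; gen_bf.
  move: (co (br _ _) x k) (co hk x k) (co hj x k) (j == k)%:R => c1 c2 c3 c4.
  by ring.
rewrite !big_split /= -!mulr_sumr !sumrN sumr_const card_ord -!mulr_sumr.
(* Antisymmetry twice turns [br (br v Y) w] into [br w (br Y v)], whose trace in [v] is the Killing
   form. *)
have -> : \sum_k co (br (br (th (E k) x) Y) w) x k = \tr (adm Y *m adm w).
  transitivity (\tr (Th x *m (adm Y *m adm w) *m Lm x)); last first.
    by rewrite [LHS]mxtrace_mulC (mulmxA (Lm x) (Th x)) LmTh // mul1mx.
  apply: eq_bigr => k _; rewrite (brC _ w) (brC _ Y) brNr opprK -!mul_adm.
  by rewrite /co /th -!mulmxA -rowE [LHS]mxE.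
have -> : \sum_k (bf (hess k x) w + bf (Phi x) (Phi x) * bf (th (E k) x) w) * (j == k)%:R
    = bf (hess j x) w + bf (Phi x) (Phi x) * bf Y w.
  rewrite (bigD1 j) //= eqxx mulr1 big1 ?addr0 // => k; rewrite eq_sym => /negPf ->.
  by rewrite mulr0.
have -> : \sum_k co (hess j x) x k * bf (th (E k) x) w = bf (hess j x) w.
  rewrite [in RHS](frame_decomp (hess j x) Ax) bf_sym bf_sumr; apply: eq_bigr => k _.
  by rewrite bfZr bf_sym.
rewrite -/(hess_trace x) -[_ *+ n]mulr_natr; gen_bf.
by move: (hess_trace x) (\tr _) => t1 t2; ring.
Qed.

Lemma smm_br (G H : vec -> vec) : smm A G -> smm A H -> smm A (fun y => br (G y) (H y)).
Proof.
move=> sG sH; apply: (smm_ext oA (M := fun y => H y *m adm (G y))).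
  by move=> y _; rewrite mul_adm.
by apply: (smmM oA) => //; exact: (smm_lin oA adm_lin).
Qed.

Lemma dmx_br (G H : vec -> vec) x v : smm A G -> smm A H -> A x ->
  dmx v (fun y => br (G y) (H y)) x = br (dmx v G x) (H x) + br (G x) (dmx v H x).
Proof.
move=> sG sH Ax; rewrite (dmx_ext oA _ Ax (N := fun y => H y *m adm (G y))); last first.
  by move=> y _; rewrite mul_adm.
rewrite (dmxM oA _ Ax sH (smm_lin oA adm_lin sG)) (dmx_lin oA _ Ax adm_lin sG).
by rewrite !mul_adm addrC.
Qed.

Lemma sm_bf2 (G H : vec -> vec) : smm A G -> smm A H -> sm A (fun y => bf (G y) (H y)).
Proof.
move=> sG sH; apply: (smmM oA); last exact: (smm_tr oA).
by apply: (smmM oA) => //; exact: smm_cst.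
Qed.

Lemma adm_br x y : adm (br x y) = adm y *m adm x - adm x *m adm y.
Proof.
apply: mx_rowP => v; rewrite mulmxBr !mulmxA !mul_adm br_leibniz.
by rewrite addrK.
Qed.

Definition killing u v : R := \tr (adm u *m adm v).

Lemma killing_inv z x y : killing (br z x) y = - killing x (br z y).
Proof.
apply/eqP; rewrite -addr_eq0; apply/eqP.
by rewrite /killing !adm_br mxtrace_commutator_inv.
Qed.

Definition Qm : 'M[R]_n := (\matrix_(i, j) killing (E i) (E j)) *m invmx Bm.

Lemma killing_lin u : scalar (killing u).
Proof.
by move=> a v w; rewrite /killing adm_lin mulmxDr -scalemxAr mxtraceD mxtraceZ.
Qed.

Lemma killing_sym u v : killing u v = killing v u.
Proof. exact: mxtrace_mulC. Qed.

Lemma bf_Qm u v : bf (u *m Qm) v = killing u v.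
Proof.
rewrite /bf /Qm mulmxA mulmxKV //.
have dec (w : vec) z : killing z w = \sum_j w 0 j * killing z (E j).
  pose D : {scalar vec} := HB.pack (killing z)
    (GRing.isLinear.Build R vec R *%R _ (killing_lin z)).
  rewrite -[LHS]/(D w) {1}[w]row_sum_delta linear_sum.
  by apply: eq_bigr => j _; rewrite linearZ.
rewrite dec mxE; apply: eq_bigr => j _; rewrite !mxE mulrC; congr (_ * _).
rewrite killing_sym dec; apply: eq_bigr => i _.
by rewrite !mxE killing_sym.
Qed.

(** Both forms are invariant, so the operator relating them commutes with brackets. *)
Lemma br_Qm x u : br x (u *m Qm) = br x u *m Qm.
Proof.
by apply: bf_ext => z; rewrite bf_br !bf_Qm killing_inv.
Qed.

Variable lam : R.
Hypothesis einstein : forall x, A x -> ricci g x = lam *: g x.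
Hypothesis n3 : (2 < n)%N.

Let n20 : n%:R - 2 != 0 :> R.
Proof. by rewrite subr_eq0 eqr_nat gtn_eqF. Qed.

(** [q] and [cc] come from solving [conformal_ricci] for [hess]: [q] is the [4^-1] of the Killing
    term over [n - 2], and [cc] collects the multiples of the metric. *)
Let cc x := (hess_trace x + (n%:R - 1) * bf (Phi x) (Phi x) + lam * expR (2 * phi x)) / (n%:R - 2).
Let q := (4 * (n%:R - 2))^-1 : R.

Let q0 : q != 0.
Proof. by rewrite invr_eq0 mulf_neq0 ?pnatr_eq0. Qed.

Lemma einstein_hess j x : A x ->
  hess j x = - (q *: (th (E j) x *m Qm)) - cc x *: th (E j) x.
Proof.
move=> Ax; apply: bf_ext => z; rewrite (frame_decomp z Ax) !bf_sumr.
apply: eq_bigr => i _; rewrite !bfZr; congr (_ * _).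
have := conformal_ricci i j Ax; move: (hess j x) => hj.
rewrite !bfE bf_Qm /killing einstein // mxE gE // mxE.
have -> : (Th x *m Bm *m (Th x)^T) i j = bf (th (E j) x) (th (E i) x).
  have -> : (Th x *m Bm *m (Th x)^T) i j
      = (E i *m (Th x *m Bm *m (Th x)^T) *m (E j)^T) 0 0.
    by rewrite trmx_delta -rowE -colE !mxE.
  by rewrite bf_sym /bf /th trmx_mul !mulmxA.
set K := \tr _; set H := bf hj _; set W := bf (th _ _) _ => e.
have -> : H = ((n%:R - 2) * H) / (n%:R - 2) by rewrite mulrC mulKf.
rewrite /q /cc invfM.
have -> : (n%:R - 2) * H = - 4^-1 * K - (hess_trace x + (n%:R - 1) * bf (Phi x) (Phi x)) * W
  - lam * (expR (2 * phi x) * W).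
  rewrite e; move: (K) (H) (W) (hess_trace x) (bf (Phi x) (Phi x)) (n%:R : R).
  by move=> k h w r p m; ring.
move: K H W (hess_trace x) (bf (Phi x) (Phi x)) (expR _) (n%:R - 2) {e} => k h w r p m d.
by move: (n%:R - 1) (4^-1) (d^-1) => d' f d1; ring.
Qed.

(* The Hessian equation for [phi] becomes linear in the gradient [F] of [exp (- phi)]. *)
Let u x := expR (- phi x).
Let F x := - u x *: Phi x.
Let hh x := u x * cc x.

Let su : sm A u. Proof. exact/(sm_exp oA)/(smN oA). Qed.
Let sF : smm A F. Proof. by apply: (smmZ oA) => //; exact: (smN oA). Qed.
Let sQ a : smm A (fun y => th a y *m Qm).
Proof. by apply: (smmM oA); [exact: sth|exact: smm_cst]. Qed.

Let shess j : smm A (hess j).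
Proof.
apply: (smmB oA); last by apply: (smmZ oA) => //; apply: sm_bf2 => //; exact: sth.
apply: (smmD oA); first exact: (smm_dmx oA).
by apply: (smmZ oA); [exact: sm_cst | apply: smm_br => //; exact: sth].
Qed.

Let shh : sm A hh.
Proof.
apply: (smM oA) => //; apply: (smM oA); last exact: sm_cst.
apply: (smD oA); first apply: (smD oA).
- by apply: (sm_sum oA) => k; apply: (smmM oA).
- by apply: (smM oA); [exact: sm_cst | exact: sm_bf2].
apply: (smM oA); first exact: sm_cst.
by apply: (sm_exp oA); apply: (smM oA) => //; exact: sm_cst.
Qed.

Let deriv_u a x : A x -> 'D_a u x = bf (F x) (th a x).
Proof.
move=> Ax; rewrite (smderiv_exp _ Ax (smN oA sphi)) (smderivN _ Ax sphi).
by rewrite -(bf_grad a sphi Ax) /F bfZl -/(u x); gen_bf; move: (u x) => ?; ring.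
Qed.

Let hess_dir a x : A x -> conf_hess (Phi x) (th a x) (dmx a Phi x)
  = - (q *: (th a x *m Qm)) - cc x *: th a x.
Proof.
move=> Ax; pose f v := conf_hess (Phi x) (th v x) (dmx v Phi x) + q *: (th v x *m Qm)
  + cc x *: th v x.
have flin : linear f.
  move=> c v w; rewrite /f /conf_hess (dmx_dir_lin sPhi Ax).
  have -> : th (c *: v + w) x = c *: th v x + th w x by rewrite /th mulmxDl -scalemxAl.
  move: (th v x) (th w x) (dmx v Phi x) (dmx w Phi x) (Phi x) (cc x) => p1 p2 p3 p4 p5 p6.
  by apply: bf_ext => z; rewrite mulmxDl -scalemxAl !(brE, bfE); gen_bf; ring.
pose fL : {linear vec -> vec} := HB.pack f (GRing.isLinear.Build R _ _ *:%R f flin).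
suff : f a = 0.
  by rewrite /f -addrA => /eqP; rewrite addr_eq0 opprD => /eqP.
rewrite -[f a]/(fL a) [a]row_sum_delta linear_sum big1 // => j _.
rewrite linearZ /= /f -/(hess j x) einstein_hess //.
by apply: bf_ext => z; rewrite !bfE bf0l; gen_bf; ring.
Qed.

(** Differentiating the factor [- u] of [F] produces the square of the differential of [phi] with
    the sign that cancels the quadratic term of [conf_hess]. *)
Lemma einstein_grad a x : A x -> dmx a F x =
  - (2^-1 *: br (th a x) (F x)) + (q * u x) *: (th a x *m Qm) + hh x *: th a x.
Proof.
move=> Ax; rewrite (dmxZ oA _ Ax (smN oA su) sPhi) (smderivN _ Ax su) deriv_u //.
have -> : dmx a Phi x = conf_hess (Phi x) (th a x) (dmx a Phi x)
    - 2^-1 *: br (th a x) (Phi x) + bf (Phi x) (th a x) *: Phi x.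
  by rewrite /conf_hess; apply: bf_ext => z; rewrite !bfE; gen_bf; ring.
rewrite hess_dir // /F /hh; move: (th a x) (Phi x) (cc x) (u x) => p1 p2 p3 p4.
apply: bf_ext => z; rewrite !(brE, bfE); gen_bf; ring.
Qed.

(* Integrability condition of the linear system [einstein_grad]. *)
Lemma einstein_prolongation a c x : A x ->
  4^-1 *: br (br (th a x) (th c x)) (F x) =
  - (q * bf (F x) (th a x)) *: (th c x *m Qm) + (q * bf (F x) (th c x)) *: (th a x *m Qm)
  - 'D_a hh x *: th c x + 'D_c hh x *: th a x.
Proof.
move=> Ax.
have DD v w : dmx v (dmx w F) x =
    - (2^-1 *: (br (dmx v (th w) x) (F x) + br (th w x) (dmx v F x)))
    + (q * bf (F x) (th v x)) *: (th w x *m Qm) + (q * u x) *: (dmx v (th w) x *m Qm)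
    + 'D_v hh x *: th w x + hh x *: dmx v (th w) x.
  rewrite (dmx_ext oA _ Ax (fun y Ay => einstein_grad w Ay)).
  have s1 : smm A (fun y => br (th w y) (F y)) by apply: smm_br => //; exact: sth.
  have s2 : smm A (fun y => 2^-1 *: br (th w y) (F y)) by apply: (smmZ oA) => //; exact: sm_cst.
  have s3 : sm A (fun y => q * u y) by apply: (smM oA) => //; exact: sm_cst.
  have s4 : smm A (fun y => (q * u y) *: (th w y *m Qm)) by exact: (smmZ oA).
  have s5 : smm A (fun y => hh y *: th w y) by apply: (smmZ oA) => //; exact: sth.
  rewrite (dmxD oA _ Ax (smmD oA (smmN oA s2) s4) s5) (dmxD oA _ Ax (smmN oA s2) s4).
  rewrite (dmxN oA _ Ax s2) (dmxZ oA _ Ax (sm_cst _ _) s1) derive_cst scale0r add0r.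
  rewrite (dmx_br _ (sth w) sF Ax) (dmxZ oA _ Ax s3 (sQ w)) (dmxZ oA _ Ax shh (sth w)).
  rewrite (smderivM _ Ax (sm_cst _ _) su) derive_cst mul0r add0r deriv_u //.
  by rewrite (dmx_mulr oA _ Ax _ (sth w)) !addrA.
(* Maurer-Cartan contributes half of the double bracket with [F], and the commutator of the two half
   brackets removes a quarter by the Jacobi identity, whence [4^-1]. *)
have := dmx_symm oA c a sF Ax; rewrite !DD !einstein_grad //.
have -> : dmx a (th c) x = dmx c (th a) x - br (th a x) (th c x).
  by rewrite -(maurer_cartan_eq a c Ax) addrC subrK.
move: (dmx c (th a) x) (th a x) (th c x) (F x) (u x) (hh x) ('D_a hh x) ('D_c hh x).
move=> P X Y G v w Da Dc e.
have {}e z := congr1 (fun v => bf v z) e.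
have jac z : bf (br X (br Y G)) z = bf (br (br X Y) G) z + bf (br Y (br X G)) z.
  by rewrite br_leibniz bfDl.
apply: bf_ext => z; move: (e z).
rewrite !mulmxBl !(brE, br_Qm) !bfE jac (brC Y X) !mulNmx !bfE; gen_bf.
lra.
Qed.

Lemma einstein_dichotomy x0 : A x0 ->
  (exists c, forall X Y, killing X Y = c * bf X Y) \/
  (exists (T : vec) (eta : vec -> R) (r : R), [/\ T != 0, r != 0, scalar eta &
    forall X Y Z, 4^-1 * bf (br (br X Y) T) Z = bf T X * (r * killing Y Z)
      - bf T Y * (r * killing X Z) - eta X * bf Y Z + eta Y * bf X Z]).
Proof.
move=> Ax0.
have thL X x : A x -> th (X *m Lm x) x = X.
  by move=> Ax; rewrite /th -mulmxA LmTh // mulmx1.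
have [[x [Ax Fx]]|noF] := pselect (exists x, A x /\ F x != 0).
  (* [th] is onto, with preimage [X *m Lm x], so [eta] is the differential of [hh] read in the
     algebra. *)
  right; exists (F x), (fun X => 'D_(X *m Lm x) hh x), (- q); split.
  - by [].
  - by rewrite oppr_eq0.
  - move=> c X Y; rewrite mulmxDl -scalemxAl; exact: (smderiv_lin shh Ax).
  move=> X Y Z; have := einstein_prolongation (X *m Lm x) (Y *m Lm x) Ax.
  rewrite !thL // => /(congr1 (fun v => bf v Z)).
  move: (F x) ('D__ hh x) ('D__ hh x) => G Da Dc.
  rewrite !bfE !bf_Qm; gen_bf; move: (killing X Z) (killing Y Z) => k1 k2; lra.
left; have F0 x : A x -> F x = 0.
  by move=> Ax; apply/eqP; apply: contrapT => /negP h; apply: noF; exists x.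
have u0 : u x0 != 0 by rewrite gt_eqF // expR_gt0.
(* Where [F] vanishes identically, [einstein_grad] reads [0 = (q * u) Q X + hh X]. *)
exists (- hh x0 / (q * u x0)) => X Y.
have := einstein_grad (X *m Lm x0) Ax0.
rewrite (dmx_ext oA _ Ax0 F0) dmx_cst F0 // br0r scaler0 oppr0 add0r thL //.
move=> /(congr1 (fun v => bf v Y)); rewrite bf0l bfDl !bfZl bf_Qm => e.
have qu0 := mulf_neq0 q0 u0; apply: (mulfI qu0); move: e qu0.
move: (q * u x0) (hh x0) (bf X Y) (killing X Y) => k h b K e k0.
have -> : k * (- h / k * b) = - (h * b) by field.
by apply/eqP; rewrite -addr_eq0 -e.
Qed.

End Conformal.
End BracketForm.

(** * Lie groups in a chart *)

Lemma smooth_on_ck (R : realType) (V W : normedModType R) (A : set V) (f : V -> W) k :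
  smooth_on A f -> ck k A f.
Proof.
elim: k f => [|k IH] f sf; split=> [x Ax|//]; try exact: (sf [::]).
move=> v; apply: IH => vs x Ax.
by have := sf (rcons vs v) x Ax; rewrite foldr_rcons.
Qed.

Lemma derive_chain (R : realType) (U V W : normedModType R) (f : U -> V) (g : V -> W)
    (x u : U) (y : V) : f x = y -> differentiable f x -> differentiable g y ->
  'D_u (g \o f) x = 'D_('D_u f x) g y.
Proof.
move=> <- df dg; rewrite !deriveE //; last exact: differentiable_comp.
by rewrite diff_comp.
Qed.

Lemma dmx_inv_eq (R : realType) n (M N P Q : 'M[R]_n) : N *m M = 1%:M ->
  P *m N + M *m Q = 0 -> Q = - (N *m P *m N).
Proof.
move=> NM /(congr1 (mulmx N)).
rewrite mulmx0 mulmxDr !mulmxA NM mul1mx addrC => /eqP.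
by rewrite addr_eq0 => /eqP.
Qed.

(** The algebra behind [maurer_cartan_structure]: [M], [N] are the left translation matrix and its
    inverse, [P], [Q] derivatives of [M], [P0], [Q0] those at the unit. [P1], [Q1] are second
    derivatives of the product, which drop out by their symmetry. *)
Lemma structure_eq (R : realType) n (M N P Q P0 Q0 P1 Q1 : 'M[R]_n) (a b : 'rV[R]_n) :
  M *m N = 1%:M -> a *m N *m Q1 = b *m N *m P1 ->
  P = P0 *m M + P1 -> Q = Q0 *m M + Q1 ->
  b *m (- (N *m P *m N)) - a *m (- (N *m Q *m N)) =
    - (b *m N *m P0 - a *m N *m Q0).
Proof.
move=> MN e -> ->; rewrite !mulmxN !(mulmxDr, mulmxDl) !mulmxA e.
have k (X : 'M[R]_n) (w : 'rV[R]_n) : w *m N *m X *m M *m N = w *m N *m X.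
  by rewrite -[LHS]mulmxA MN mulmx1.
by rewrite !k opprK opprD addrACA addNr addr0 opprB addrC.
Qed.

Section Group.
Variables (R : realType) (n : nat) (G : lieGroup R n) (c : chart R n G).
Hypotheses (ac : lg_atlas c) (ce : cdom c (lg_one G)).
Local Notation vec := 'rV[R]_n.
Local Notation E i := (delta_mx 0 i : vec).
Local Notation kap := (cinv c).
Local Notation x0 := (c (lg_one G)).
Local Notation "p '.*' q" := (lg_mul p q) (at level 40).

Lemma lg_mulVr (p : G) : p .* lg_inv p = lg_one G.
Proof.
rewrite -[LHS]lg_mul1 -{1}(lg_mulV (lg_inv p)) -lg_mulA (lg_mulA (lg_inv p) p) lg_mulV.
by rewrite lg_mul1 lg_mulV.
Qed.

Lemma lg_mulr1 (p : G) : p .* lg_one G = p.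
Proof. by rewrite -(lg_mulV p) lg_mulA lg_mulVr lg_mul1. Qed.

Definition chart_img : set vec := c @` cdom c.
Local Notation O := chart_img.

Lemma chart_img_open : open O. Proof. exact: cimg_open. Qed.

Lemma chart_img0 : O x0. Proof. by exists (lg_one G). Qed.

Lemma cinvK x : O x -> c (kap x) = x.
Proof. by move=> [p dp <-]; rewrite cmapK. Qed.

Lemma cinv_dom x : O x -> cdom c (kap x).
Proof. by move=> [p dp <-]; rewrite cmapK. Qed.

Definition mu (z : vec * vec) : vec := c (kap z.1 .* kap z.2).

Definition mu_dom : set (vec * vec) :=
  [set z | [/\ O z.1, O z.2 & cdom c (kap z.1 .* kap z.2)]].

Lemma mu_ck k : ck k mu_dom mu.
Proof.
apply: ck_sub (smooth_on_ck k (lg_mul_smooth ac ac ac)) => -[x y] [/= Ox Oy d].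
exists (kap x, kap y); last by rewrite /= !cinvK.
by split=> //; exact: cinv_dom.
Qed.

Lemma mu_dom_open : open mu_dom.
Proof.
rewrite openE => -[x y] [/= Ox Oy d]; rewrite /interior /=.
have cx : {for x, continuous kap} by exact: cinv_cont.
have cy : {for y, continuous kap} by exact: cinv_cont.
have nd : nbhs (kap x .* kap y) (cdom c).
  by apply: open_nbhs_nbhs; split=> //; exact: cdom_open.
have [[P Q] /= [Px Qy] PQ] := @lg_mul_cont _ _ G (kap x, kap y) _ nd.
have nO z : O z -> nbhs z O.
  by move=> Oz; apply: open_nbhs_nbhs; split=> //; exact: chart_img_open.
exists (O `&` kap @^-1` P, O `&` kap @^-1` Q) => /=.
  by split; apply: filterI; [exact: nO|exact: cx|exact: nO|exact: cy].
by move=> -[x' y'] [/= [Ox' Px'] [Oy' Qy']]; split=> //=; exact: (PQ (kap x', kap y')).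
Qed.

Lemma mu0r x : O x -> mu (x, x0) = x.
Proof. by move=> Ox; rewrite /mu /= cmapK // lg_mulr1 cinvK. Qed.

Lemma mu_dom0r x : O x -> mu_dom (x, x0).
Proof.
move=> Ox; split=> //=; first exact: chart_img0.
by rewrite cmapK // lg_mulr1; exact: cinv_dom.
Qed.

Lemma kap_mu x y : mu_dom (x, y) -> kap (mu (x, y)) = kap x .* kap y.
Proof. by move=> [/= _ _ d]; rewrite /mu cmapK. Qed.

Lemma mu_img x y : mu_dom (x, y) -> O (mu (x, y)).
Proof. by move=> [/= _ _ d]; exists (kap x .* kap y). Qed.

Lemma mu_dom_near x y : mu_dom (x, y) -> \forall z \near y, mu_dom (x, z).
Proof.
move=> d; have := mu_dom_open; rewrite openE => /(_ _ d) [[P Q] /= [Px Qy] PQ].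
by apply: filterS Qy => z Qz; apply: PQ; split=> //=; exact: nbhs_singleton.
Qed.

Lemma mu_diffr x y : mu_dom (x, y) -> differentiable (fun z => mu (x, z)) y.
Proof.
move=> d; have : ck 0 [set z | mu_dom (x, z)] (fun z => mu (x, z)).
  by apply: (ck_pairr _ (mu_ck 0)).
by move=> /ck_diff; apply.
Qed.

Definition left_mx x : 'M[R]_n := \matrix_(i, j) left_field c (E i) x 0 j.
Definition mc_mx x : 'M[R]_n := \matrix_(i, j) maurer_cartan c c x (E i) 0 j.

Lemma lin_row_mx (D : vec -> vec) u : linear D ->
  u *m (\matrix_(i, j) D (E i) 0 j) = D u.
Proof.
move=> Dlin; pose DL : {linear vec -> vec} := HB.pack D (GRing.isLinear.Build R _ _ *:%R D Dlin).
rewrite -[RHS]/(DL u) [u in RHS]row_sum_delta linear_sum.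
apply/rowP => j; rewrite mxE summxE; apply: eq_bigr => i _.
by rewrite linearZ !mxE.
Qed.

Lemma left_fieldE x u : O x -> left_field c u x = 'd (fun y => mu (x, y)) x0 u.
Proof. by move=> Ox; rewrite /left_field [LHS]deriveE //; exact/mu_diffr/mu_dom0r. Qed.

Lemma mul_left_mx x u : O x -> u *m left_mx x = left_field c u x.
Proof.
move=> Ox; apply: (@lin_row_mx (fun u => left_field c u x)) => a v w.
by rewrite !left_fieldE // linearP.
Qed.

Lemma left_mx0 : left_mx x0 = 1%:M.
Proof.
apply/row_matrixP => i; rewrite !rowE mul_left_mx ?mulmx1; last exact: chart_img0.
rewrite /left_field; have -> : 'D_(E i) (fun y => c (kap x0 .* kap y)) x0 = 'D_(E i) id x0.
  apply: near_eq_derive; near=> y; rewrite cmapK // lg_mul1 cinvK //.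
  by near: y; apply: open_nbhs_nbhs; split; [exact: chart_img_open|exact: chart_img0].
exact: derive_id.
Unshelve. all: by end_near. Qed.

Lemma smm_left_mx : smm O left_mx.
Proof.
move=> i j k.
have h : ck k O (fun x => 'D_(0, E i) mu (x, x0)).
  exact: (ck_pairl (fun x Ox => mu_dom0r Ox) (ck_deriv (0, E i) (mu_ck k.+1))).
apply: ck_ext (ck_entry 0 j chart_img_open h); first exact: chart_img_open.
by move=> x Ox; rewrite mxE derive_pairr.
Qed.

Definition psi x y := c (lg_inv (kap x) .* kap y).

(** The inverse of [cinv c x] may leave the chart [c], so it is read in a chart [c1] around it and
    then kept fixed. *)
Lemma psi_diff x : O x -> differentiable (psi x) x.
Proof.
move=> Ox; have [c1 ac1 d1] := lg_cover (lg_inv (kap x)).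
have := smooth_on_ck 0 (lg_mul_smooth ac1 ac ac).
set f1 := (fun z : vec * vec => _); set Om := [set _ | _ in _] => h.
have : ck 0 [set z | Om (c1 (lg_inv (kap x)), z)] (fun z => f1 (c1 (lg_inv (kap x)), z)).
  by apply: (ck_pairr _ h).
have -> : (fun z => f1 (c1 (lg_inv (kap x)), z)) = psi x.
  by apply/funext => z; rewrite /f1 /psi /= cmapK.
move=> /ck_diff; apply; exists (lg_inv (kap x), kap x); last by rewrite /= cinvK.
by split=> //=; [exact: cinv_dom|rewrite lg_mulV].
Qed.

Lemma mc_psi x a : O x -> maurer_cartan c c x a = 'd (psi x) x a.
Proof. by move=> Ox; rewrite /maurer_cartan [LHS]deriveE //; exact: psi_diff. Qed.

Lemma mul_mc_mx x a : O x -> a *m mc_mx x = maurer_cartan c c x a.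
Proof.
move=> Ox; apply: (@lin_row_mx (fun a => maurer_cartan c c x a)) => b v w.
by rewrite !mc_psi // linearP.
Qed.

(** Translation by the inverse undoes translation by the element near the unit; the chain rule gives
    inverse differentials. *)
Lemma left_mc x : O x -> left_mx x *m mc_mx x = 1%:M.
Proof.
move=> Ox; apply/row_matrixP => i; rewrite !rowE mulmx1 mulmxA mul_left_mx // mul_mc_mx //.
have dm := mu_diffr (mu_dom0r Ox).
transitivity ('D_(E i) (psi x \o (fun y => mu (x, y))) x0).
  by rewrite (derive_chain (f := fun z => mu (x, z)) (E i) (mu0r Ox) dm (psi_diff Ox)).
have -> : 'D_(E i) (psi x \o (fun y => mu (x, y))) x0 = 'D_(E i) id x0.
  apply: near_eq_derive; have := mu_dom_near (mu_dom0r Ox); apply: filterS => y d.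
  rewrite /= /psi kap_mu // lg_mulA lg_mulV lg_mul1 cinvK //.
  by case: d.
exact: derive_id.
Qed.

Lemma mc_mxE x : O x -> mc_mx x = invmx (left_mx x).
Proof.
move=> Ox; have e := left_mc Ox; have [u _] := mulmx1_unit e.
by rewrite -[RHS]mulmx1 -e mulKmx.
Qed.

(** Smoothness is inherited from [left_mx] by matrix inversion, which avoids differentiating the
    group inverse in the definition. *)
Lemma smm_mc_mx : smm O mc_mx.
Proof.
apply: (smm_ext chart_img_open (M := fun x => invmx (left_mx x))).
  by move=> x Ox; rewrite mc_mxE.
apply: (smm_inv chart_img_open); last exact: smm_left_mx.
by move=> x Ox; have [u _] := mulmx1_unit (left_mc Ox).
Qed.

Definition mu_jac x y : 'M[R]_n :=
  \matrix_(i, j) 'D_(E i) (fun z => mu (x, z)) y 0 j.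
Definition mu_sec x : set vec := [set y | mu_dom (x, y)].

Lemma mu_sec_open x : open (mu_sec x).
Proof. by rewrite openE => y d; exact: mu_dom_near. Qed.

Lemma mul_mu_jac x y u : mu_dom (x, y) -> u *m mu_jac x y = 'D_u (fun z => mu (x, z)) y.
Proof.
move=> d; apply: (@lin_row_mx (fun u => 'D_u (fun z => mu (x, z)) y)) => a v w.
by rewrite !(deriveE _ (mu_diffr d)) linearP.
Qed.

Lemma mu_sec_ck x k : ck k (mu_sec x) (fun z => mu (x, z)).
Proof. by apply: (ck_pairr _ (mu_ck k)). Qed.

Lemma smm_mu_jac x : smm (mu_sec x) (mu_jac x).
Proof.
move=> i j k; have h := ck_deriv (E i) (mu_sec_ck x k.+1).
have oN := @mu_sec_open x.
have h' := ck_entry 0 j oN h.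
apply: (ck_ext oN _ h') => y d; by rewrite mxE.
Qed.

(** Associativity, differentiated in the third factor at the unit. *)
Lemma left_invariance x y : mu_dom (x, y) ->
  left_mx (mu (x, y)) = left_mx y *m mu_jac x y.
Proof.
move=> d; have Oy : O y by case: d.
apply/row_matrixP => i; rewrite !rowE mulmxA mul_left_mx; last exact: mu_img.
rewrite (mul_left_mx _ Oy) (mul_mu_jac _ d).
rewrite -(derive_chain (f := fun z => mu (y, z)) (E i) (mu0r Oy)
  (mu_diffr (mu_dom0r Oy)) (mu_diffr d)).
apply: near_eq_derive; apply: filterS (mu_dom_near (mu_dom0r Oy)) => z dz.
by rewrite /= -[RHS]/(c (kap x .* kap (mu (y, z)))) (kap_mu d) (kap_mu dz) lg_mulA.
Qed.

(* Derivative of [left_invariance] in [y] at the unit. *)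
Lemma left_mx_structure x v : O x -> dmx (v *m left_mx x) left_mx x =
  dmx v left_mx x0 *m left_mx x + dmx v (mu_jac x) x0.
Proof.
move=> Ox; have d0 := mu_dom0r Ox; have oN := @mu_sec_open x.
have sL : smm (mu_sec x) left_mx.
  by move=> i j k; apply: ck_sub (smm_left_mx i j k) => y [].
have J0 : mu_jac x x0 = left_mx x.
  by apply/row_matrixP => i; rewrite !rowE mul_mu_jac // mul_left_mx.
have := dmx_ext oN v d0 (M := fun y => left_mx (mu (x, y)))
  (fun y d => left_invariance d).
rewrite (dmxM oN _ d0 sL (smm_mu_jac x)) J0 left_mx0 mul1mx => <-.
apply/matrixP => i j; rewrite (mul_left_mx _ Ox).
rewrite [LHS]mxE.
rewrite [RHS]mxE.
have dl : differentiable (fun w => left_mx w i j) x by exact: sm_diff (smm_left_mx i j) Ox.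
have E := derive_chain (f := fun z => mu (x, z)) v (mu0r Ox) (mu_diffr d0) dl.
exact: esym E.
Qed.

(** Both sides are mixed second derivatives of the left translation by [x] at the unit. *)
Lemma mu_jac_symm x u v : O x ->
  u *m dmx v (mu_jac x) x0 = v *m dmx u (mu_jac x) x0.
Proof.
move=> Ox; have d0 := mu_dom0r Ox; have oN := @mu_sec_open x.
apply/rowP => j.
have e w z : (w *m dmx z (mu_jac x) x0) 0 j =
    'D_z (fun y => 'D_w (fun y => mu (x, y) 0 j) y) x0.
  rewrite -(dmx_mull oN _ d0 w (smm_mu_jac x)) mxE.
  apply: (deriv_sm_ext oN _ d0) => y dy; rewrite (mul_mu_jac _ dy).
  rewrite derive_mx ?mxE //; apply: diff_derivable; exact: mu_diffr.
have sj : sm (mu_sec x) (fun y => mu (x, y) 0 j).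
  by move=> k; apply: (ck_entry 0 j oN); exact: mu_sec_ck.
apply: etrans (e u v) _; apply: etrans (esym (e v u)).
exact: (smderiv_symm oN u v sj d0).
Qed.

Lemma lg_bracketE u v : lg_bracket c u v =
  v *m dmx u left_mx x0 - u *m dmx v left_mx x0.
Proof.
have O0 := chart_img0; have oO := chart_img_open.
have dl w z : 'D_w (left_field c z) x0 = z *m dmx w left_mx x0.
  transitivity ('D_w (fun y => z *m left_mx y) x0).
    apply: near_eq_derive; have : nbhs x0 O by apply: open_nbhs_nbhs.
    by apply: filterS => y Oy; rewrite mul_left_mx.
  have sz : smm O (fun y => z *m left_mx y).
    by apply: (smmM oO); [exact: smm_cst|exact: smm_left_mx].
  rewrite -(dmx_mull oO _ O0 z smm_left_mx) derive_mx //.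
  by apply/derivable_mxP => i j; exact: sm_derivable (sz i j) O0.
rewrite /lg_bracket /vf_bracket !dl.
by rewrite -!(mul_left_mx _ O0) left_mx0 !mulmx1.
Qed.

(** The form is the inverse of [left_mx], and [left_mx_structure] splits the derivative of the
    latter into a part taken at the unit, which yields the bracket, and a symmetric part, which
    cancels. *)
Lemma maurer_cartan_structure x a b : O x ->
  dmx a (fun y => b *m mc_mx y) x - dmx b (fun y => a *m mc_mx y) x
  = - lg_bracket c (a *m mc_mx x) (b *m mc_mx x).
Proof.
move=> Ox; have oO := chart_img_open.
have lmc := left_mc Ox; have mcl := mulmx1C lmc.
have dmc v : dmx v mc_mx x = - (mc_mx x *m dmx v left_mx x *m mc_mx x).
  have := dmx_ext oO v Ox (fun y Oy => left_mc Oy).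
  rewrite dmx_cst (dmxM oO _ Ox smm_left_mx smm_mc_mx).
  exact: dmx_inv_eq mcl.
have S w : dmx w left_mx x = dmx (w *m mc_mx x) left_mx x0 *m left_mx x
    + dmx (w *m mc_mx x) (mu_jac x) x0.
  have := left_mx_structure (w *m mc_mx x) Ox.
  have -> : w *m mc_mx x *m left_mx x = w by rewrite -(mulmxA w) mcl mulmx1.
  by [].
have e := mu_jac_symm (a *m mc_mx x) (b *m mc_mx x) Ox.
have E := structure_eq lmc e (S a) (S b).
have d (w : vec) (z : vec) := dmx_mull oO z Ox w smm_mc_mx.
have Ea := etrans (d b a) (congr1 (mulmx b) (dmc a)).
have Eb := etrans (d a b) (congr1 (mulmx a) (dmc b)).
have Ec := congr2 (fun X Y => X - Y) Ea Eb.
exact: etrans Ec (etrans E (congr1 -%R (esym (lg_bracketE _ _)))).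
Qed.

End Group.

Lemma scalar_row_sum (R : comNzRingType) n (D : 'rV[R]_n -> R) u : scalar D ->
  D u = \sum_i u 0 i * D (delta_mx 0 i).
Proof.
move=> Dlin; pose DL : {linear 'rV[R]_n -> R^o} :=
  HB.pack D (GRing.isLinear.Build R 'rV[R]_n R^o *:%R D Dlin).
rewrite -[LHS]/(DL u) [u in LHS]row_sum_delta linear_sum.
by apply: eq_bigr => i _; rewrite linearZ.
Qed.

(** * Transport between coordinates and the metric Lie algebra *)

Section Coordinates.
Variables (R : realType) (L : metricLie R) (n : nat).
Variables (f : 'rV[R]_n -> L) (g : L -> 'rV[R]_n).
Hypotheses (flin : linear f) (fK : cancel f g) (gK : cancel g f).
Local Notation vec := 'rV[R]_n.
Local Notation E i := (delta_mx 0 i : vec).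
Local Notation hL := (ml_invariant L).

Definition gram : 'M[R]_n := \matrix_(i, j) ml_form (f (E i)) (f (E j)).

Lemma bf_gram u v : bf gram u v = ml_form (f u) (f v).
Proof.
rewrite (@scalar_row_sum _ _ (fun v => ml_form (f u) (f v)) v); last first.
  by move=> a x y; rewrite flin (ifDr hL) (ifZr hL).
rewrite /bf mxE; apply: eq_bigr => j _; rewrite [X in _ * X]mxE mulrC; congr (_ * _).
rewrite (@scalar_row_sum _ _ (fun u => ml_form (f u) (f (E j))) u); last first.
  by move=> a x y; rewrite flin (ifDl hL) (ifZl hL).
by rewrite mxE; apply: eq_bigr => i _; rewrite mxE.
Qed.

Lemma gram_sym : gram^T = gram.
Proof. by apply/matrixP => i j; rewrite !mxE (if_sym hL). Qed.

Lemma gram_unit : gram \in unitmx.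
Proof.
rewrite -row_free_unit -kermx_eq0; apply/eqP/row_matrixP => i; rewrite row0.
have : row i (kermx gram) *m gram = 0 by rewrite -row_mul mulmx_ker row0.
move: (row i _) => u u0.
have fu0 : f u = 0.
  by apply: ml_nondeg => y; rewrite -(gK y) -bf_gram /bf u0 mul0mx mxE.
by rewrite -(fK u) fu0 (inv_lin0 flin fK gK).
Qed.

Variable br : vec -> vec -> vec.
Hypothesis f_br : forall u v, f (br u v) = lb (f u) (f v).

Lemma br_coordsE u v : br u v = g (lb (f u) (f v)).
Proof. by rewrite -f_br fK. Qed.

Lemma br_linearr x : linear (br x).
Proof. by move=> a u v; rewrite !br_coordsE flin lbDr lbZr (glin flin fK gK). Qed.

Lemma br_linearl y : linear (br^~ y).
Proof. by move=> a u v; rewrite !br_coordsE flin lbDl lbZl (glin flin fK gK). Qed.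

Lemma br_alternating x : br x x = 0.
Proof. by rewrite br_coordsE lb_alt (inv_lin0 flin fK gK). Qed.

Lemma br_jacobi x y z : br x (br y z) = br (br x y) z + br y (br x z).
Proof.
apply: (can_inj fK); rewrite -[X in _ = f (X + _)]scale1r flin scale1r !f_br.
exact: lb_leibniz.
Qed.

Lemma bf_gram_inv z x y : bf gram (br z x) y + bf gram x (br z y) = 0.
Proof. by rewrite !bf_gram !f_br; exact: (if_inv hL (f z)). Qed.

Lemma killing_trace_form u v : killing br u v = trace_form f g (f u) (f v).
Proof.
have e w : adm br w = adjoint_mx f g (f w).
  by congr lin1_mx; apply/funext => z; rewrite br_coordsE.
by rewrite /killing !e.
Qed.

Lemma dichotomy_transport :
  ((exists r, forall X Y, killing br X Y = r * bf gram X Y) \/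
   (exists (T : vec) (eta : vec -> R) (r : R), [/\ T != 0, r != 0, scalar eta &
    forall X Y Z, 4^-1 * bf gram (br (br X Y) T) Z =
      bf gram T X * (r * killing br Y Z) - bf gram T Y * (r * killing br X Z)
      - eta X * bf gram Y Z + eta Y * bf gram X Z])) ->
  (exists r, forall x y : L, trace_form f g x y = r * ml_form x y) \/
  (exists (T : L) (eta : L -> R) (r : R), [/\ T != 0, r != 0, scalar eta &
    forall X Y Z, 4^-1 * ml_form (lb (lb X Y) T) Z =
      ml_form T X * (r * trace_form f g Y Z) - ml_form T Y * (r * trace_form f g X Z)
      - eta X * ml_form Y Z + eta Y * ml_form X Z]).
Proof.
case=> [[r e]|[T [eta [r [T0 r0 etal e]]]]]; [left|right].
  by exists r => x y; rewrite -[x]gK -[y]gK -killing_trace_form e bf_gram.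
exists (f T), (fun x => eta (g x)), r; split=> //.
- by apply: contraNneq T0 => fT; rewrite -(fK T) fT (inv_lin0 flin fK gK).
- by move=> a x y; rewrite (glin flin fK gK) etal.
move=> X Y Z; have := e (g X) (g Y) (g Z).
by rewrite !killing_trace_form !bf_gram !f_br !gK.
Qed.

End Coordinates.

Lemma left_metricE (R : realType) (L : metricLie R) n (G : lieGroup R n) (c : chart R n G)
    (f : 'rV[R]_n -> L) x :
  lg_atlas c -> cdom c (lg_one G) -> linear f -> chart_img c x ->
  left_metric c (fun u v => ml_form (f u) (f v)) c x =
    mc_mx c x *m gram f *m (mc_mx c x)^T.
Proof.
move=> ac ce flin Ox; apply/matrixP => i j.
rewrite mxE -(bf_gram flin) -!(mul_mc_mx ac) //.
rewrite /bf trmx_mul trmx_delta.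
move: (mc_mx c x) (gram f) => M B.
by rewrite !mulmxA -colE -!mulmxA -rowE !mxE.
Qed.

(** All the analysis takes place near the unit, in the single chart [c] that also identifies the Lie
    algebra. *)
Lemma metric_einstein_dichotomy (R : realType) (L : metricLie R) n (G : lieGroup R n)
    (c : chart R n G) (f : 'rV[R]_n -> L) (g : L -> 'rV[R]_n) :
  lg_atlas c -> cdom c (lg_one G) -> linear f -> cancel f g -> cancel g f ->
  (forall u v, f (lg_bracket c u v) = lb (f u) (f v)) -> (2 < n)%N ->
  locally_conformally_einstein (left_metric c (fun u v => ml_form (f u) (f v))) ->
  (exists r, forall x y : L, trace_form f g x y = r * ml_form x y) \/
  (exists (T : L) (eta : L -> R) (r : R), [/\ T != 0, r != 0, scalar eta &
    forall X Y Z, 4^-1 * ml_form (lb (lb X Y) T) Z =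
      ml_form T X * (r * trace_form f g Y Z) - ml_form T Y * (r * trace_form f g X Z)
      - eta X * ml_form Y Z + eta Y * ml_form X Z]).
Proof.
move=> ac ce flin fK gK f_br n3 /(_ (lg_one G)) [U [phi [oU Ue sphi [lam einstein]]]].
have {}sphi := sphi _ ac; have {}einstein := einstein _ ac.
set A := c @` _ in sphi einstein.
have AO : A `<=` chart_img c by move=> _ [p [dp _] <-]; exists p.
(* Near a point of [A] the inverse chart is continuous and lands in the open set [U]. *)
have oA : open A.
  rewrite openE => x Ax; have Ox := AO _ Ax; rewrite /interior.
  have Ux : nbhs (cinv c x) U.
    by apply: open_nbhs_nbhs; split=> //; case: Ax => p [dp Up] <-; rewrite cmapK.
  have N1 : nbhs x (cinv c @^-1` U) by exact: (cinv_cont Ox).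
  have N2 : nbhs x (chart_img c).
    by apply: open_nbhs_nbhs; split=> //; exact: chart_img_open.
  apply: filterS2 N1 N2 => y Uy Oy; exists (cinv c y); last exact: cinvK.
  by split=> //; exact: cinv_dom.
have A0 : A (c (lg_one G)) by exists (lg_one G).
have sA m1 m2 (M : 'rV[R]_n -> 'M[R]_(m1, m2)) : smm (chart_img c) M -> smm A M.
  by move=> sM i j k; apply: ck_sub (sM i j k).
apply: (dichotomy_transport flin fK gK f_br).
apply: (einstein_dichotomy (br_linearr flin fK gK f_br) (br_linearl flin fK gK f_br)
  (br_alternating flin fK gK f_br) (br_jacobi flin fK f_br) (gram_sym f)
  (gram_unit flin fK gK) (bf_gram_inv flin f_br) oA (sA _ _ _ (smm_mc_mx ac ce))
  (sA _ _ _ (smm_left_mx ac ce)) (fun k => smooth_on_ck k sphi)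
  (fun x Ax => left_mc ac ce (AO x Ax))
  (fun x a b Ax => maurer_cartan_structure ac ce a b (AO x Ax)) _ einstein n3 A0).
by move=> x Ax; rewrite -(left_metricE ac ce flin) //; exact: AO.
Qed.

Theorem theorem1p4 (R : realType) (h : metricLie R) (s : lieAlgebra R)
  (b : s -> s -> R) (delta : s -> 'End(h))
  (hb : invariant_form b) (hdelta : skew_der_action delta) :
  lie_simple s ->
  conformally_einstein (double_ext hb hdelta) ->
  lie_iso s (sl_lie R 2) \/ lie_iso s (so_lie R 3).
Proof.
move=> simp [n [G [c [f [_ [ac ce] [flin [g fK gK]] f_br einstein]]]]].
have n3 := dext_dim_ge3 simp flin fK gK.
have [[r e]|[T [eta [r [T0 r0 etal key]]]]] :=
  metric_einstein_dichotomy ac ce flin fK gK f_br n3 einstein.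
  by case: (dext_not_einstein simp flin fK gK e).
exact: (dext_class simp flin fK gK T0 r0 etal key).
Qed.
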